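(* Let $\mathcal{G}$ be a second-countable locally compact Hausdorff étale groupoid, let $\sigma\in Z^2(\mathcal{G},\mathbb{T})$ be a normalized continuous $2$-cocycle, and suppose $\mathcal{G}$ has the $\sigma$-weak containment property. If $\ell^1(\mathrm{Iso}(\mathcal{G})^\circ,\sigma)$ is $C^*$-unique, then $\ell^1(\mathcal{G},\sigma)$ is $C^*$-unique.
   Context: Groupoids: $\mathcal{G}$ has unit space $\mathcal{G}^{(0)}$, range and source maps $r,s:\mathcal{G}\to\mathcal{G}^{(0)}$, and composable pairs $\mathcal{G}^{(2)}=\{(\alpha,\beta): s(\alpha)=r(\beta)\}$; all structure maps are continuous. It is étale if $r$ (hence $s$) is a local homeomorphism. For $x\in\mathcal{G}^{(0)}$ put $\mathcal{G}_x=\{\gamma: s(\gamma)=x\}$ and $\mathcal{G}^x=\{\gamma: r(\gamma)=x\}$. The isotropy subgroupoid is $\mathrm{Iso}(\mathcal{G})=\{\gamma\in\mathcal{G}: r(\gamma)=s(\gamma)\}$, and $\mathrm{Iso}(\mathcal{G})^\circ$ denotes its interior in $\mathcal{G}$, itself a second-countable locally compact Hausdorff étale groupoid with unit space $\mathcal{G}^{(0)}$. Cocycles: a normalized continuous $2$-cocycle on $\mathcal{G}$ is a continuous map $\sigma:\mathcal{G}^{(2)}\to\mathbb{T}$ with $\sigma(r(\gamma),\gamma)=1=\sigma(\gamma,s(\gamma))$ for all $\gamma$ and $\sigma(\alpha,\beta)\sigma(\alpha\beta,\gamma)=\sigma(\beta,\gamma)\sigma(\alpha,\beta\gamma)$ whenever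 $(\alpha,\beta),(\beta,\gamma)\in\mathcal{G}^{(2)}$. The set of these is $Z^2(\mathcal{G},\mathbb{T})$. The restriction of $\sigma$ to $\mathrm{Iso}(\mathcal{G})^\circ$ is also denoted $\sigma$. Algebras: $C_c(\mathcal{G},\sigma)$ is the space $C_c(\mathcal{G})$ of continuous compactly supported complex functions with product $(f*_\sigma g)(\gamma)=\sum_{\mu\in\mathcal{G}_{s(\gamma)}} f(\gamma\mu^{-1})g(\mu)\sigma(\gamma\mu^{-1},\mu)$ and involution $f^{*_\sigma}(\gamma)=\overline{\sigma(\gamma^{-1},\gamma)}\,\overline{f(\gamma^{-1})}$. The $I$-norm is $\|f\|_I=\sup_{x\in\mathcal{G}^{(0)}}\max\{\sum_{\gamma\in\mathcal{G}_x}|f(\gamma)|,\sum_{\gamma\in\mathcal{G}^x}|f(\gamma)|\}$, and $\ell^1(\mathcal{G},\sigma)$ is the Banach $*$-algebra obtained by completing $C_c(\mathcal{G},\sigma)$ in the $I$-norm. $\ell^1(\mathrm{Iso}(\mathcal{G})^\circ,\sigma)$ is defined in the same way from the groupoid $\mathrm{Iso}(\mathcal{G})^\circ$; extension of functions by zero identifies it isometrically with a Banach $*$-subalgebra of $\ell^1(\mathcal{G},\sigma)$. Weak containment: $C^*(\mathcal{G},\sigma)$ is the completion of $C_c(\mathcal{G},\sigma)$ in the norm $\|f\|=\sup\{\|\pi(f)\|:\pi \text{ an } I\text{-norm bounded } *\text{-representation}\}$. For $x\in\mathcal{G}^{(0)}$ let $L^{\sigma,x}:C_c(\mathcal{G},\sigma)\to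 B(\ell^2(\mathcal{G}_x))$ be given by $L^{\sigma,x}(f)\delta_\gamma=\sum_{\mu\in\mathcal{G}_{r(\gamma)}}\sigma(\mu,\gamma)f(\mu)\delta_{\mu\gamma}$. $C^*_r(\mathcal{G},\sigma)$ is the completion of $C_c(\mathcal{G},\sigma)$ in the norm coming from $\bigoplus_{x}L^{\sigma,x}$. $\mathcal{G}$ has the $\sigma$-weak containment property if the natural surjective $*$-homomorphism $C^*(\mathcal{G},\sigma)\to C^*_r(\mathcal{G},\sigma)$ is an isomorphism. $C^*$-uniqueness: a Banach $*$-algebra $\mathcal{A}$ is reduced if its $*$-representations on Hilbert spaces separate its points (the algebras above are reduced). A reduced Banach $*$-algebra $\mathcal{A}$ is $C^*$-unique if $\|a\|=\sup\{\|\pi(a)\|:\pi:\mathcal{A}\to B(\mathcal{H})\text{ a }*\text{-representation}\}$ is the only $C^*$-norm on $\mathcal{A}$ (a $C^*$-norm being an algebra norm with $\|a^*a\|=\|a\|^2$). *)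

(* Defs.v *)
From HB Require Import structures.
From mathcomp Require Import all_boot all_order all_algebra complex.
From mathcomp Require Import all_classical all_reals all_analysis.

Set Implicit Arguments.
Unset Strict Implicit.
Unset Printing Implicit Defensive.
Import Order.TTheory GRing.Theory Num.Theory numFieldNormedType.Exports.

Local Open Scope classical_set_scope.
Local Open Scope ring_scope.

(* MathComp-Analysis has no canonical topology on [R[i]] itself; we give it the
   one of its norm, which is what [R[i]^o] carries. *)
HB.instance Definition _ (R : realType) := PseudoPointedMetric.copy R[i] R[i]^o.
HB.instance Definition _ (R : realType) := NormedModule.copy R[i] R[i]^o.

(* Norms of modules over [R[i]] take their values in [R[i]]; this is the same
   norm, seen in [R]. *)
Definition rnorm (R : realType) (V : normedZmodType R[i]) (x : V) : R :=
  complex.Re `|x|.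

(* Supremum in [0, +oo] (0, rather than -oo, for the empty set). *)
Definition esup0 (R : realType) (S : set (\bar R)) : \bar R :=
  ereal_sup (0%E |` S).

(* [gmul] is total; it is only meaningful on composable pairs.  Units are
   identified with their identity arrows. *)
Record topGroupoid := TopGroupoid {
  arrow :> topologicalType;
  rng : arrow -> arrow;
  src : arrow -> arrow;
  gmul : arrow -> arrow -> arrow;
  ginv : arrow -> arrow;
  rng_rng : forall g, rng (rng g) = rng g;
  src_rng : forall g, src (rng g) = rng g;
  rng_src : forall g, rng (src g) = src g;
  src_src : forall g, src (src g) = src g;
  rng_mul : forall a b, src a = rng b -> rng (gmul a b) = rng a;
  src_mul : forall a b, src a = rng b -> src (gmul a b) = src b;
  gmulA : forall a b c, src a = rng b -> src b = rng c ->
    gmul (gmul a b) c = gmul a (gmul b c);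
  rng_gmul : forall g, gmul (rng g) g = g;
  gmul_src : forall g, gmul g (src g) = g;
  rng_inv : forall g, rng (ginv g) = src g;
  src_inv : forall g, src (ginv g) = rng g;
  gmulV : forall g, gmul g (ginv g) = rng g;
  gmulVl : forall g, gmul (ginv g) g = src g;
  rng_continuous : continuous rng;
  src_continuous : continuous src;
  ginv_continuous : continuous ginv;
  gmul_continuous : {within [set p : arrow * arrow | src p.1 = rng p.2],
                      continuous (fun p => gmul p.1 p.2)}
}.

Arguments rng {t} _.
Arguments src {t} _.
Arguments gmul {t} _ _.
Arguments ginv {t} _.

Section Groupoid.
Variable G : topGroupoid.

Definition units : set G := range rng.

Definition composable : set (G * G) := [set p | src p.1 = rng p.2].

Definition src_fibre (x : G) : set G := [set g | src g = x].

Definition rng_fibre (x : G) : set G := [set g | rng g = x].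

Definition iso_subgroupoid : set G := [set g | rng g = src g].

End Groupoid.

Arguments units : clear implicits.
Arguments composable : clear implicits.
Arguments iso_subgroupoid : clear implicits.

(* Every point has an open neighbourhood [U] that [f] maps homeomorphically,
   with inverse [k], onto a relatively open subset of [Z]. *)
Definition local_homeo (X Y : topologicalType) (f : X -> Y) (Z : set Y) : Prop :=
  continuous f /\
  forall x, exists (U : set X) (W : set Y) (k : Y -> X),
    [/\ open_nbhs x U, open W, f @` U = W `&` Z,
        {in U, cancel f k} & {within f @` U, continuous k}].

Definition etale (G : topGroupoid) : Prop := local_homeo (@rng G) (units G).

Definition iso_set (G : topGroupoid) : set G := (iso_subgroupoid G)°.
Arguments iso_set : clear implicits.

Section IsoInterior.
Variables (G : topGroupoid) (etG : etale G).
Local Notation A := (iso_set G).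

Lemma iso_interior_rng (g : G) : A (rng g).
Proof.
have [_ /(_ (rng g)) [U [W [k [[oU Ux] _ _ kU _]]]]] := etG.
have nU : nbhs (rng g) U by exact: open_nbhs_nbhs.
have nrU : nbhs (rng g) (rng @^-1` U).
  by apply: rng_continuous; rewrite rng_rng.
apply: filterS (filterI nU nrU) => h [Uh Urh] /=.
have kh := kU h (mem_set Uh).
have krh := kU (rng h) (mem_set Urh).
have hE : h = rng h by rewrite -[LHS]kh -[in RHS]krh rng_rng.
by rewrite /iso_subgroupoid /= [in RHS]hE src_rng.
Qed.

Lemma iso_interior_iso (g : G) : A g -> rng g = src g.
Proof. by move=> /interior_subset. Qed.

Lemma iso_interior_src (g : G) : A (src g).
Proof. by rewrite -rng_src; exact: iso_interior_rng. Qed.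

Lemma ginvK (g : G) : ginv (ginv g) = g.
Proof.
rewrite -[LHS]gmul_src src_inv rng_inv -gmulVl -gmulA ?src_inv ?rng_inv //.
by rewrite gmulVl src_inv rng_gmul.
Qed.

Lemma iso_interior_inv (g : G) : A g -> A (ginv g).
Proof.
move=> Ag; have : nbhs (ginv g) (ginv @^-1` iso_subgroupoid G).
  by apply: ginv_continuous; rewrite ginvK.
apply: filterS => h /=.
by rewrite /iso_subgroupoid /= rng_inv src_inv.
Qed.

Lemma iso_interior_mul (a b : G) :
  A a -> A b -> src a = rng b -> A (gmul a b).
Proof.
move=> Aa Ab ab.
have [_ /(_ a) [U [W [k [[oU Ua] oW fU kU kc]]]]] := etG.
have ka : k (rng a) = a := kU a (mem_set Ua).
have [Wra _] : (W `&` units G) (rng a) by rewrite -fU; exists a.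
have rab : rng (gmul a b) = rng a by exact: rng_mul.
have rW : nbhs (gmul a b) (rng @^-1` W).
  by apply: rng_continuous; rewrite rab; exact: open_nbhs_nbhs.
have rk : k \o rng @ gmul a b --> a.
  move=> V nV; rewrite /fmap /=.
  have : (k @ within (rng @` U) (nbhs (rng a))) V.
    move/subspace_continuousP: kc => /(_ (rng a)); apply; first by exists a.
    by rewrite /from_subspace ka.
  rewrite /fmap /within /= => nk.
  have := @rng_continuous G (gmul a b) _; rewrite rab => /(_ _ nk) nk'.
  apply: filterS (filterI rW nk') => h [Wh]; apply.
  by have : (W `&` units G) (rng h); [split => //; exists h|rewrite -fU].
pose v h := gmul (ginv (k (rng h))) h.
have vU : nbhs (gmul a b) [set h | exists2 u, U u & rng u = rng h].
  apply: filterS rW => h Wh.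
  have : (W `&` units G) (rng h) by split => //; exists h.
  by rewrite -fU => -[u Uu ruh]; exists u.
have vc : v @ gmul a b --> b.
  have vab : v (gmul a b) = b.
    rewrite /v rab ka -gmulA ?src_inv ?gmulVl //.
    by rewrite ab rng_gmul.
  move=> V nV.
  have := @gmul_continuous G => /subspace_continuousP.
  move=> /(_ (ginv a, gmul a b)) /= /(_ _ V).
  rewrite /from_subspace /= src_inv rab => /(_ erefl).
  rewrite [gmul (ginv a) _](_ : _ = b); last by rewrite -[RHS]vab /v rab ka.
  move=> /(_ nV) nm.
  have pc : (fun h => (ginv (k (rng h)), h)) @ gmul a b --> (ginv a, gmul a b).
    apply: cvg_pair; last exact: cvg_id.
    by apply: cvg_comp rk _; exact: ginv_continuous.
  have := pc _ nm; rewrite /fmap /= => nm'.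
  apply: filterS (filterI vU nm') => h [[u Uu ruh]] /=; apply.
  by rewrite src_inv -ruh kU ?inE.
have nA : nbhs (gmul a b) ((k \o rng) @^-1` iso_subgroupoid G) by exact: rk.
have nB : nbhs (gmul a b) (v @^-1` iso_subgroupoid G) by exact: vc.
apply: filterS (filterI vU (filterI nA nB)) => h [[u Uu ruh]] [].
rewrite /iso_subgroupoid /v /= -ruh kU ?inE // => ru vh.
have uh : src (ginv u) = rng h by rewrite src_inv.
by move: vh; rewrite rng_mul // src_mul // rng_inv -ru ruh.
Qed.

Definition iso_rng (g : A) : A :=
  exist _ (rng (val g)) (mem_set (iso_interior_rng (val g))).

Definition iso_src (g : A) : A :=
  exist _ (src (val g)) (mem_set (iso_interior_src (val g))).

Definition iso_inv (g : A) : A :=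
  exist _ (ginv (val g)) (mem_set (iso_interior_inv (set_valP g))).

Definition iso_mul (a b : A) : A := insubd a (gmul (val a) (val b)).

Lemma val_iso_mul (a b : A) : src (val a) = rng (val b) ->
  val (iso_mul a b) = gmul (val a) (val b).
Proof.
move=> ab; rewrite /iso_mul val_insubd ifT //; apply: mem_set.
by apply: iso_interior_mul => //; exact: set_valP.
Qed.

Lemma iso_composable (a b : A) :
  iso_src a = iso_rng b -> src (val a) = rng (val b).
Proof. by move=> /(congr1 val). Qed.

Lemma val_continuous : continuous (val : A -> G).
Proof. exact: initial_continuous. Qed.

Lemma to_iso_continuous (T : topologicalType) (F : set_system T)
    (FF : Filter F) (f : T -> A) (x : A) :
  (fun t => val (f t)) @ F --> val x -> f @ F --> x.
Proof.
move=> fx V [_ [[B oB <-] Bx] BV].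
have nB : nbhs (val x) B by exact: open_nbhs_nbhs.
have := fx B nB; rewrite nbhs_filterE /fmap /=; apply: filterS => t Bt; exact: BV.
Qed.

Lemma iso_mul_continuous :
  {within [set p : A * A | iso_src p.1 = iso_rng p.2],
    continuous (fun p => iso_mul p.1 p.2)}.
Proof.
apply/subspace_continuousP => -[a b] /= /iso_composable ab.
apply: to_iso_continuous => V; rewrite /from_subspace /= val_iso_mul // => nV.
have := @gmul_continuous G => /subspace_continuousP.
move=> /(_ (val a, val b) ab _ nV); rewrite /from_subspace /fmap /within /=.
move=> nm.
have pc : (fun p : A * A => (val p.1, val p.2)) @ (a, b) --> (val a, val b).
  apply: cvg_pair.
    apply: (@cvg_comp _ _ _ fst val _ (nbhs a)); first exact: cvg_fst.
    exact: val_continuous.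
  apply: (@cvg_comp _ _ _ snd val _ (nbhs b)); first exact: cvg_snd.
  exact: val_continuous.
have := pc _ nm; rewrite !nbhs_filterE /fmap /within /=.
apply: filterS => -[c d] /= cd /iso_composable h.
by rewrite val_iso_mul //; exact: cd.
Qed.

Lemma iso_rng_continuous : continuous iso_rng.
Proof.
have h : continuous (rng \o (val : A -> G)).
  move=> y; apply: continuous_comp; first exact: val_continuous.
  exact: rng_continuous.
by move=> x; apply: to_iso_continuous; [exact: nbhs_filter|exact: (h x)].
Qed.

Lemma iso_src_continuous : continuous iso_src.
Proof.
have h : continuous (src \o (val : A -> G)).
  move=> y; apply: continuous_comp; first exact: val_continuous.
  exact: src_continuous.
by move=> x; apply: to_iso_continuous; [exact: nbhs_filter|exact: (h x)].
Qed.

Lemma iso_inv_continuous : continuous iso_inv.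
Proof.
have h : continuous (ginv \o (val : A -> G)).
  move=> y; apply: continuous_comp; first exact: val_continuous.
  exact: ginv_continuous.
by move=> x; apply: to_iso_continuous; [exact: nbhs_filter|exact: (h x)].
Qed.

Lemma iso_rng_rng (g : A) : iso_rng (iso_rng g) = iso_rng g.
Proof. by apply: val_inj; rewrite /= rng_rng. Qed.

Lemma iso_src_rng (g : A) : iso_src (iso_rng g) = iso_rng g.
Proof. by apply: val_inj; rewrite /= src_rng. Qed.

Lemma iso_rng_src (g : A) : iso_rng (iso_src g) = iso_src g.
Proof. by apply: val_inj; rewrite /= rng_src. Qed.

Lemma iso_src_src (g : A) : iso_src (iso_src g) = iso_src g.
Proof. by apply: val_inj; rewrite /= src_src. Qed.

Lemma iso_rng_inv (g : A) : iso_rng (iso_inv g) = iso_src g.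
Proof. by apply: val_inj; rewrite /= rng_inv. Qed.

Lemma iso_src_inv (g : A) : iso_src (iso_inv g) = iso_rng g.
Proof. by apply: val_inj; rewrite /= src_inv. Qed.

Lemma iso_rng_mul (a b : A) :
  iso_src a = iso_rng b -> iso_rng (iso_mul a b) = iso_rng a.
Proof.
move=> /iso_composable ab; apply: val_inj.
by rewrite /= val_iso_mul // rng_mul.
Qed.

Lemma iso_src_mul (a b : A) :
  iso_src a = iso_rng b -> iso_src (iso_mul a b) = iso_src b.
Proof.
move=> /iso_composable ab; apply: val_inj.
by rewrite /= val_iso_mul // src_mul.
Qed.

Lemma iso_mulA (a b c : A) :
  iso_src a = iso_rng b -> iso_src b = iso_rng c ->
  iso_mul (iso_mul a b) c = iso_mul a (iso_mul b c).
Proof.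
move=> /iso_composable ab /iso_composable bc; apply: val_inj.
rewrite !val_iso_mul ?gmulA //; first by rewrite rng_mul.
by rewrite src_mul.
Qed.

Lemma iso_rng_gmul (g : A) : iso_mul (iso_rng g) g = g.
Proof. by apply: val_inj; rewrite val_iso_mul /= ?src_rng ?rng_gmul. Qed.

Lemma iso_gmul_src (g : A) : iso_mul g (iso_src g) = g.
Proof. by apply: val_inj; rewrite val_iso_mul /= ?rng_src ?gmul_src. Qed.

Lemma iso_mulV (g : A) : iso_mul g (iso_inv g) = iso_rng g.
Proof. by apply: val_inj; rewrite val_iso_mul /= ?rng_inv ?gmulV. Qed.

Lemma iso_mulVl (g : A) : iso_mul (iso_inv g) g = iso_src g.
Proof. by apply: val_inj; rewrite val_iso_mul /= ?src_inv ?gmulVl. Qed.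

Definition iso_interior : topGroupoid :=
  @TopGroupoid A iso_rng iso_src iso_mul iso_inv
    iso_rng_rng iso_src_rng iso_rng_src iso_src_src
    iso_rng_mul iso_src_mul iso_mulA iso_rng_gmul iso_gmul_src
    iso_rng_inv iso_src_inv iso_mulV iso_mulVl
    iso_rng_continuous iso_src_continuous iso_inv_continuous iso_mul_continuous.

End IsoInterior.

(* Values of [s] outside the composable pairs are irrelevant. *)
Definition Z2 (R : realType) (G : topGroupoid) : set (G * G -> R[i]) :=
  [set s : G * G -> R[i] |
    [/\ forall p, composable G p -> `|s p| = 1,
        {within composable G, continuous s},
        forall g, s (rng g, g) = 1 /\ s (g, src g) = 1 &
        forall a b c, composable G (a, b) -> composable G (b, c) ->
          s (a, b) * s (gmul a b, c) = s (b, c) * s (a, gmul b c)]].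
Arguments Z2 : clear implicits.

Definition iso_cocycle (R : realType) (G : topGroupoid) (etG : etale G)
    (s : G * G -> R[i]) : iso_interior etG * iso_interior etG -> R[i] :=
  fun p => s (val p.1, val p.2).

(* The data of a complex *-algebra: the subset [sdom] of an ambient vector space
   together with a product and an involution, which are only meaningful on
   [sdom]. *)
Record starData (R : realType) := StarData {
  scarrier :> lmodType R[i];
  sdom : set scarrier;
  smul : scarrier -> scarrier -> scarrier;
  sstar : scarrier -> scarrier
}.
Arguments sdom {R} _.
Arguments smul {R _} _ _.
Arguments sstar {R _} _.

Record banachStarAlg (R : realType) := BanachStarAlg {
  bcarrier :> completeNormedModType R[i];
  bmul : bcarrier -> bcarrier -> bcarrier;
  bstar : bcarrier -> bcarrier;
  bmulDl : forall a b c, bmul (a + b) c = bmul a c + bmul b c;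
  bmulDr : forall a b c, bmul a (b + c) = bmul a b + bmul a c;
  bmulZl : forall (z : R[i]) a b, bmul (z *: a) b = z *: bmul a b;
  bmulZr : forall (z : R[i]) a b, bmul a (z *: b) = z *: bmul a b;
  bmulA : forall a b c, bmul a (bmul b c) = bmul (bmul a b) c;
  bstarD : forall a b, bstar (a + b) = bstar a + bstar b;
  bstarZ : forall (z : R[i]) a, bstar (z *: a) = z^* *: bstar a;
  bstarM : forall a b, bstar (bmul a b) = bmul (bstar b) (bstar a);
  bstarK : forall a, bstar (bstar a) = a;
  bnormM : forall a b, `|bmul a b| <= `|a| * `|b|;
  bnorm_star : forall a, `|bstar a| = `|a|
}.
Arguments bmul {R _} _ _.
Arguments bstar {R _} _.

Definition bsa_data (R : realType) (A : banachStarAlg R) : starData R :=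
  @StarData R A setT bmul bstar.

Record hilbert (R : realType) := Hilbert {
  hcarrier :> completeNormedModType R[i];
  hdot : hcarrier -> hcarrier -> R[i];
  hdotDl : forall x y z, hdot (x + y) z = hdot x z + hdot y z;
  hdotZl : forall (c : R[i]) x y, hdot (c *: x) y = c * hdot x y;
  hdotC : forall x y, hdot x y = (hdot y x)^*;
  hdot_norm : forall x, hdot x x = `|x| ^+ 2
}.
Arguments hdot {R _} _ _.

Section Representations.
Variable R : realType.

(* Norms of operators are computed in [\bar R], so that no supremum takes a
   default value. *)
Definition opnorm (H : hilbert R) (T : H -> H) : \bar R :=
  ereal_sup [set (rnorm (T x))%:E | x in [set x : H | `|x| <= 1]].

Definition star_rep (A : starData R) (H : hilbert R) (pi : A -> {linear H -> H}) :
    Prop :=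
  [/\ forall a, sdom A a -> continuous (pi a),
      forall a b, sdom A a -> sdom A b ->
        forall x, pi (a + b) x = pi a x + pi b x,
      forall (c : R[i]) a, sdom A a -> forall x, pi (c *: a) x = c *: pi a x,
      forall a b, sdom A a -> sdom A b ->
        forall x, pi (smul a b) x = pi a (pi b x) &
      forall a, sdom A a ->
        forall x y, hdot (pi a x) y = hdot x (pi (sstar a) y)].

Definition star_hom (A : starData R) (B : banachStarAlg R) (phi : A -> B) : Prop :=
  [/\ forall a b, sdom A a -> sdom A b -> phi (a + b) = phi a + phi b,
      forall (c : R[i]) a, sdom A a -> phi (c *: a) = c *: phi a,
      forall a b, sdom A a -> sdom A b -> phi (smul a b) = bmul (phi a) (phi b) &
      forall a, sdom A a -> phi (sstar a) = bstar (phi a)].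

(* The completion of [A] in the norm [N] is not built: it is any Banach *-algebra
   with an isometric *-homomorphism from [A] of dense range, which determines it
   up to a unique isometric *-isomorphism. *)
Definition completion (A : starData R) (N : A -> \bar R) (B : banachStarAlg R)
    (iota : A -> B) : Prop :=
  [/\ star_hom iota,
      forall a, sdom A a -> (rnorm (iota a))%:E = N a &
      closure (iota @` sdom A) = setT].

Definition reduced (A : banachStarAlg R) : Prop :=
  forall a b : A, a <> b ->
    exists (H : hilbert R) (pi : bsa_data A -> {linear H -> H}),
      star_rep pi /\ exists x, pi a x <> pi b x.

Definition cstar_norm (A : banachStarAlg R) (N : A -> R) : Prop :=
  [/\ forall a b, N (a + b) <= N a + N b,
      forall (c : R[i]) a, N (c *: a) = rnorm c * N a,
      forall a, N a = 0 -> a = 0,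
      forall a b, N (bmul a b) <= N a * N b &
      forall a, N (bmul (bstar a) a) = N a ^+ 2].

Definition universal_norm (A : banachStarAlg R) (a : A) : \bar R :=
  ereal_sup [set n | exists (H : hilbert R) (pi : bsa_data A -> {linear H -> H}),
    star_rep pi /\ n = opnorm (pi a)].

Definition cstar_unique (A : banachStarAlg R) : Prop :=
  reduced A /\
  forall N : A -> R,
    cstar_norm N <-> (forall a, (N a)%:E = universal_norm a).

End Representations.

Section TwistedGroupoidAlgebra.
Variables (R : realType) (G : topGroupoid) (s : G * G -> R[i]).

Definition Cc : set (G -> R[i]) :=
  [set f | continuous f /\ compact (closure [set g | f g != 0])].

(* For [f], [h] in [Cc] over an étale Hausdorff groupoid all the sums
   below have finite support. *)
Definition conv (f h : G -> R[i]) : G -> R[i] := fun g =>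
  \sum_(m \in src_fibre (src g))
    f (gmul g (ginv m)) * h m * s (gmul g (ginv m), m).

Definition invol (f : G -> R[i]) : G -> R[i] := fun g =>
  (s (ginv g, g))^* * (f (ginv g))^*.

Definition Cc_alg : starData R := @StarData R (G -> R[i]) Cc conv invol.

Definition I_norm (f : G -> R[i]) : \bar R :=
  esup0 [set maxe (\esum_(g in src_fibre x) (rnorm (f g))%:E)
                  (\esum_(g in rng_fibre x) (rnorm (f g))%:E) | x in units G].

Definition is_ell1 (A : banachStarAlg R) (iota : (G -> R[i]) -> A) : Prop :=
  completion (A := Cc_alg) I_norm iota.

Definition I_bounded (H : hilbert R) (pi : Cc_alg -> {linear H -> H}) : Prop :=
  exists M : R, forall f, Cc f -> (opnorm (pi f) <= M%:E * I_norm f)%E.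

Definition full_norm (f : G -> R[i]) : \bar R :=
  ereal_sup [set n | exists (H : hilbert R) (pi : Cc_alg -> {linear H -> H}),
    [/\ star_rep pi, I_bounded pi & n = opnorm (pi f)]].

Definition delta (g : G) : G -> R[i] := fun h => (h == g)%:R.

(* The regular representation at the unit [x], on square-summable functions on
   [src_fibre x]: its value [L f delta_g] on a basis vector, and its extension
   to arbitrary vectors [xi], computed coordinatewise. *)
Definition regular_delta (f : G -> R[i]) (g : G) : G -> R[i] :=
  \sum_(m \in src_fibre (rng g)) (s (m, g) * f m) *: delta (gmul m g).

Definition regular (x : G) (f : G -> R[i]) (xi : G -> R[i]) : G -> R[i] := fun h =>
  \sum_(g \in src_fibre x) xi g * regular_delta f g h.

Definition ell2_norm (x : G) (xi : G -> R[i]) : \bar R :=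
  sqrte (\esum_(g in src_fibre x) (rnorm (xi g) ^+ 2)%:E).

Definition regular_norm (x : G) (f : G -> R[i]) : \bar R :=
  ereal_sup [set ell2_norm x (regular x f xi) |
             xi in [set xi | (ell2_norm x xi <= 1)%E]].

(* Norm of the direct sum of the regular representations. *)
Definition reduced_norm (f : G -> R[i]) : \bar R :=
  esup0 [set regular_norm x f | x in units G].

(* [q] is the natural map, determined by its values on the dense image of [Cc]. *)
Definition weak_containment : Prop :=
  exists (Cfull Cred : banachStarAlg R)
         (ifull : Cc_alg -> Cfull) (ired : Cc_alg -> Cred)
         (q : bsa_data Cfull -> Cred),
    [/\ completion (A := Cc_alg) full_norm ifull,
        completion (A := Cc_alg) reduced_norm ired,
        star_hom q,
        forall f, Cc f -> q (ifull f) = ired f &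
        bijective q].

End TwistedGroupoidAlgebra.

(* Main.v *)
(* Let N be a C*-norm on l1(G, s) and U the universal C*-norm.  Gelfand-Naimark
   gives N <= U, so that only U <= N is at stake.

   For f in Cc(G) one has U(f) <= full_norm f = reduced_norm f: a representation of
   l1(G, s) restricts to Cc(G), and the full and reduced norms agree by weak
   containment.  It remains to see that reduced_norm f <= N(f).  Call a unit x good
   if the isotropy group at x lies in Iso(G)°; a Baire argument shows that the good
   units are dense.  Evaluation at a good unit x is a state phi_x of l1(G, s) with
   |phi_x(f)| <= N(f): for a bump h near x, the function h f h belongs to
   l1(Iso(G)°, s), on which N is the universal norm by hypothesis, and phi_x is a
   state there.  Hence phi_x(g* f* f g) <= N(f)^2 phi_x(g* g) for good x, and for all
   units x by continuity in x; this is the bound on the regular representation. *)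

From HB Require Import structures.
Require Import Defs.
From mathcomp Require Import all_boot all_order all_algebra complex.
From mathcomp Require Import all_classical all_reals all_analysis.
From mathcomp Require Import ring lra.

Set Implicit Arguments.
Unset Strict Implicit.
Unset Printing Implicit Defensive.
Import Order.TTheory GRing.Theory Num.Theory numFieldNormedType.Exports.

Local Open Scope classical_set_scope.
Local Open Scope ring_scope.

(** [N] need not make [ell1G] complete and is not assumed comparable with the given norm, so there
    is no spectrum to work with: positivity, square roots and even [N <= rnorm] come from norm
    inequalities, on the unitization with the operator norm of left multiplication. Seminorms are
    treated throughout, since the same facts serve [N], the norm of a representation and the norm
    carried over by weak containment. The product [h f h] lives on the arrows of the support of [f]
    with range and source near [x]. At a good unit, compactness of that support forces all of them
    into the interior of the isotropy; at other units it cannot, since arrows of the isotropy at [x]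
    lie outside that interior. Hence the detour through a dense set. The algebras are known only as
    completions. Their elements are reached by evaluations extended from Cc(G), and identities in
    them are proved by approximation. These evaluations also show that [ell1G] is reduced, without
    which the universal norm would not be a norm. *)

Section Rnorm.
Variables (R : realType) (V : normedZmodType R[i]).

Lemma rnorm_ge0 (x : V) : 0 <= rnorm x.
Proof. by have := normr_ge0 x; rewrite lecE => /andP[]. Qed.

Lemma normrE_rnorm (x : V) : `|x| = (rnorm x)%:C%C.
Proof. by rewrite /rnorm RRe_real// ger0_real. Qed.

Lemma rnorm_le (x : V) (e : R) : (`|x| <= e%:C%C) = (rnorm x <= e).
Proof. by rewrite normrE_rnorm lecR. Qed.

Lemma rnorm_lt (x : V) (e : R) : (`|x| < e%:C%C) = (rnorm x < e).
Proof. by rewrite normrE_rnorm ltcR. Qed.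

Lemma rnormD (x y : V) : rnorm (x + y) <= rnorm x + rnorm y.
Proof. by have := ler_normD x y; rewrite !normrE_rnorm -rmorphD lecR. Qed.

Lemma rnorm0 : rnorm (0 : V) = 0.
Proof. by rewrite /rnorm normr0. Qed.

Lemma rnormN (x : V) : rnorm (- x) = rnorm x.
Proof. by rewrite /rnorm normrN. Qed.

Lemma rnormB (x y : V) : rnorm (x - y) = rnorm (y - x).
Proof. by rewrite /rnorm distrC. Qed.

Lemma rnorm_eq0 (x : V) : rnorm x = 0 -> x = 0.
Proof. by move=> x0; apply/normr0_eq0; rewrite normrE_rnorm x0. Qed.

End Rnorm.

Section ComplexRnorm.
Variables (R : realType).

Lemma rnorm_real (t : R) : rnorm t%:C%C = `|t|.
Proof. by rewrite /rnorm normc_def /= expr0n addr0 sqrtr_sqr. Qed.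

Lemma rnormMc (x y : R[i]) : rnorm (x * y) = rnorm x * rnorm y.
Proof. by rewrite /rnorm normrM !normrE_rnorm -rmorphM. Qed.

Lemma rnormJ (x : R[i]) : rnorm x^* = rnorm x.
Proof. by rewrite /rnorm norm_conjC. Qed.

Lemma conjC_real (t : R) : (t%:C%C)^* = t%:C%C.
Proof. by rewrite conj_Creal//; apply/complex_realP; exists t. Qed.

Lemma conjCi : ('i%C : R[i])^* = - 'i%C.
Proof. by rewrite complexiE conjCi. Qed.

Lemma mulCii : 'i%C * 'i%C = -1 :> R[i].
Proof. by rewrite -expr2 sqr_i. Qed.

Lemma rnormi : rnorm ('i%C : R[i]) = 1.
Proof. by rewrite /rnorm normc_def /= expr0n expr1n add0r sqrtr1. Qed.

Lemma cReD (a b : R[i]) : complex.Re (a + b) = complex.Re a + complex.Re b.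
Proof. by case: a b => [? ?] [? ?]. Qed.

Lemma cImD (a b : R[i]) : complex.Im (a + b) = complex.Im a + complex.Im b.
Proof. by case: a b => [? ?] [? ?]. Qed.

Lemma cReN (a : R[i]) : complex.Re (- a) = - complex.Re a.
Proof. by case: a. Qed.

Lemma cImN (a : R[i]) : complex.Im (- a) = - complex.Im a.
Proof. by case: a. Qed.

Lemma cRe_le_rnorm (z : R[i]) : `|complex.Re z| <= rnorm z.
Proof. by have := normc_ge_Re z; rewrite normrE_rnorm lecR. Qed.

Lemma cIm_le_rnorm (z : R[i]) : `|complex.Im z| <= rnorm z.
Proof.
have -> : complex.Im z = complex.Re (- 'i%C * z) by case: z => a b; rewrite /= oppr0 mul0r sub0r mulN1r opprK.
by apply: le_trans (cRe_le_rnorm _) _; rewrite rnormMc rnormN rnormi mul1r.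
Qed.

Lemma rnorm_le_ReIm (z : R[i]) : rnorm z <= `|complex.Re z| + `|complex.Im z|.
Proof.
have {1}-> : z = (complex.Re z)%:C%C + 'i%C * (complex.Im z)%:C%C by rewrite -complexE.
by apply: le_trans (rnormD _ _) _; rewrite rnormMc rnormi mul1r !rnorm_real.
Qed.

Lemma posC_ex (e : R[i]) : 0 < e -> exists2 d : R, 0 < d & e = d%:C%C.
Proof.
move=> e0; exists (complex.Re e); first by move: e0; rewrite ltcE => /andP[].
by rewrite RRe_real// gtr0_real.
Qed.

End ComplexRnorm.

Section RnormModule.
Variables (R : realType) (V : normedModType R[i]).

Lemma rnormZ (c : R[i]) (x : V) : rnorm (c *: x) = rnorm c * rnorm x.
Proof. by rewrite /rnorm normrZ !normrE_rnorm -rmorphM. Qed.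

Lemma rnormZr (t : R) (x : V) : 0 <= t -> rnorm (t%:C%C *: x) = t * rnorm x.
Proof. by move=> t0; rewrite rnormZ rnorm_real ger0_norm. Qed.

Lemma rnorm_small_eq (x y : V) (K : R) :
  0 <= K -> (forall e, 0 < e -> rnorm (x - y) <= K * e) -> x = y.
Proof.
move=> K0 h; apply/eqP; rewrite -subr_eq0; apply/eqP/rnorm_eq0/eqP.
rewrite eq_le rnorm_ge0 andbT; apply/ler_addgt0Pr => e e0; rewrite add0r.
have K1 : 0 < K + 1 by lra.
apply: le_trans (h (e / (K + 1)) _) _; first by rewrite divr_gt0.
by rewrite mulrA ler_pdivrMr// mulrC ler_wpM2l ?lerDl// ltW.
Qed.

(** For errors that are quadratic in [e]: with [e <= 1] a product of two errors is again at most
    linear. *)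
Lemma rnorm_small_eq1 (x y : V) (K : R) :
  0 <= K -> (forall e, 0 < e -> e <= 1 -> rnorm (x - y) <= K * e) -> x = y.
Proof.
move=> K0 h; apply: (@rnorm_small_eq _ _ K) => // e e0.
apply: (@le_trans _ _ (K * Num.min e 1)); last by rewrite ler_wpM2l// ge_min lexx.
by apply: h; rewrite ?lt_min ?e0 ?ltr01// ge_min lexx orbT.
Qed.

End RnormModule.

Arguments rnorm_small_eq {R V x y} K.
Arguments rnorm_small_eq1 {R V x y} K.

(** The inequality for [c^-1] at [c *: x] is the reverse inequality for [c] at [x]. *)
Lemma rnorm_homogeneous (R : realType) (V : lmodType R[i]) (p : V -> R) :
  (forall x, 0 <= p x) -> (forall (c : R[i]) x, p (c *: x) <= rnorm c * p x) ->
  forall (c : R[i]) x, p (c *: x) = rnorm c * p x.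
Proof.
move=> p0 le c x; apply/eqP; rewrite eq_le le; have [->|c0] := eqVneq c 0.
  by rewrite rnorm0 mul0r p0.
have := le c^-1 (c *: x); rewrite scalerA mulVf// scale1r.
have cp : 0 < rnorm c.
  by rewrite lt_def rnorm_ge0 andbT; apply: contra_neq c0; exact: rnorm_eq0.
by rewrite -(ler_pM2l cp) mulrA -rnormMc mulfV// (rnorm_real 1) normr1 mul1r.
Qed.

(** * Identities in abelian groups *)

(** Proof by reflection: an additive expression is normalised to its integer coefficients at the
    atoms listed in [env]. *)
Inductive zmod_expr :=
  | ZVar of nat | Zzero | Zadd of zmod_expr & zmod_expr | Zopp of zmod_expr
  | Zmuln of zmod_expr & nat.

Fixpoint zmod_eval (V : zmodType) (env : seq V) (e : zmod_expr) : V :=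
  match e with
  | ZVar n => env`_n
  | Zzero => 0
  | Zadd e f => zmod_eval env e + zmod_eval env f
  | Zopp e => - zmod_eval env e
  | Zmuln e n => zmod_eval env e *+ n
  end.

Fixpoint zmod_coef (e : zmod_expr) (i : nat) : int :=
  match e with
  | ZVar n => (n == i)%:R
  | Zzero => 0
  | Zadd e f => zmod_coef e i + zmod_coef f i
  | Zopp e => - zmod_coef e i
  | Zmuln e n => zmod_coef e i *+ n
  end.

Lemma zmod_evalE (V : zmodType) (env : seq V) e :
  zmod_eval env e = \sum_(i < size env) env`_i *~ zmod_coef e i.
Proof.
elim: e => [n||e IHe f IHf|e IHe|e IHe n] /=.
- have [ni|ni] := ltnP n (size env).
    rewrite (bigD1 (Ordinal ni)) //= eqxx big1 ?addr0// => i /negPf.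
    by rewrite eq_sym -val_eqE /= => ->.
  rewrite nth_default// big1// => i _; case: eqP => // ei.
  by have := ltn_ord i; rewrite -ei ltnNge ni.
- by rewrite big1.
- by rewrite IHe IHf -big_split; apply: eq_bigr => i _; rewrite mulrzDr.
- by rewrite IHe -sumrN; apply: eq_bigr => i _; rewrite mulrNz.
- rewrite IHe -sumrMnl; apply: eq_bigr => i _.
  by rewrite -[zmod_coef e i *+ n]mulr_natr natz mulrzA -pmulrn.
Qed.

Lemma zmod_eqP (V : zmodType) (env : seq V) e f :
  all (fun i => zmod_coef e i == zmod_coef f i) (iota 0 (size env)) ->
  zmod_eval env e = zmod_eval env f.
Proof.
move=> /allP ef; rewrite !zmod_evalE; apply: eq_bigr => i _.
by rewrite (eqP (ef i _))// mem_iota ltn_ord.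
Qed.

(* Atoms are compared up to conversion: the same product may appear with several
   inheritance paths for its structure. *)
Ltac zmod_index x env :=
  match env with
  | ?y :: _ => let _ := match goal with _ => unify x y end in constr:(0%N)
  | _ :: ?env => let n := zmod_index x env in constr:(n.+1)
  end.

Ltac zmod_mem x env :=
  match env with
  | nil => constr:(false)
  | ?y :: _ => let _ := match goal with _ => unify x y end in constr:(true)
  | _ :: ?env => zmod_mem x env
  end.

Ltac zmod_atoms t env :=
  lazymatch t with
  | (?x + ?y)%R => let env := zmod_atoms x env in zmod_atoms y env
  | (- ?x)%R => zmod_atoms x env
  | (?x *+ ?n)%R => zmod_atoms x env
  | 0%R => env
  | ?x => lazymatch zmod_mem x env with true => env | false => constr:(x :: env) end
  end.

Ltac zmod_reify t env :=
  lazymatch t with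
  | (?x + ?y)%R => let a := zmod_reify x env in let b := zmod_reify y env in
                   constr:(Zadd a b)
  | (- ?x)%R => let a := zmod_reify x env in constr:(Zopp a)
  | (?x *+ ?n)%R => let a := zmod_reify x env in constr:(Zmuln a n)
  | 0%R => constr:(Zzero)
  | ?x => let n := zmod_index x env in constr:(ZVar n)
  end.

Ltac zmodule :=
  lazymatch goal with
  | |- @eq ?T ?x ?y =>
    let env := zmod_atoms x (@nil T) in
    let env := zmod_atoms y env in
    let a := zmod_reify x env in
    let b := zmod_reify y env in
    first [exact (@zmod_eqP _ env a b isT) | fail 1 "not an identity of abelian groups"]
  end.

(** * Positivity in unital algebras with a C*-seminorm *)

Lemma bernoulli_ineq (R : realType) (d : R) n : 0 <= d -> 1 + n%:R * d <= (1 + d) ^+ n.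
Proof.
move=> d0; elim: n => [|n IH]; first by rewrite mul0r addr0 expr0.
rewrite exprS; apply: (@le_trans _ _ ((1 + d) * (1 + n%:R * d))); last first.
  by rewrite ler_wpM2l// addr_ge0.
have : 0 <= n%:R * d * d by rewrite !mulr_ge0.
rewrite -[n.+1]addn1 natrD; nra.
Qed.

(** If [x = 1 + d] with [d > 0], Bernoulli's inequality makes the left side at least [(m d)^2] for
    [m = 2 ^ n], which outgrows the linear right side. *)
Lemma exp_2n_linear_bound (R : realType) (x C K : R) : 0 <= K ->
  (forall n, x ^+ (2 ^ n.+1) <= C + K * (2 ^ n)%:R) -> x <= 1.
Proof.
move=> K0 h; rewrite leNgt; apply/negP => x1.
pose d := x - 1; have d0 : 0 < d by rewrite subr_gt0.
have bd n : (2 ^ n)%:R * d ^+ 2 <= `|C| + K.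
  have m1 : 1 <= (2 ^ n)%:R :> R by rewrite ler1n expn_gt0.
  rewrite -(ler_pM2l (lt_le_trans ltr01 m1)).
  have := h n; rewrite expnSr exprM; have -> : x = 1 + d by rewrite /d; lra.
  have := bernoulli_ineq (2 ^ n) (ltW d0); set m := (2 ^ n)%:R in m1 *.
  set X := (1 + d) ^+ _ => mX XC.
  have m0 : 0 <= m * d by rewrite mulr_ge0// ltW//; apply: lt_le_trans m1.
  have : (m * d) ^+ 2 <= X ^+ 2.
    by rewrite lerXn2r ?nnegrE//; lra.
  have : C <= m * `|C|.
    by apply: le_trans (ler_norm C) _; rewrite ler_peMl.
  rewrite exprMn !expr2 in XC *; nra.
have d20 : 0 < d ^+ 2 by rewrite exprn_gt0.
have CK : 0 <= (`|C| + K) / d ^+ 2 by rewrite divr_ge0 ?addr_ge0// ltW.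
have := archi_boundP CK; set k := Num.Def.archi_bound _ => ktr.
have := bd k.+1; rewrite -ler_pdivlMr// leNgt => /negP; apply.
by apply: lt_le_trans ktr _; rewrite ler_nat ltnW// (leq_trans (ltn_expl k (leqnn 2)))// leq_exp2l.
Qed.

(** Taking [2 ^ n]-th roots makes the factor [K] disappear. *)
Lemma le_of_exp_2n (R : realType) (x y K : R) : 0 <= x -> 0 <= y ->
  (forall n, x ^+ (2 ^ n) <= K * y ^+ (2 ^ n)) -> x <= y.
Proof.
move=> x0 y0 h.
have [yE|yn0] := eqVneq y 0.
  by have := h 0; rewrite yE expn0 !expr1 mulr0.
have yp : 0 < y by rewrite lt_def yn0.
rewrite -[leRHS]mul1r -ler_pdivrMr//.
apply: (@exp_2n_linear_bound _ _ K 0) => // n.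
by rewrite mul0r addr0 expr_div_n ler_pdivrMr ?exprn_gt0.
Qed.

(** Cancelling [p x] gives [p x <= p (st x)]; the same at [st x] gives equality. *)
Lemma star_isometry (R : realType) (T : Type) (p : T -> R) (st : T -> T) :
  involutive st -> (forall x, 0 <= p x) -> (forall x, p x ^+ 2 <= p (st x) * p x) ->
  forall x, p (st x) = p x.
Proof.
move=> stK p0 h x; have le y : p y <= p (st y).
  have [->|y0] := eqVneq (p y) 0; first exact: p0.
  by have := h y; rewrite expr2 ler_pM2r// lt_def y0 p0.
by apply/eqP; rewrite eq_le le -{2}(stK x) le.
Qed.

Section CstarSeminorm.
Variables (R : realType) (B : algType R[i]) (st : B -> B) (p : B -> R).

(** The seminorm may have a kernel and [B] need not be complete, so the arguments below use neither
    inverses nor limits in [B], only elements with a small defect. *)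
Record unital_cstar_seminorm : Prop := UnitalCstarSeminorm {
  ucs_starD : forall x y, st (x + y) = st x + st y;
  ucs_starZ : forall (c : R[i]) x, st (c *: x) = c^* *: st x;
  ucs_starM : forall x y, st (x * y) = st y * st x;
  ucs_starK : forall x, st (st x) = x;
  ucs_D : forall x y, p (x + y) <= p x + p y;
  ucs_Z : forall (c : R[i]) x, p (c *: x) = rnorm c * p x;
  ucs_M : forall x y, p (x * y) <= p x * p y;
  ucs_C : forall x, p (st x * x) = p x ^+ 2;
  ucs_1 : p 1 <= 1 }.

Hypothesis H : unital_cstar_seminorm.

Local Notation rs t := ((t)%:C%C *: (1 : B)).

Let stD := ucs_starD H.
Let stZ := ucs_starZ H.
Let stM := ucs_starM H.
Let stK := ucs_starK H.
Let pD := ucs_D H.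
Let pM := ucs_M H.
Let pC := ucs_C H.

Let pZ (t : R) x : 0 <= t -> p (t%:C%C *: x) = t * p x.
Proof. by move=> t0; rewrite (ucs_Z H) rnorm_real ger0_norm. Qed.

Let stZr (t : R) x : st (t%:C%C *: x) = t%:C%C *: st x.
Proof. by rewrite stZ conjC_real. Qed.

Let st1 : st 1 = 1.
Proof. by have := stM (st 1) 1; rewrite mulr1 stK mulr1. Qed.

Let stN x : st (- x) = - st x.
Proof. by rewrite -[in LHS]scaleN1r stZ rmorphN rmorph1 scaleN1r. Qed.

Let stB x y : st (x - y) = st x - st y.
Proof. by rewrite stD stN. Qed.

Let st0 : st 0 = 0.
Proof. by have := stB 0 0; rewrite !subrr. Qed.

Let strs t : st (rs t) = rs t.
Proof. by rewrite stZr st1. Qed.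

Let stX x n : st (x ^+ n) = st x ^+ n.
Proof. by elim: n => [|n IH]; rewrite ?expr0 ?st1// exprS exprSr stM IH. Qed.

Let pN x : p (- x) = p x.
Proof.
by rewrite -scaleN1r (ucs_Z H) rnormN (rnorm_real 1) normr1 mul1r.
Qed.

Let p0 : p 0 = 0.
Proof. by rewrite -(scale0r 0) (ucs_Z H) rnorm0 mul0r. Qed.

Let p_ge0 x : 0 <= p x.
Proof. by have := pD x (- x); rewrite subrr p0 pN; lra. Qed.

Let pB x y : p (x - y) <= p x + p y.
Proof. by rewrite -(pN y); exact: pD. Qed.

Let pBC x y : p (x - y) = p (y - x).
Proof. by rewrite -pN opprB. Qed.

Let pst x : p (st x) = p x.
Proof. by apply: (star_isometry (p := p) stK) => y; [exact: p_ge0|rewrite -pC; exact: pM]. Qed.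

Let ptri x y z : p (x - z) <= p (x - y) + p (y - z).
Proof. by rewrite -[x - z](subrKA y); exact: pD. Qed.

Let prs t : 0 <= t -> p (rs t) <= t.
Proof. by move=> t0; rewrite pZ// ler_piMr// (ucs_1 H). Qed.

Lemma ucs_exp_2n x n : st x = x -> p (x ^+ (2 ^ n)) = p x ^+ (2 ^ n).
Proof.
move=> sx; elim: n => [|n IH]; first by rewrite !expn0 !expr1.
by rewrite expnSr !exprM expr2 -{1}sx -stX pC IH.
Qed.

(** For [u = x + i y] one has [u* u = x^2 + y^2] and [2 x = u + u*]. *)
Lemma ucs_le_sum_sq x y : st x = x -> st y = y -> GRing.comm x y ->
  p x ^+ 2 <= p (x * x + y * y).
Proof.
move=> sx sy xy; pose u := x + 'i%C *: y.
have su : st u = x - 'i%C *: y by rewrite stD stZ sx sy conjCi scaleNr.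
have uu : st u * u = x * x + y * y.
  rewrite su /u mulrBl !mulrDr -!scalerAl -!scalerAr scalerA mulCii scaleN1r.
  by rewrite -xy; zmodule.
rewrite -uu pC lerXn2r ?nnegrE//.
suff : 2 * p x <= p u + p u by lra.
rewrite -[2 * _]pZ// -[p u in X in _ + X]pst.
apply: le_trans (pD _ _); rewrite su /u addrACA subrr addr0.
by rewrite rmorphMn /= scaler_nat mulr2n.
Qed.

(** A fixed point [z] satisfies [(1 - z)^2 = 1 - g]. *)
Let sqrt_step (g z : B) := (2^-1)%:C%C *: (g + z * z).
Let sqrt_iter (g : B) := fun n => iter n (sqrt_step g) 0.

(** Scaling [g] by [r = 1 - d < 1] makes the increments of the iteration decay like [r ^+ n], so
    that a late iterate is an approximate solution. Iterates are polynomials in [g], whence the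
    commutation clause. *)
Lemma ucs_sqrt_approx g e : st g = g -> p g <= 1 -> 0 < e ->
  exists y, [/\ st y = y, forall c, GRing.comm c g -> GRing.comm c y &
    p (y * y - (1 - g)) <= e].
Proof.
move=> sg pg e0.
pose d := Num.min (e / 2) 1; have d0 : 0 < d by rewrite lt_min ltr01 divr_gt0.
have d1 : d <= 1 by rewrite ge_min lexx orbT.
have de : d <= e / 2 by rewrite ge_min lexx.
pose r := 1 - d; have r1 : r < 1 by rewrite /r; lra.
have r0 : 0 <= r by rewrite /r; lra.
pose g' := r%:C%C *: g.
have pg' : p g' <= r by rewrite pZ// ler_piMr.
pose z := sqrt_iter g'.
have zS n : z n.+1 = sqrt_step g' (z n) by [].
have half : (2^-1 : R) + 2^-1 = 1 by lra.
have h0 : 0 <= (2^-1 : R) by lra.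
have pz n : p (z n) <= r.
  elim: n => [|n IH]; first by rewrite p0.
  rewrite zS pZ// (le_trans (ler_wpM2l h0 (pD _ _)))//.
  have : p (z n * z n) <= r * 1.
    apply: le_trans (pM _ _) _; apply: ler_pM => //.
    by apply: le_trans IH (ltW _).
  lra.
have sz n : st (z n) = z n.
  elim: n => [|n IH]; first exact: st0.
  by rewrite zS stZr stD stM IH stZr sg.
have cz n c : GRing.comm c g -> GRing.comm c (z n).
  move=> cg; elim: n => [|n IH]; first exact: commr0.
  rewrite zS /GRing.comm -scalerAr -scalerAl; congr (_ *: _).
  apply: commrD; last exact: commrM.
  by rewrite /GRing.comm -scalerAr -scalerAl cg.
have czz n m : z n * z m = z m * z n by apply: (cz m); apply/commr_sym; apply: (cz n).
have dz n : p (z n.+1 - z n) <= r ^+ n.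
  elim: n => [|n IH].
    by rewrite expr0 subr0 (le_trans (pz _))// ltW.
  rewrite [X in X - _]zS [X in _ - X]zS -scalerBr pZ//.
  rewrite opprD addrACA subrr add0r.
  have -> : z n.+1 * z n.+1 - z n * z n = (z n.+1 - z n) * (z n.+1 + z n).
    rewrite mulrBl !mulrDr (czz n n.+1); zmodule.
  rewrite exprSr.
  have : p ((z n.+1 - z n) * (z n.+1 + z n)) <= r ^+ n * (r + r).
    apply: le_trans (pM _ _) _; apply: ler_pM => //.
    by apply: le_trans (pD _ _) (lerD _ _).
  lra.
have [n rn] : exists n, 2 * r ^+ n <= e / 2.
  have : (fun n => r ^+ n : R) @ \oo --> (0 : R).
    by apply: cvg_expr; rewrite ger0_norm.
  move/cvgrPdist_le => /(_ (e / 4)) [|N _ /(_ N (leqnn N))]; first lra.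
  by rewrite /= sub0r normrN ger0_norm ?exprn_ge0// => ?; exists N; lra.
exists (1 - z n); split => [|c cg|]; first by rewrite stB st1 sz.
- by apply: commrB; [exact: commr1|exact: cz].
(* The defect of [1 - z n] is twice the next increment plus the cost [g - g'] of the scaling. *)
have -> : (1 - z n) * (1 - z n) - (1 - g) =
    2%:C%C *: (z n.+1 - z n) + (g - g').
  rewrite zS scalerBr /sqrt_step scalerA -rmorphM mulfV//= scale1r.
  rewrite rmorphMn /= scaler_nat mulr2n mulrBl mul1r mulrBr mulr1.
  zmodule.
apply: (le_trans (pD _ _)); rewrite pZ//.
have -> : g - g' = d%:C%C *: g by rewrite -[X in X - _]scale1r -scalerBl -(rmorph1 (@real_complex R)) -rmorphB /r opprB addrC subrK.
rewrite pZ; last exact: ltW.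
have := dz n; have : d * p g <= d * 1 by apply: ler_pM => //; exact: ltW.
lra.
Qed.

Let stsq x : st x = x -> st (x * x) = x * x.
Proof. by move=> sx; rewrite stM sx. Qed.

Let scale_mul (a b : R) (x y : B) :
  (a%:C%C *: x) * (b%:C%C *: y) = (a * b)%:C%C *: (x * y).
Proof. by rewrite -scalerAl -scalerAr scalerA rmorphM. Qed.

(** Let [y] be an approximate root of [1 - h^2]. Since [y^2 + h^2] is nearly [1] and [y] commutes
    with [h], [ucs_le_sum_sq] bounds [p y], hence [p (y * y)], which is nearly [p (1 - h * h)]. *)
Lemma ucs_1_sub_sq h : st h = h -> p h <= 1 -> p (1 - h * h) <= 1.
Proof.
move=> sh ph; apply/ler_addgt0Pr => e e0.
have phh : p (h * h) <= 1.
  by rewrite (le_trans (pM _ _))// mulr_ile1.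
have [|y [sy cy py]] := ucs_sqrt_approx (stsq sh) phh (_ : 0 < e / 2); first lra.
have hy : GRing.comm y h by apply/commr_sym/cy; rewrite /GRing.comm mulrA.
have := ucs_le_sum_sq sy sh hy.
have -> : y * y + h * h = (y * y - (1 - h * h)) + 1 by zmodule.
move=> /le_trans /(_ (pD _ _)); rewrite expr2 => yy.
have := pB (y * y) (y * y - (1 - h * h)); have -> : y * y - (y * y - (1 - h * h)) = 1 - h * h by zmodule.
have := pM y y; have := ucs_1 H; lra.
Qed.

(* Positivity without spectral theory: for self-adjoint x this says that the spectrum
   of x in the C*-quotient is contained in [0, 2t]. *)
Definition ucs_pos x := st x = x /\ exists t : R, p (rs t - x) <= t.

Let rsD a b : rs (a + b) = rs a + rs b.
Proof. by rewrite rmorphD scalerDl. Qed.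

Lemma ucs_pos_sqrt x e : ucs_pos x -> 0 < e ->
  exists y, [/\ st y = y, forall c, GRing.comm c x -> GRing.comm c y &
    p (y * y - x) <= e].
Proof.
move=> [sx [t0 xt0]] e0.
(* The given [t0] may be [0]; adding [1] preserves the inequality and allows division by [t]. *)
pose t := t0 + 1; have t00 : 0 <= t0 := le_trans (p_ge0 _) xt0.
have t1 : 0 < t by rewrite /t; lra.
have xt : p (rs t - x) <= t.
  have -> : rs t - x = (rs t0 - x) + rs 1 by rewrite rsD; zmodule.
  by rewrite (le_trans (pD _ _))// lerD// prs.
pose g := t^-1%:C%C *: (rs t - x).
have ti : 0 <= t^-1 by rewrite invr_ge0 ltW.
have pg : p g <= 1 by rewrite pZ// mulrC ler_pdivrMr// mul1r.
have sg : st g = g by rewrite stZr stB strs sx.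
have [|y [sy cy py]] := ucs_sqrt_approx sg pg (_ : 0 < e / t).
  by rewrite divr_gt0.
pose s := Num.sqrt t; have ss : s * s = t by rewrite -expr2 sqr_sqrtr// ltW.
exists (s%:C%C *: y); split => [|c cx|].
- by rewrite stZr sy.
- rewrite /GRing.comm -scalerAr -scalerAl; congr (_ *: _); apply: cy.
  rewrite /g /GRing.comm -scalerAr -scalerAl mulrBr mulrBl cx.
  by rewrite -scalerAr -scalerAl mulr1 mul1r.
- rewrite scale_mul ss.
  have -> : t%:C%C *: (y * y) - x = t%:C%C *: (y * y - (1 - g)).
    rewrite !scalerBr /g scalerA -rmorphM mulfV ?gt_eqF// scale1r.
    by zmodule.
  rewrite pZ; last exact: ltW.
  by rewrite mulrC -ler_pdivlMr.
Qed.

Let pos_sq_large y t : st y = y -> p y ^+ 2 <= t -> 0 < t -> p (rs t - y * y) <= t.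
Proof.
move=> sy pt t0; pose s := Num.sqrt t.
have ss : s * s = t by rewrite -expr2 sqr_sqrtr// ltW.
have s0 : 0 < s by rewrite sqrtr_gt0.
have si : 0 <= s^-1 by rewrite invr_ge0 ltW.
pose h := s^-1%:C%C *: y.
have ph : p h <= 1.
  rewrite pZ// mulrC ler_pdivrMr// mul1r -(@ler_pXn2r _ 2)// ?nnegrE//; last exact: ltW.
  by rewrite [s ^+ 2]expr2 ss.
have sh : st h = h by rewrite stZr sy.
have := ucs_1_sub_sq sh ph.
have -> : rs t - y * y = t%:C%C *: (1 - h * h).
  rewrite scalerBr /h scale_mul scalerA -rmorphM -ss.
  by rewrite -invfM mulfV ?scale1r// mulf_neq0 ?gt_eqF.
move=> hh; rewrite pZ; last exact: ltW.
by rewrite ler_piMr// ltW.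
Qed.

Lemma ucs_pos_sq y : st y = y -> ucs_pos (y * y).
Proof.
move=> sy; split; first exact: stsq.
exists (p y ^+ 2 + 1); apply: pos_sq_large => //; first by rewrite lerDl.
by rewrite ltr_wpDl// exprn_ge0.
Qed.

(** [x] is nearly a square, for which the bound is [ucs_1_sub_sq] rescaled. The witness in [ucs_pos]
    thereby becomes a matter of [p x] alone and can be shared by nearby elements. *)
Lemma ucs_pos_large x t : ucs_pos x -> p x <= t -> p (rs t - x) <= t.
Proof.
move=> px xt; apply/ler_addgt0Pr => e e0.
have [|y [sy cy py]] := ucs_pos_sqrt px (_ : 0 < e / 3); first lra.
pose T := t + e / 3.
have t0 : 0 <= t := le_trans (p_ge0 _) xt.
have T0 : 0 < T by rewrite /T; lra.
have yT : p y ^+ 2 <= T.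
  rewrite -pC sy; have := ptri (y * y) x 0; rewrite !subr0 /T; lra.
have := pos_sq_large sy yT T0.
have -> : rs t - x = (rs T - y * y) + (y * y - x) - rs (e / 3).
  by rewrite /T rsD; zmodule.
move=> h; apply: le_trans (pB _ _) _.
have e3 : 0 <= e / 3 by lra.
have := prs e3; have := pD (rs T - y * y) (y * y - x); rewrite /T in h *; lra.
Qed.

Lemma ucs_posD x y : ucs_pos x -> ucs_pos y -> ucs_pos (x + y).
Proof.
move=> [sx [t xt]] [sy [u yu]]; split; first by rewrite stD sx sy.
exists (t + u); have -> : rs (t + u) - (x + y) = (rs t - x) + (rs u - y).
  by rewrite rsD; zmodule.
by apply: le_trans (pD _ _) _; exact: lerD.
Qed.

Lemma ucs_posZ (a : R) x : 0 <= a -> ucs_pos x -> ucs_pos (a%:C%C *: x).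
Proof.
move=> a0 [sx [t xt]]; split; first by rewrite stZr sx.
exists (a * t); have -> : rs (a * t) - a%:C%C *: x = a%:C%C *: (rs t - x).
  by rewrite scalerBr scalerA -rmorphM.
by rewrite pZ// ler_wpM2l.
Qed.

Lemma ucs_pos0 : ucs_pos 0.
Proof. by have := ucs_pos_sq st0; rewrite mul0r. Qed.

Lemma ucs_pos_sum (I : Type) (r : seq I) (F : I -> B) :
  (forall i, ucs_pos (F i)) -> ucs_pos (\sum_(i <- r) F i).
Proof.
move=> pF; elim/big_ind: _ => //; first exact: ucs_pos0.
exact: ucs_posD.
Qed.

(** Approximants within [1] of [x] all admit the witness [p x + 1] by [ucs_pos_large], so the
    inequality passes to the limit. *)
Lemma ucs_pos_closed x : st x = x ->
  (forall e, 0 < e -> exists2 y, ucs_pos y & p (x - y) <= e) -> ucs_pos x.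
Proof.
move=> sx xy; split => //; exists (p x + 1); apply/ler_addgt0Pr => e e0.
have [|y py xye] := xy (Num.min e 1); first by rewrite lt_min e0 ltr01.
have y1 : p (x - y) <= 1 by rewrite (le_trans xye)// ge_min lexx orbT.
have ye : p (x - y) <= e by rewrite (le_trans xye)// ge_min lexx.
have yx : p y <= p x + 1.
  have := pB x (x - y); have -> : x - (x - y) = y by zmodule.
  lra.
have := ucs_pos_large py yx => ?.
have := pB (rs (p x + 1) - y) (x - y).
have -> : rs (p x + 1) - y - (x - y) = rs (p x + 1) - x by zmodule.
lra.
Qed.

Lemma ucs_pos_sub z t : st z = z -> p z <= t -> ucs_pos (rs t - z).
Proof.
move=> sz zt; split; first by rewrite stB strs sz.
by exists t; have -> : rs t - (rs t - z) = z by zmodule.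
Qed.

(** If [y] is an approximate root of [g], it commutes with [d], so [d g d] is close to the square of
    the self-adjoint [d y]. *)
Lemma ucs_pos_conj g d : ucs_pos g -> st d = d -> GRing.comm d g ->
  ucs_pos (d * g * d).
Proof.
move=> pg sd dg; apply: ucs_pos_closed => [|e e0].
  by rewrite !stM sd pg.1 mulrA.
have [|y [sy cy py]] := ucs_pos_sqrt pg (_ : 0 < e / (p d ^+ 2 + 1)).
  by rewrite divr_gt0// ltr_wpDl// exprn_ge0.
have yd := cy _ dg.
exists ((d * y) * (d * y)); first by apply: ucs_pos_sq; rewrite stM sd sy yd.
have -> : d * g * d - d * y * (d * y) = d * (g - y * y) * d.
  rewrite [X in d * y * X]yd mulrBr mulrBl !mulrA; congr (_ - _).
apply: (le_trans (pM _ _)); apply: (le_trans (ler_wpM2r _ (pM _ _))) => //.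
rewrite pBC mulrAC -expr2.
apply: (@le_trans _ _ ((p d ^+ 2 + 1) * p (y * y - g))).
  by rewrite ler_wpM2r// lerDl.
by rewrite mulrC -ler_pdivlMr// ltr_wpDl// exprn_ge0.
Qed.

(** [x] and [y] need not commute, but [x] and [t - x] do, and for [t = p (x + y)] the latter is
    positive as [(t - (x + y)) + y]. Their approximate roots [u], [v] commute, and [ucs_le_sum_sq]
    bounds [p u ^+ 2], nearly [p x], by [p (u * u + v * v)], nearly at most [t]. *)
Lemma ucs_pos_monotone x y : ucs_pos x -> ucs_pos y -> p x <= p (x + y).
Proof.
move=> px py; apply/ler_addgt0Pr => e e0.
pose t := p (x + y).
have ptx : ucs_pos (rs t - x).
  have -> : rs t - x = (rs t - (x + y)) + y by zmodule.
  by apply: ucs_posD => //; apply: ucs_pos_sub => //; rewrite stD px.1 py.1.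
have [|u [su cu pu]] := ucs_pos_sqrt px (_ : 0 < e / 3); first lra.
have [|v [sv cv pv]] := ucs_pos_sqrt ptx (_ : 0 < e / 3); first lra.
have uv : GRing.comm u v.
  apply: cv; apply: commrB; last by apply/commr_sym/cu.
  by rewrite /GRing.comm -scalerAr -scalerAl mulr1 mul1r.
have := ucs_le_sum_sq su sv uv; rewrite -pC su.
have := pB (u * u) (u * u - x).
have -> : u * u - (u * u - x) = x by zmodule.
have -> : u * u + v * v = rs t + (u * u - x) + (v * v - (rs t - x)).
  by zmodule.
have := pD (rs t + (u * u - x)) (v * v - (rs t - x)).
have := pD (rs t) (u * u - x).
have := prs (p_ge0 (x + y)); rewrite -/t; lra.
Qed.

Lemma ucs_posX g n : ucs_pos g -> ucs_pos (g ^+ n).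
Proof.
move=> pg; rewrite -(odd_double_half n) exprD -addnn exprD.
have sgk : st (g ^+ n./2) = g ^+ n./2 by rewrite stX pg.1.
case: (odd n); rewrite ?expr1 ?expr0 ?mul1r; last exact: ucs_pos_sq.
rewrite mulrA -exprS exprSr.
by apply: ucs_pos_conj => //; apply/commr_sym/commrX.
Qed.

(** Summing the geometric series, [1 - g^n (1 - g)] equals [g] plus the sum over [i < n] of
    [(1 - g) g^i (1 - g)]. *)
Lemma ucs_pos_1_sub_pow g n : ucs_pos g -> ucs_pos (1 - g ^+ n * (1 - g)).
Proof.
move=> pg.
have -> : 1 - g ^+ n * (1 - g) =
    g + \sum_(i < n) (1 - g) * g ^+ i * (1 - g).
  rewrite -mulr_suml -mulr_sumr.
  have -> : (1 - g) * (\sum_(i < n) g ^+ i) = 1 - g ^+ n.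
    by rewrite -[1 - g]opprB mulNr -subrX1 opprB.
  by rewrite !mulrBr !mulr1 mulrBl mul1r; zmodule.
apply: ucs_posD => //; apply: ucs_pos_sum => i; apply: ucs_pos_conj.
- exact: ucs_posX.
- by rewrite stB st1 pg.1.
- by apply/commr_sym; apply: commrB; [exact: commr1|exact/commr_sym/commrX].
Qed.

Let rs1 : rs 1 = 1. Proof. by rewrite rmorph1 scale1r. Qed.

Let diff_sq (x : B) : 1 - (1 - x) * (1 + x) = x * x.
Proof. by rewrite mulrBl !mulrDr !mulr1 !mul1r; zmodule. Qed.

(* Kaplansky's theorem that b* b is positive.  With l = b* b, g = 1 - l and
   c = b g^n, the identity c* c + c c* = 2 (x^2 + y^2), for c = x + i y, and
   c c* <= 1 bound c* c = g^(2n) (1 - g) uniformly in n, so that the powers of g grow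
   at most linearly. *)
Let p1B_le1 b : p b <= 1 -> p (1 - st b * b) <= 1.
Proof.
move=> pb; pose l := st b * b; pose g := 1 - l.
pose g' := 1 - b * st b.
have pl : p l <= 1 by rewrite pC expr_le1.
have sl : st l = l by rewrite stM stK.
have sl' : st (b * st b) = b * st b by rewrite stM stK.
have sg : st g = g by rewrite stB st1 sl.
have pg : ucs_pos g by rewrite /g -rs1; exact: ucs_pos_sub.
have pg' : ucs_pos g'.
  by rewrite /g' -rs1; apply: ucs_pos_sub => //; rewrite -{1}(stK b) pC pst expr_le1.
(* This turns [c c*] into the expression in [g'] that [c* c] is in [g]. *)
have bg n : b * g ^+ n = g' ^+ n * b.
  elim: n => [|n IH]; first by rewrite !expr0 mulr1 mul1r.
  rewrite exprSr mulrA IH -mulrA exprSr -mulrA; congr (_ * _).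
  by rewrite mulrBr mulrBl mulr1 mul1r mulrA.
have bnd n : p (g ^+ (2 * n) * (1 - g)) <= 3.
  pose c := b * g ^+ n.
  have cc : st c * c = g ^+ (2 * n) * (1 - g).
    have lg : l = 1 - g by rewrite /g subKr.
    rewrite stM stX sg mulrA -[_ * st b * b]mulrA -/l lg -mulrA.
    have -> : (1 - g) * g ^+ n = g ^+ n * (1 - g).
      by apply/commr_sym; apply: commrB; [exact: commr1|exact/commr_sym/commrX].
    by rewrite mulrA mul2n -addnn exprD.
  have cc' : c * st c = g' ^+ (2 * n) * (1 - g').
    rewrite stM stX sg mulrA -[c * _]mulrA -exprD addnn -mul2n bg.
    by rewrite -mulrA /g' subKr.
  have p1 := ucs_pos_1_sub_pow (2 * n) pg; rewrite -cc in p1.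
  have p2 := ucs_pos_1_sub_pow (2 * n) pg'; rewrite -cc' in p2.
  have p3 : ucs_pos (st c * c + c * st c).
    pose x := c + st c; pose y := 'i%C *: (c - st c).
    have sx : st x = x by rewrite stD stK addrC.
    have sy : st y = y.
      by rewrite stZ conjCi stB stK scaleNr -scalerN opprB.
    have -> : st c * c + c * st c = (2^-1)%:C%C *: (x * x + y * y).
      rewrite -[LHS]scale1r -(rmorph1 (@real_complex R)) -[1 in LHS](mulVf (_ : 2 != 0))//.
      rewrite rmorphM -scalerA; congr (_ *: _).
      rewrite rmorphMn /= scaler_nat /x /y -scalerAl -scalerAr scalerA mulCii scaleN1r.
      rewrite !mulrDl !mulrDr !mulrN !mulNr; zmodule.
    apply: ucs_posZ; first by rewrite invr_ge0.
    by apply: ucs_posD; exact: ucs_pos_sq.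
  rewrite -cc.
  (* [1 + c* c] and [1 - c* c] are positive with sum [2], so monotonicity gives [p (1 + c* c) <= 2];
     the constant [3] is [2] plus the bound on [p 1]. *)
  have p4 : ucs_pos (1 + st c * c).
    have -> : 1 + st c * c = (1 - c * st c) + (st c * c + c * st c) by zmodule.
    exact: ucs_posD.
  have := ucs_pos_monotone p4 p1.
  have -> : 1 + st c * c + (1 - st c * c) = rs 2 by rewrite (rsD 1 1) rs1; zmodule.
  have := @prs 2; have := pB (1 + st c * c) 1.
  have -> : 1 + st c * c - 1 = st c * c by zmodule.
  by have := ucs_1 H; have : (0 : R) <= 2 by []; move=> ? ? ? /(_ _) ?; lra.
pose K := 3 * (1 + p g).
(* Telescoping: [g^(2n) - g^(2n+2) = g^(2n) (1 - g) (1 + g)], so each step costs at most [K]. *)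
have step n : p (g ^+ (2 * n)) <= 1 + K * n%:R.
  elim: n => [|n IH]; first by rewrite muln0 expr0 mulr0 addr0 (ucs_1 H).
  have := pB (g ^+ (2 * n)) (g ^+ (2 * n) * (1 - g) * (1 + g)).
  have -> : g ^+ (2 * n) - g ^+ (2 * n) * (1 - g) * (1 + g) = g ^+ (2 * n.+1).
    rewrite -[n.+1]addn1 mulnDr muln1 exprD -mulrA expr2.
    rewrite -[X in X - _]mulr1 -mulrBr; congr (_ * _).
    exact: diff_sq.
  have : p (g ^+ (2 * n) * (1 - g) * (1 + g)) <= 3 * (1 + p g).
    apply: le_trans (pM _ _) _; apply: ler_pM => //.
    by apply: le_trans (pD _ _) _; rewrite lerD2r (ucs_1 H).
  by rewrite -/K -[n.+1]addn1 natrD; lra.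
apply: (@exp_2n_linear_bound _ _ 1 K); first by rewrite mulr_ge0// addr_ge0.
by move=> n; rewrite -/l -/g -ucs_exp_2n// expnS; exact: step.
Qed.

Lemma ucs_pos_star_mul b : ucs_pos (st b * b).
Proof.
pose t := p b + 1; have t0 : 0 < t by rewrite /t ltr_wpDl.
have ti : 0 <= t^-1 by rewrite invr_ge0 ltW.
pose b' := t^-1%:C%C *: b.
have pb' : p b' <= 1 by rewrite pZ// mulrC ler_pdivrMr// mul1r lerDl.
have -> : st b * b = (t * t)%:C%C *: (st b' * b').
  rewrite stZr scale_mul scalerA -rmorphM.
  by rewrite -invfM mulfV ?scale1r// mulf_neq0 ?gt_eqF.
apply: ucs_posZ; first by rewrite mulr_ge0// ltW.
split; first by rewrite stM stK.
by exists 1; rewrite rs1; exact: p1B_le1.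
Qed.

End CstarSeminorm.

(** * Limits, density and bounded linear maps in terms of the real-valued norm *)

Lemma small_affine (R : realType) (r e : R) : 0 <= r -> 0 < e ->
  exists2 d : R, 0 < d & d <= 1 /\ 4 * (d * r) + 4 * d <= e.
Proof.
move=> r0 e0; have r4 : 0 < 4 * r + 4 by lra.
exists (Num.min 1 (e / (4 * r + 4))); first by rewrite lt_min ltr01 divr_gt0.
split; first by rewrite ge_min lexx.
have : Num.min 1 (e / (4 * r + 4)) * (4 * r + 4) <= e.
  by rewrite -ler_pdivlMr// ge_min lexx orbT.
by move: (Num.min _ _) => d; rewrite mulrDr mulrCA; lra.
Qed.

Lemma rnorm_cauchy_cvg (R : realType) (V : completeNormedModType R[i]) (u : nat -> V) :
  (forall e : R, 0 < e -> exists N, forall m n, (N <= m)%N -> (N <= n)%N ->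
     rnorm (u m - u n) <= e) ->
  exists l, forall e : R, 0 < e -> exists N, forall n, (N <= n)%N ->
     rnorm (u n - l) <= e.
Proof.
move=> uC.
have : cauchy (u @ \oo).
  apply: cauchy_exP => e /posC_ex[d d0 ->].
  have [|N NP] := uC (d / 2); first lra.
  exists (u N); exists N => // n /= Nn; rewrite -ball_normE /= rnorm_lt.
  by have := NP _ _ (leqnn N) Nn; lra.
move/cauchy_cvg => /cvg_ex[l ul]; exists l => e e0.
move/cvgrPdist_le: ul => /(_ e%:C%C); rewrite ltcR => /(_ e0)[N _ NP].
by exists N => n Nn; rewrite rnormB -rnorm_le; exact: NP.
Qed.

Lemma rnorm_dense (R : realType) (V : normedModType R[i]) (D : set V) (a : V) (e : R) :
  closure D = setT -> 0 < e -> exists2 d, D d & rnorm (a - d) <= e.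
Proof.
move=> Dd e0; have : closure D a by rewrite Dd.
move=> /(_ (ball a e%:C%C)) [|d [Dx ad]]; first by apply: nbhsx_ballx; rewrite ltcR.
by exists d => //; move: ad; rewrite -ball_normE /= rnorm_lt => /ltW.
Qed.

Lemma dense_closure (R : realType) (V : normedModType R[i]) (D : set V) :
  (forall a (e : R), 0 < e -> exists2 d, D d & rnorm (a - d) <= e) ->
  closure D = setT.
Proof.
move=> h; apply/seteqP; split => // a _ B /nbhs_ballP[e /= /posC_ex[d d0 ->]] aB.
have [|x Dx ax] := h a (d / 2); first lra.
exists x; split => //; apply: aB; rewrite -ball_normE /= rnorm_lt; lra.
Qed.

Lemma continuous_rnorm_bound (R : realType) (V W : normedModType R[i])
    (f : {linear V -> W}) :
  continuous f -> exists2 C : R, 0 <= C & forall x, rnorm (f x) <= C * rnorm x.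
Proof.
move=> /(linear_bounded_continuous f)/(linear_boundedP f)[M [Mr MP]].
exists (rnorm M + 1) => [|x]; first by rewrite addr_ge0// rnorm_ge0.
rewrite -rnorm_le rmorphM /= -[(rnorm x)%:C%C]normrE_rnorm; apply: MP.
by rewrite rmorphD /= -[(rnorm M)%:C%C]normrE_rnorm ltr_pwDr// real_ler_norm.
Qed.

Lemma rnorm_bound_continuous (R : realType) (V W : normedModType R[i])
    (f : {linear V -> W}) (C : R) :
  (forall x, rnorm (f x) <= C * rnorm x) -> continuous f.
Proof.
move=> fC; apply/(linear_bounded_continuous f)/(linear_boundedP f).
exists C%:C%C; split => [|r Cr x]; first by apply/complex_realP; exists C.
apply: (@le_trans _ _ (C%:C%C * `|x|)); last by rewrite ler_wpM2r// ltW.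
by rewrite [`|x|]normrE_rnorm -rmorphM rnorm_le.
Qed.

(** Definiteness is dropped so that the operator norm of any representation, faithful or not,
    qualifies. *)
Definition cstar_seminorm (R : realType) (A : banachStarAlg R) (N : A -> R) : Prop :=
  [/\ forall a b, N (a + b) <= N a + N b,
      forall (c : R[i]) a, N (c *: a) = rnorm c * N a,
      forall a b, N (bmul a b) <= N a * N b &
      forall a, N (bmul (bstar a) a) = N a ^+ 2].

Section BanachStar.
Variables (R : realType) (A : banachStarAlg R).

Lemma bmul0l (a : A) : bmul 0 a = 0.
Proof. by rewrite -(scale0r (0 : A)) bmulZl !scale0r. Qed.

Lemma bmul0r (a : A) : bmul a 0 = 0.
Proof. by rewrite -(scale0r (0 : A)) bmulZr !scale0r. Qed.

Lemma bmulNl (a b : A) : bmul (- a) b = - bmul a b.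
Proof. by rewrite -scaleN1r bmulZl scaleN1r. Qed.

Lemma bmulNr (a b : A) : bmul a (- b) = - bmul a b.
Proof. by rewrite -scaleN1r bmulZr scaleN1r. Qed.

Lemma bstarN (a : A) : bstar (- a) = - bstar a.
Proof. by rewrite -scaleN1r bstarZ rmorphN rmorph1 scaleN1r. Qed.

Lemma bstar0 : bstar (0 : A) = 0.
Proof. by rewrite -(scale0r (0 : A)) bstarZ rmorph0 !scale0r. Qed.

Lemma bstarB (a b : A) : bstar (a - b) = bstar a - bstar b.
Proof. by rewrite bstarD bstarN. Qed.

Lemma rnorm_bmul (a b : A) :
  rnorm (bmul a b) <= rnorm a * rnorm b.
Proof. by rewrite -rnorm_le rmorphM /= -!normrE_rnorm bnormM. Qed.

Lemma rnorm_bstar (a : A) : rnorm (bstar a) = rnorm a.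
Proof. by rewrite /rnorm bnorm_star. Qed.

Lemma bmulB (a b c d : A) :
  bmul a b - bmul c d = bmul (a - c) b + bmul c (b - d).
Proof. by rewrite bmulDl bmulDr bmulNl bmulNr; zmodule. Qed.

Lemma rnorm_bmulB (a b c d : A) :
  rnorm (bmul a b - bmul c d) <= rnorm (a - c) * rnorm b + rnorm c * rnorm (b - d).
Proof. by rewrite bmulB (le_trans (rnormD _ _))// lerD// rnorm_bmul. Qed.

End BanachStar.

(** * C*-seminorms on Banach *-algebras *)

Section Unitization.
Variables (R : realType) (A : banachStarAlg R).

Definition unitization : Type := (A * R[i]^o)%type.
HB.instance Definition _ := GRing.Lmodule.on unitization.

Definition unitz_one : unitization := (0, 1).
Definition unitz_mul (x y : unitization) : unitization :=
  (bmul x.1 y.1 + (x.2 : R[i]) *: y.1 + (y.2 : R[i]) *: x.1, x.2 * y.2).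

Lemma unitz_mulA : associative unitz_mul.
Proof.
move=> [a x] [b y] [c z]; rewrite /unitz_mul /=; congr pair; last exact: mulrA.
rewrite !bmulDl !bmulDr !scalerDr !bmulZl !bmulZr !bmulA !scalerA.
rewrite [z * x]mulrC [z * y]mulrC; zmodule.
Qed.

Lemma unitz_mul1r : left_id unitz_one unitz_mul.
Proof.
move=> [a x]; rewrite /unitz_mul /=; congr pair; last exact: mul1r.
by rewrite scale1r scaler0 bmul0l add0r addr0.
Qed.

Lemma unitz_mulr1 : right_id unitz_one unitz_mul.
Proof.
move=> [a x]; rewrite /unitz_mul /=; congr pair; last exact: mulr1.
by rewrite scale1r scaler0 bmul0r !add0r.
Qed.

Lemma unitz_mulDl : left_distributive unitz_mul +%R.
Proof.
move=> [a x] [b y] [c z]; rewrite /unitz_mul /=; congr pair; last exact: mulrDl.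
rewrite /= bmulDl !scalerDl !scalerDr; zmodule.
Qed.

Lemma unitz_mulDr : right_distributive unitz_mul +%R.
Proof.
move=> [a x] [b y] [c z]; rewrite /unitz_mul /=; congr pair; last exact: mulrDr.
rewrite /= bmulDr !scalerDl !scalerDr; zmodule.
Qed.

Lemma unitz_one_neq0 : unitz_one != 0.
Proof. by apply/eqP => -[/eqP]; rewrite oner_eq0. Qed.

HB.instance Definition _ := GRing.Zmodule_isNzRing.Build unitization
  unitz_mulA unitz_mul1r unitz_mulr1 unitz_mulDl unitz_mulDr unitz_one_neq0.

Lemma unitz_scaleAl (c : R[i]) (x y : unitization) : c *: (x * y) = (c *: x) * y.
Proof.
case: x y => [a x] [b y]; congr pair => /=; last exact: mulrA.
by rewrite !scalerDr bmulZl !scalerA [y * c]mulrC.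
Qed.

HB.instance Definition _ := GRing.Lmodule_isLalgebra.Build R[i] unitization unitz_scaleAl.

Lemma unitz_scaleAr (c : R[i]) (x y : unitization) : c *: (x * y) = x * (c *: y).
Proof.
case: x y => [a x] [b y]; congr pair => /=; last by rewrite /GRing.scale/= mulrCA.
by rewrite !scalerDr bmulZr !scalerA [x * c]mulrC.
Qed.

HB.instance Definition _ := GRing.Lalgebra_isAlgebra.Build R[i] unitization unitz_scaleAr.

Definition unitz_in (a : A) : unitization := (a, 0).
Definition unitz_star (x : unitization) : unitization := (bstar x.1, (x.2 : R[i])^*).
Definition unitz_act (x : unitization) (c : A) : A := bmul x.1 c + (x.2 : R[i]) *: c.

Lemma unitz_actM x y c : unitz_act (x * y) c = unitz_act x (unitz_act y c).
Proof.
case: x y => [a x] [b y]; rewrite /unitz_act /=.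
by rewrite !bmulDl !bmulDr !bmulZl !bmulZr !scalerDr !scalerA bmulA; zmodule.
Qed.

Lemma unitz_inM a b : unitz_in (bmul a b) = unitz_in a * unitz_in b.
Proof. by congr pair => /=; rewrite ?mulr0// !scale0r !addr0. Qed.

Lemma unitz_inD a b : unitz_in (a + b) = unitz_in a + unitz_in b.
Proof. by congr pair; rewrite /= addr0. Qed.

Lemma unitz_in_star a : unitz_in (bstar a) = unitz_star (unitz_in a).
Proof. by congr pair; rewrite /= conjC0. Qed.

End Unitization.

Section UnitizationNorm.
Variables (R : realType) (A : banachStarAlg R) (N : A -> R).
Hypothesis NC : cstar_seminorm N.

Let ND : forall a b, N (a + b) <= N a + N b. Proof. by case: NC. Qed.

Let NZ : forall (c : R[i]) a, N (c *: a) = rnorm c * N a. Proof. by case: NC. Qed.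

Let NM : forall a b, N (bmul a b) <= N a * N b. Proof. by case: NC. Qed.

Let NS : forall a, N (bmul (bstar a) a) = N a ^+ 2. Proof. by case: NC. Qed.

Lemma cstar_seminormN a : N (- a) = N a.
Proof. by rewrite -scaleN1r NZ rnormN (rnorm_real 1) normr1 mul1r. Qed.

Lemma cstar_seminorm0 : N 0 = 0.
Proof. by rewrite -(scale0r 0) NZ rnorm0 mul0r. Qed.

Lemma cstar_seminorm_ge0 a : 0 <= N a.
Proof. by have := ND a (- a); rewrite subrr cstar_seminorm0 cstar_seminormN; lra. Qed.

Lemma cstar_seminorm_star a : N (bstar a) = N a.
Proof.
apply: (star_isometry (p := N) (@bstarK R A)) => b; first exact: cstar_seminorm_ge0.
by rewrite -NS; exact: NM.
Qed.

Local Notation N0 := cstar_seminorm_ge0.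

(** The operator norm of left multiplication on [A] with the seminorm [N]. It can be degenerate even
    if [N] is not: when [A] has a unit [u], it vanishes at [(u, -1)]. *)
Definition unitz_norm (x : unitization A) : R :=
  sup [set N (unitz_act x c) | c in [set c | N c <= 1]].

Let act_bound x c : N (unitz_act x c) <= (N x.1 + rnorm (x.2 : R[i])) * N c.
Proof. by rewrite mulrDl (le_trans (ND _ _))// NZ lerD. Qed.

Let bounded x : has_ubound [set N (unitz_act x c) | c in [set c | N c <= 1]].
Proof.
exists (N x.1 + rnorm (x.2 : R[i])) => _ [c /= c1 <-].
apply: le_trans (act_bound _ _) _; apply: ler_piMr => //.
by rewrite addr_ge0 ?N0 ?rnorm_ge0.
Qed.

Lemma unitz_actZ (x : unitization A) (k : R[i]) c : unitz_act x (k *: c) = k *: unitz_act x c.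
Proof. by rewrite /unitz_act bmulZr scalerDr !scalerA mulrC. Qed.

Lemma unitz_act_le x c : N (unitz_act x c) <= unitz_norm x * N c.
Proof.
have [c0|cn0] := eqVneq (N c) 0.
  by have := act_bound x c; rewrite c0 !mulr0.
have cp : 0 < N c by rewrite lt_def cn0 N0.
pose k := (N c)^-1; have k0 : 0 <= k by rewrite invr_ge0 ltW.
rewrite -ler_pdivrMr// mulrC -/k.
have -> : k * N (unitz_act x c) = N (unitz_act x (k%:C%C *: c)).
  by rewrite unitz_actZ NZ rnorm_real ger0_norm.
apply: ub_le_sup; first exact: bounded.
exists (k%:C%C *: c) => //=; rewrite NZ rnorm_real ger0_norm// /k mulVf//.
Qed.

Lemma unitz_norm_le x K : 0 <= K -> (forall c, N (unitz_act x c) <= K * N c) ->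
  unitz_norm x <= K.
Proof.
move=> K0 xK; apply: ge_sup; first by exists (N (unitz_act x 0)); exists 0 => //=; rewrite cstar_seminorm0 ler01.
move=> _ [c /= c1 <-]; apply: le_trans (xK c) _; exact: ler_piMr.
Qed.

Lemma unitz_norm_ge0 x : 0 <= unitz_norm x.
Proof.
apply: le_trans (N0 (unitz_act x 0)) _; apply: ub_le_sup; first exact: bounded.
by exists 0 => //=; rewrite cstar_seminorm0 ler01.
Qed.

(** The lower bound is read off at [bstar a], by the C*-identity. *)
Lemma unitz_norm_in a : unitz_norm (unitz_in a) = N a.
Proof.
have actE c : unitz_act (unitz_in a) c = bmul a c.
  by rewrite /unitz_act /= scale0r addr0.
apply/eqP; rewrite eq_le; apply/andP; split.
  by apply: unitz_norm_le => [|c]; [exact: N0|rewrite actE].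
have [->|a0] := eqVneq (N a) 0; first exact: unitz_norm_ge0.
have ap : 0 < N a by rewrite lt_def a0 N0.
have := unitz_act_le (unitz_in a) (bstar a).
by rewrite actE -{1}(bstarK a) NS cstar_seminorm_star expr2 ler_pM2r.
Qed.

(** For [c] in [A], [N (x c) ^+ 2] is [N] of [c* (x* x) c], at most the norm of [x* x] times
    [N c ^+ 2]. *)
Let norm_sq x : unitz_norm x ^+ 2 <= unitz_norm (unitz_star x * x).
Proof.
set S := unitz_norm (_ * _).
have S0 : 0 <= S by exact: unitz_norm_ge0.
rewrite -[leRHS]sqr_sqrtr// lerXn2r ?nnegrE ?unitz_norm_ge0 ?sqrtr_ge0//.
apply: unitz_norm_le => [|c]; first exact: sqrtr_ge0.
rewrite -(@ler_pXn2r _ 2)// ?nnegrE ?N0 ?mulr_ge0 ?N0 ?sqrtr_ge0//.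
rewrite -NS exprMn sqr_sqrtr//.
have -> : bmul (bstar (unitz_act x c)) (unitz_act x c) =
    bmul (bstar c) (unitz_act (unitz_star x * x) c).
  rewrite unitz_actM /unitz_act /=.
  by rewrite bstarD bstarM bstarZ !(bmulDl, bmulDr, bmulZl, bmulZr, bmulA, scalerDr, scalerA) [x.2 * _]mulrC.
apply: le_trans (NM _ _) _; rewrite cstar_seminorm_star.
apply: le_trans (ler_wpM2l (N0 _) (unitz_act_le _ _)) _.
by rewrite mulrCA expr2.
Qed.

Lemma unitz_cstar : unital_cstar_seminorm (@unitz_star R A) unitz_norm.
Proof.
have nM x y : unitz_norm (x * y) <= unitz_norm x * unitz_norm y.
  apply: unitz_norm_le => [|c]; first by rewrite mulr_ge0// unitz_norm_ge0.
  rewrite unitz_actM -mulrA; apply: le_trans (unitz_act_le _ _) _.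
  by rewrite ler_wpM2l ?unitz_norm_ge0 ?unitz_act_le.
have stK : involutive (@unitz_star R A).
  by move=> [a x]; rewrite /unitz_star /= bstarK conjCK.
have nst x : unitz_norm (unitz_star x) = unitz_norm x.
  apply: (star_isometry (p := unitz_norm) stK) => y; first exact: unitz_norm_ge0.
  exact: le_trans (norm_sq y) (nM _ _).
have nZ (c : R[i]) x : unitz_norm (c *: x) = rnorm c * unitz_norm x.
  apply: rnorm_homogeneous => [|k y]; first exact: unitz_norm_ge0.
  apply: unitz_norm_le => [|d]; first by rewrite mulr_ge0 ?rnorm_ge0 ?unitz_norm_ge0.
  have -> : unitz_act (k *: y) d = k *: unitz_act y d.
    by rewrite /unitz_act /= bmulZl scalerDr scalerA.
  by rewrite NZ -mulrA ler_wpM2l ?rnorm_ge0 ?unitz_act_le.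
split => //.
- by move=> [a x] [b y]; rewrite /unitz_star /= bstarD rmorphD.
- by move=> c [a x]; rewrite /unitz_star /= bstarZ rmorphM.
- move=> [a x] [b y]; congr pair => /=; last by rewrite rmorphM mulrC.
  by rewrite !bstarD bstarM !bstarZ; zmodule.
- move=> x y; apply: unitz_norm_le => [|c]; first by rewrite addr_ge0// unitz_norm_ge0.
  have -> : unitz_act (x + y) c = unitz_act x c + unitz_act y c.
    by rewrite /unitz_act /= bmulDl scalerDl; zmodule.
  by rewrite mulrDl (le_trans (ND _ _))// lerD// unitz_act_le.
- move=> x; apply/eqP; rewrite eq_le norm_sq andbT.
  by rewrite (le_trans (nM _ _))// nst expr2.
- apply: unitz_norm_le => // c.
  have -> : unitz_act 1 c = c.
    by rewrite /unitz_act /= scale1r bmul0l add0r.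
  by rewrite mul1r.
Qed.

Theorem cstar_seminorm_monotone (c : A) (I : Type) (r : seq I) (F : I -> A) :
  N (bmul (bstar c) c) <=
  N (bmul (bstar c) c + \sum_(i <- r) bmul (bstar (F i)) (F i)).
Proof.
have inS a : unitz_in (bmul (bstar a) a) = unitz_star (unitz_in a) * unitz_in a.
  by rewrite unitz_inM unitz_in_star.
rewrite -!unitz_norm_in unitz_inD inS.
have -> : unitz_in (\sum_(i <- r) bmul (bstar (F i)) (F i)) =
    \sum_(i <- r) unitz_star (unitz_in (F i)) * unitz_in (F i).
  elim: r => [|i r IH]; first by rewrite !big_nil.
  by rewrite !big_cons unitz_inD IH inS.
apply: (ucs_pos_monotone unitz_cstar); first exact: (ucs_pos_star_mul unitz_cstar).
apply: (ucs_pos_sum unitz_cstar) => i; exact: (ucs_pos_star_mul unitz_cstar).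
Qed.

End UnitizationNorm.

Section Contractive.
Variables (R : realType) (A : banachStarAlg R).

(* [1 - z] is a square root of [1 - h^2]. *)
Lemma banach_sqrt (h : A) : bstar h = h -> rnorm h < 1 ->
  exists z, [/\ bstar z = z, bmul h z = bmul z h & z + z = bmul h h + bmul z z].
Proof.
move=> sh h1; pose r := rnorm h; have r0 : 0 <= r := rnorm_ge0 h.
pose f z := 2^-1%:C%C *: (bmul h h + bmul z z).
pose z n := iter n f 0.
have i2 : 0 <= 2^-1 :> R by lra.
have zr n : rnorm (z n) <= r.
  elim: n => [|n IH]; first by rewrite rnorm0.
  rewrite /= rnormZr//; apply: le_trans (ler_wpM2l i2 (rnormD _ _)) _.
  have := rnorm_bmul h h; have := rnorm_bmul (z n) (z n).
  have : rnorm (z n) * rnorm (z n) <= r * 1.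
    by apply: ler_pM => //; rewrite ?rnorm_ge0// (le_trans IH)// ltW.
  have : rnorm h * rnorm h <= r * 1.
    by apply: ler_pM => //; rewrite ?rnorm_ge0// ltW.
  rewrite -/(z n); lra.
have dz n : rnorm (z n.+1 - z n) <= r ^+ n.
  elim: n => [|n IH]; first by rewrite subr0 expr0 (le_trans (zr 1))// ltW.
  rewrite [z n.+2]/(f (z n.+1)) [X in _ - X]/(f (z n)) -scalerBr rnormZr//.
  have -> : bmul h h + bmul (z n.+1) (z n.+1) - (bmul h h + bmul (z n) (z n)) =
    bmul (z n.+1) (z n.+1) - bmul (z n) (z n) by zmodule.
  have := rnorm_bmulB (z n.+1) (z n.+1) (z n) (z n).
  have : rnorm (z n.+1 - z n) * rnorm (z n.+1) <= r ^+ n * r.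
    by apply: ler_pM; rewrite ?rnorm_ge0.
  have : rnorm (z n) * rnorm (z n.+1 - z n) <= r * r ^+ n.
    by apply: ler_pM; rewrite ?rnorm_ge0.
  rewrite exprSr; lra.
have r1 : 0 < 1 - r by rewrite subr_gt0.
(* The geometric sum of the increments, multiplied by [1 - r] to avoid a division. *)
have dzk n k : rnorm (z (n + k)%N - z n) * (1 - r) <= r ^+ n * (1 - r ^+ k).
  elim: k => [|k IH]; first by rewrite addn0 subrr rnorm0 mul0r expr0 subrr mulr0.
  have := rnormD (z (n + k.+1)%N - z (n + k)%N) (z (n + k)%N - z n).
  rewrite subrKA => le.
  have := dz (n + k)%N; rewrite -addnS exprD => dzn.
  apply: le_trans (ler_wpM2r (ltW r1) le) _; rewrite mulrDl.
  have := ler_wpM2r (ltW r1) dzn; rewrite exprSr; lra.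
have rn_small e : 0 < e -> exists N, forall n, (N <= n)%N -> r ^+ n <= e.
  move=> e0; have : (fun n => r ^+ n : R) @ \oo --> (0 : R).
    by apply: cvg_expr; rewrite ger0_norm.
  move/cvgrPdist_le => /(_ e e0)[N _ NP]; exists N => n Nn.
  by have := NP n Nn; rewrite /= sub0r normrN ger0_norm// exprn_ge0.
have [l zl] : exists l, forall e : R, 0 < e -> exists N, forall n, (N <= n)%N ->
     rnorm (z n - l) <= e.
  apply: rnorm_cauchy_cvg => e e0.
  have [|N NP] := rn_small (e * (1 - r) / 2); first by rewrite divr_gt0 ?mulr_gt0.
  have zN n : (N <= n)%N -> rnorm (z n - z N) <= e / 2.
    move=> /subnKC <-; rewrite -(ler_pM2r r1); apply: le_trans (dzk _ _) _.
    apply: le_trans (_ : r ^+ N <= _); last by have := NP N (leqnn N); lra.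
    by rewrite ler_piMr ?exprn_ge0// gerBl exprn_ge0.
  exists N => m n Nm Nn; rewrite -(subrKA (z N)).
  apply: le_trans (rnormD _ _) _; rewrite [rnorm (z N - _)]rnormB.
  by have := zN _ Nm; have := zN _ Nn; lra.
have zl' e : 0 < e -> exists n, rnorm (z n - l) <= e /\ rnorm (z n.+1 - l) <= e.
  move=> e0; have [N NP] := zl e e0; exists N.
  by split; apply: NP; rewrite ?leqnSn.
have sz n : bstar (z n) = z n.
  elim: n => [|n IH]; first exact: bstar0.
  by rewrite /= -/(z n) bstarZ conjC_real bstarD !bstarM sh IH.
have hz n : bmul h (z n) = bmul (z n) h.
  elim: n => [|n IH]; first by rewrite bmul0l bmul0r.
  rewrite /= -/(z n) bmulZl bmulZr bmulDl bmulDr !bmulA IH; congr (_ *: (_ + _)).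
  by rewrite -!bmulA IH.
have zz n : z n.+1 + z n.+1 = bmul h h + bmul (z n) (z n).
  rewrite /= -/(z n) -scalerDl -rmorphD.
  by have -> : 2^-1 + 2^-1 = 1 :> R by [lra]; rewrite scale1r.
exists l; split.
- apply: (rnorm_small_eq 2) => // e e0; have [n [nl _]] := zl' e e0.
  have -> : bstar l - l = (bstar l - bstar (z n)) + (z n - l) by rewrite sz subrKA.
  apply: le_trans (rnormD _ _) _; rewrite -bstarB rnorm_bstar rnormB; lra.
- apply: (rnorm_small_eq (rnorm h + rnorm h)) => [|e e0].
    by rewrite addr_ge0 ?rnorm_ge0.
  have [n [nl _]] := zl' e e0.
  have -> : bmul h l - bmul l h = bmul h (l - z n) + bmul (z n - l) h.
    by rewrite bmulDl bmulDr bmulNl bmulNr hz; zmodule.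
  apply: le_trans (rnormD _ _) _; rewrite mulrDl lerD//.
    by apply: le_trans (rnorm_bmul _ _) _; rewrite rnormB ler_wpM2l ?rnorm_ge0.
  by apply: le_trans (rnorm_bmul _ _) _; rewrite mulrC ler_wpM2l ?rnorm_ge0.
- apply: (rnorm_small_eq (2 + r + rnorm l)) => [|e e0].
    by rewrite !addr_ge0 ?rnorm_ge0.
  have [n [nl nl']] := zl' e e0.
  have -> : l + l - (bmul h h + bmul l l) =
     (l - z n.+1) + (l - z n.+1) + (bmul (z n) (z n) - bmul l l).
    have -> : bmul h h = z n.+1 + z n.+1 - bmul (z n) (z n) by rewrite zz; zmodule.
    by zmodule.
  have := rnorm_bmulB (z n) (z n) l l.
  have := rnormD (l - z n.+1) (l - z n.+1).
  have := rnormD ((l - z n.+1) + (l - z n.+1)) (bmul (z n) (z n) - bmul l l).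
  rewrite rnormB in nl'.
  have : rnorm (z n - l) * rnorm (z n) <= e * r by apply: ler_pM; rewrite ?rnorm_ge0.
  have := ler_wpM2l (rnorm_ge0 l) nl.
  lra.
Qed.

(** No continuity of [N] is assumed; completeness of [A] replaces it. A self-adjoint [h] of norm
    below [1] satisfies [h^2 + (1 - z)^2 = 1] in the unitization, which forces [N h <= 1]. A general
    [a] is rescaled by a [t] strictly between [rnorm a] and [N a], and the first case is applied to
    [b* b]. *)
Theorem cstar_seminorm_contractive (N : A -> R) : cstar_seminorm N ->
  forall a, N a <= rnorm a.
Proof.
move=> NC; have UC := unitz_cstar NC.
have sa h : bstar h = h -> rnorm h < 1 -> N h <= 1.
  move=> sh h1; have [z [sz hz zz]] := banach_sqrt sh h1.
  pose x := unitz_in h; pose y := 1 - unitz_in z.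
  have sx : unitz_star x = x by rewrite -unitz_in_star sh.
  have sy : unitz_star y = y.
    congr pair => /=; first by rewrite bstarD bstarN bstar0 sz.
    by rewrite subr0 rmorph1.
  have xy : GRing.comm x y.
    apply: commrB; first exact: commr1.
    by rewrite /GRing.comm -!unitz_inM hz.
  have := ucs_le_sum_sq UC sx sy xy.
  have -> : x * x + y * y = 1.
    rewrite /y mulrBl mul1r mulrBr mulr1 -!unitz_inM.
    have -> : bmul h h = z + z - bmul z z by rewrite zz; zmodule.
    rewrite !unitz_inD; have -> : unitz_in (- bmul z z) = - unitz_in (bmul z z).
      by congr pair; rewrite /= oppr0.
    by zmodule.
  move=> /le_trans /(_ (ucs_1 UC)); rewrite unitz_norm_in//.
  by rewrite expr_le1 ?cstar_seminorm_ge0.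
move=> a; rewrite leNgt; apply/negP => aN.
pose t := (rnorm a + N a) / 2; have a0 := rnorm_ge0 a.
have ta : rnorm a < t by rewrite /t; lra.
have tN : t < N a by rewrite /t; lra.
have t0 : 0 < t by exact: le_lt_trans ta.
have ti : 0 <= t^-1 by rewrite invr_ge0 ltW.
pose b := t^-1%:C%C *: a.
have b1 : rnorm b < 1 by rewrite rnormZr// mulrC ltr_pdivrMr// mul1r.
have bN : 1 < N b.
  have [_ NZ _ _] := NC; rewrite NZ rnorm_real ger0_norm// mulrC ltr_pdivlMr//.
  by rewrite mul1r.
have := sa (bmul (bstar b) b); rewrite bstarM bstarK => /(_ erefl).
have [_ _ _ ->] := NC => le.
have : N b ^+ 2 <= 1.
  apply: le; apply: le_lt_trans (rnorm_bmul _ _) _; rewrite rnorm_bstar.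
  by rewrite mulr_ilt1 ?rnorm_ge0.
by rewrite expr2; nra.
Qed.

End Contractive.

(** * The Hahn-Banach theorem *)

Section HahnBanach.
Variables (R : realType) (V : lmodType R[i]).

(** For homogeneity [<=] is enough: applied to the inverse scalar it gives equality. *)
Definition sublinear (p : V -> R) : Prop :=
  (forall x y, p (x + y) <= p x + p y) /\
  (forall (t : R) x, 0 < t -> p (t%:C%C *: x) <= t * p x).

Lemma sublinearZ p t x : sublinear p -> 0 < t -> p (t%:C%C *: x) = t * p x.
Proof.
move=> [_ pZ] t0; apply/eqP; rewrite eq_le pZ//=.
have ti : 0 < t^-1 by rewrite invr_gt0.
have := pZ t^-1 (t%:C%C *: x) ti.
by rewrite scalerA -rmorphM mulVf ?gt_eqF// scale1r mulrC ler_pdivlMr// mulrC.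
Qed.

Lemma sublinear0 p : sublinear p -> p 0 = 0.
Proof. by move=> sp; have := sublinearZ 0 sp (ltr0n R 2); rewrite scaler0; lra. Qed.

Lemma sublinearN_ge p x : sublinear p -> - p (- x) <= p x.
Proof. by move=> sp; have := sp.1 x (- x); rewrite subrr (sublinear0 sp); lra. Qed.

(* A minimal sublinear functional is linear; [dir p x] is a sublinear functional below
   [p] with value [- p x] or less at [- x]. *)
Let dir (p : V -> R) (x : V) (y : V) : R :=
  inf [set p (y + t%:C%C *: x) - t * p x | t in [set t | 0 < t]].

Let dir_lb p x y t : sublinear p -> 0 < t -> - p (- y) <= p (y + t%:C%C *: x) - t * p x.
Proof.
move=> sp t0; have := sp.1 (y + t%:C%C *: x) (- y).
by rewrite addrAC subrr add0r (sublinearZ _ sp t0); lra.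
Qed.

Let dir_le p x y t : sublinear p -> 0 < t -> dir p x y <= p (y + t%:C%C *: x) - t * p x.
Proof.
move=> sp t0; apply: ge_inf; last by exists t.
by exists (- p (- y)) => _ [s /= s0 <-]; apply: dir_lb.
Qed.

Let le_dir p x y K : (forall t, 0 < t -> K <= p (y + t%:C%C *: x) - t * p x) -> K <= dir p x y.
Proof.
move=> h; apply: lb_le_inf; first by exists (p (y + 1%:C%C *: x) - 1 * p x); exists 1 => //; exact: ltr01.
by move=> _ [t t0 <-]; exact: h.
Qed.

Let dir_approx p x y e : sublinear p -> 0 < e ->
  exists2 t, 0 < t & p (y + t%:C%C *: x) - t * p x < dir p x y + e.
Proof.
move=> sp e0; have [|_ [t t0 <-] te] := @inf_adherent _ [set p (y + t%:C%C *: x) - t * p x | t in [set t | 0 < t]] e e0.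
  split; first by exists (p (y + 1%:C%C *: x) - 1 * p x); exists 1 => //; exact: ltr01.
  by exists (- p (- y)) => _ [s /= s0 <-]; apply: dir_lb.
by exists t.
Qed.

Let dir_sublinear p x : sublinear p -> sublinear (dir p x).
Proof.
move=> sp; split => [y z|s y s0].
  apply/ler_addgt0Pr => e e0.
  have [|t t0 te] := @dir_approx p x y (e / 2) sp; first lra.
  have [|u u0 ue] := @dir_approx p x z (e / 2) sp; first lra.
  have := @dir_le p x (y + z) (t + u) sp (addr_gt0 t0 u0).
  have := sp.1 (y + t%:C%C *: x) (z + u%:C%C *: x).
  have -> : y + t%:C%C *: x + (z + u%:C%C *: x) = y + z + (t + u)%:C%C *: x.
    by rewrite rmorphD scalerDl; zmodule.
  lra.
rewrite -ler_pdivrMl//; apply: le_dir => t t0; rewrite ler_pdivrMl// mulrBr.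
rewrite -(sublinearZ _ sp s0) scalerDr scalerA -rmorphM mulrA.
by apply: dir_le => //; rewrite mulr_gt0.
Qed.

Let dir_lower p x : sublinear p -> forall y, dir p x y <= p y.
Proof.
move=> sp y; apply/ler_addgt0Pr => e e0.
pose t := e / (`|p x| + `|p x| + 1).
have d0 : 0 < `|p x| + `|p x| + 1 by rewrite ltr_wpDl// addr_ge0.
have t0 : 0 < t by rewrite divr_gt0.
have := dir_le x y sp t0; have := sp.1 y (t%:C%C *: x); rewrite (sublinearZ _ sp t0).
by have := ltW e0; lra.
Qed.

Let dirN p x : sublinear p -> dir p x (- x) <= - p x.
Proof.
move=> sp; have := dir_le x (- x) sp ltr01.
by rewrite scale1r addNr (sublinear0 sp); lra.
Qed.

Definition real_linear (f : V -> R) : Prop :=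
  (forall x y, f (x + y) = f x + f y) /\ (forall (t : R) x, f (t%:C%C *: x) = t * f x).

Lemma real_linearN f x : real_linear f -> f (- x) = - f x.
Proof.
by move=> [_ /(_ (-1) x)]; rewrite rmorphN rmorph1 scaleN1r mulN1r.
Qed.

Let minimal_linear p : sublinear p ->
  (forall p', sublinear p' -> (forall x, p' x <= p x) -> forall x, p x <= p' x) ->
  real_linear p.
Proof.
move=> sp pmin.
have pN x : p (- x) = - p x.
  apply/eqP; rewrite eq_le; apply/andP; split.
    apply: le_trans (dirN x sp); apply: pmin; first exact: dir_sublinear.
    exact: dir_lower.
  by have := sublinearN_ge (- x) sp; rewrite opprK.
have pD x y : p (x + y) = p x + p y.
  apply/eqP; rewrite eq_le sp.1 /=.
  by have := sp.1 (x + y) (- y); rewrite addrK pN; lra.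
split => // t x; have [t0|t0|->] := ltgtP t 0; last by rewrite mul0r scale0r (sublinear0 sp).
  rewrite -[t]opprK rmorphN scaleNr pN sublinearZ ?mulNr//.
  by rewrite oppr_gt0.
exact: sublinearZ.
Qed.

(** Zorn's lemma is applied below [dir q x0] rather than below [q]: this forces the value at [- x0],
    and so the value at [x0] once the minimal functional is known to be linear. *)
Theorem hahn_banach_sublinear (q : V -> R) (x0 : V) : sublinear q ->
  exists f, [/\ real_linear f, forall x, f x <= q x & f x0 = q x0].
Proof.
move=> sq; pose q0 := dir q x0; have sq0 := dir_sublinear x0 sq.
pose P (p : V -> R) := sublinear p /\ forall x, p x <= q0 x.
pose T := {p : V -> R | `[< P p >]}.
have TP (p : T) : P (val p) by apply/asboolP/(valP p).
pose rT (p1 p2 : T) := `[< forall x, val p2 x <= val p1 x >].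
have Pq0 : P q0 by [].
have [|p1 p2 p3 /asboolP h1 /asboolP h2|p1 p2 /asboolP h1 /asboolP h2|A Atot|pm pmin] := @Zorn T rT.
- by move=> p; apply/asboolP => x.
- by apply/asboolP => x; exact: le_trans (h2 x) (h1 x).
- by apply/val_inj/funext => x; apply/eqP; rewrite eq_le h1 h2.
- have [->|/set0P[a0 Aa0]] := eqVneq A set0.
    by exists (exist _ q0 (asboolT Pq0)).
  (* The pointwise infimum bounds the chain; it is subadditive because any two members of the chain
     are comparable. *)
  pose m x := inf [set val p x | p in A].
  have lb x : has_lbound [set val p x | p in A].
    exists (- q0 (- x)) => _ [p Ap <-]; have [sp pq] := TP p.
    by have := sublinearN_ge x sp; have := pq (- x); lra.
  have mle p x : A p -> m x <= val p x by move=> Ap; apply: ge_inf => //; exists p.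
  have lem K x : (forall p, A p -> K <= val p x) -> K <= m x.
    move=> h; apply: lb_le_inf; first by exists (val a0 x); exists a0.
    by move=> _ [p Ap <-]; exact: h.
  have mapprox x e : 0 < e -> exists2 p, A p & val p x < m x + e.
    move=> e0; have [|_ [p Ap <-] pe] := @inf_adherent _ [set val p x | p in A] e e0.
      by split => //; exists (val a0 x); exists a0.
    by exists p.
  have sm : P m.
    split; last by move=> x; apply: le_trans (mle _ _ Aa0) _; exact: (TP a0).2.
    split => [x y|t x t0].
      apply/ler_addgt0Pr => e e0.
      have [|p Ap pe] := mapprox x (e / 2); first lra.
      have [|r Ar re] := mapprox y (e / 2); first lra.
      have [/asboolP pr|/asboolP pr] := Atot _ _ Ap Ar.
        have := mle _ (x + y) Ar; have := (TP r).1.1 x y; have := pr x; lra.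
      have := mle _ (x + y) Ap; have := (TP p).1.1 x y; have := pr y; lra.
    rewrite -ler_pdivrMl//; apply: lem => p Ap; rewrite ler_pdivrMl//.
    apply: le_trans (mle _ _ Ap) _; exact: (TP p).1.2.
  exists (exist _ m (asboolT sm)) => p Ap; apply/asboolP => x; exact: mle.
have [sp pq] := TP pm.
have lp : real_linear (val pm).
  apply: minimal_linear => // p' sp' p'pm x.
  have Pp' : P p' by split => // y; exact: le_trans (p'pm y) (pq y).
  have -> // : pm = exist _ p' (asboolT Pp').
  by apply/esym/pmin/asboolP.
exists (val pm); split => // [x|]; first by apply: le_trans (pq x) _; exact: dir_lower.
apply/eqP; rewrite eq_le; apply/andP; split.
  by apply: le_trans (pq x0) _; exact: dir_lower.
by have := le_trans (pq (- x0)) (dirN x0 sq); rewrite real_linearN// lerN2.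
Qed.

End HahnBanach.

(** * Hilbert space completion *)

Section SemiInner.
Variables (R : realType) (V : lmodType R[i]) (dot : V -> V -> R[i]).

Record semi_inner : Prop := SemiInner {
  si_Dl : forall x y z, dot (x + y) z = dot x z + dot y z;
  si_Zl : forall (c : R[i]) x y, dot (c *: x) y = c * dot x y;
  si_C : forall x y, dot x y = (dot y x)^*;
  si_ge0 : forall x, 0 <= dot x x }.

Hypothesis S : semi_inner.

Lemma si_Dr x y z : dot x (y + z) = dot x y + dot x z.
Proof.
by rewrite (si_C S) (si_Dl S) rmorphD [dot x y](si_C S) [dot x z](si_C S).
Qed.

Lemma si_Zr (c : R[i]) x y : dot x (c *: y) = c^* * dot x y.
Proof. by rewrite (si_C S) (si_Zl S) rmorphM [dot x y](si_C S). Qed.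

Lemma si_Nl x y : dot (- x) y = - dot x y.
Proof. by rewrite -scaleN1r (si_Zl S) mulN1r. Qed.

Lemma si_Nr x y : dot x (- y) = - dot x y.
Proof. by rewrite -scaleN1r si_Zr rmorphN rmorph1 mulN1r. Qed.

Definition snorm (x : V) : R := Num.sqrt (complex.Re (dot x x)).

Lemma snorm_ge0 x : 0 <= snorm x. Proof. exact: sqrtr_ge0. Qed.

Lemma si_Re_ge0 x : 0 <= complex.Re (dot x x).
Proof. by have := si_ge0 S x; rewrite lecE => /andP[]. Qed.

Lemma snorm_sq x : snorm x ^+ 2 = complex.Re (dot x x).
Proof. by rewrite /snorm sqr_sqrtr ?si_Re_ge0. Qed.

Lemma si_self x : dot x x = (snorm x ^+ 2)%:C%C.
Proof.
by rewrite /snorm sqr_sqrtr ?si_Re_ge0// RRe_real// ger0_real// (si_ge0 S).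
Qed.

(** Positivity at [x - s l y], for [l = dot x y] and real [s], is a quadratic inequality in [s]. The
    choice [s = 1 / |y|^2] gives the bound; if [|y| = 0], a large [s] forces [l = 0]. *)
Lemma cauchy_schwarz x y : rnorm (dot x y) <= snorm x * snorm y.
Proof.
set l := dot x y; have [L LE] : exists L, L = rnorm l ^+ 2 by exists (rnorm l ^+ 2).
have ll : l * l^* = L%:C%C by rewrite -normCK normrE_rnorm LE -rmorphXn.
have quad (s : R) : 0 <= snorm x ^+ 2 - 2 * s * L + s ^+ 2 * L * snorm y ^+ 2.
  rewrite -lecR; have := si_ge0 S (x - (s%:C%C * l) *: y).
  rewrite (si_Dl S) !si_Dr !si_Nl !si_Nr !(si_Zl S) !si_Zr.
  rewrite [dot y x](si_C S) -/l !si_self !rmorphM /= conjC_real opprK.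
  have -> : 2 * s * L = s * L + s * L by ring.
  rewrite !(rmorphD, rmorphN, rmorphM, rmorphXn) /= -ll; congr (_ <= _); ring.
rewrite -(@ler_pXn2r _ 2)// ?nnegrE ?rnorm_ge0 ?mulr_ge0 ?snorm_ge0// -LE exprMn.
have L0 : 0 <= L by rewrite LE exprn_ge0 ?rnorm_ge0.
set X := snorm x ^+ 2 in quad *; set Y := snorm y ^+ 2 in quad *.
have Y0 : 0 <= Y by rewrite exprn_ge0 ?snorm_ge0.
have [Yz|Yn] := eqVneq Y 0.
  rewrite Yz mulr0 leNgt; apply/negP => Lp.
  have := quad ((X + 1) / (2 * L)); rewrite Yz mulr0 addr0.
  have -> : 2 * ((X + 1) / (2 * L)) * L = X + 1 by field; rewrite gt_eqF.
  lra.
have Yp : 0 < Y by rewrite lt_def Yn.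
have := quad Y^-1; have -> : 2 * Y^-1 * L = 2 * (L / Y) by ring.
have -> : Y^-1 ^+ 2 * L * Y = L / Y by field.
by move=> h; rewrite -ler_pdivrMr//; lra.
Qed.

Lemma snormD x y : snorm (x + y) <= snorm x + snorm y.
Proof.
rewrite -(@ler_pXn2r _ 2)// ?nnegrE ?addr_ge0 ?snorm_ge0//.
have -> : snorm (x + y) ^+ 2 = snorm x ^+ 2 + snorm y ^+ 2 +
    (complex.Re (dot x y) + complex.Re (dot y x)).
  by rewrite !snorm_sq (si_Dl S) !si_Dr !cReD; ring.
have Rle (z : R[i]) : complex.Re z <= rnorm z := le_trans (ler_norm _) (cRe_le_rnorm z).
rewrite sqrrD.
have := le_trans (Rle _) (cauchy_schwarz x y); have := le_trans (Rle _) (cauchy_schwarz y x).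
by rewrite [snorm y * _]mulrC -mulr_natr; lra.
Qed.

Lemma snormZ (c : R[i]) x : snorm (c *: x) = rnorm c * snorm x.
Proof.
apply/eqP; rewrite -(@eqrXn2 _ 2)// ?mulr_ge0 ?rnorm_ge0 ?snorm_ge0//.
rewrite exprMn !snorm_sq (si_Zl S) si_Zr mulrA -normCK normrE_rnorm -rmorphXn si_self.
by rewrite -rmorphM.
Qed.

Lemma snormN x : snorm (- x) = snorm x.
Proof. by rewrite -scaleN1r snormZ rnormN (rnorm_real 1) normr1 mul1r. Qed.

Lemma snormB x y : snorm (x - y) = snorm (y - x).
Proof. by rewrite -snormN opprB. Qed.

End SemiInner.

Definition seq_complete (R : realType) (V : normedModType R[i]) : Prop :=
  forall u : nat -> V,
  (forall e : R, 0 < e -> exists N, forall m n, (N <= m)%N -> (N <= n)%N ->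
     rnorm (u m - u n) <= e) ->
  exists l, forall e : R, 0 < e -> exists N, forall n, (N <= n)%N ->
     rnorm (u n - l) <= e.

Lemma real_cauchy_cvg (R : realType) (u : nat -> R) :
  (forall e : R, 0 < e -> exists N, forall m n, (N <= m)%N -> (N <= n)%N ->
     `|u m - u n| <= e) ->
  exists l, forall e : R, 0 < e -> exists N, forall n, (N <= n)%N ->
     `|u n - l| <= e.
Proof.
move=> uC.
have : cauchy (u @ \oo).
  apply: cauchy_exP => e e0.
  have [|N NP] := uC (e / 2); first lra.
  exists (u N); exists N => // n /= Nn; rewrite -ball_normE /=.
  by have := NP _ _ (leqnn N) Nn; lra.
move/cauchy_cvg => /cvg_ex[l ul]; exists l => e e0.
move/cvgrPdist_le: ul => /(_ e e0)[N _ NP].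
by exists N => n Nn; rewrite distrC; exact: NP.
Qed.

Lemma complex_seq_complete (R : realType) : @seq_complete R R[i].
Proof.
move=> u uC.
have [|a ua] := @real_cauchy_cvg R (fun n => complex.Re (u n)).
  move=> e /uC[N NP]; exists N => m n Nm Nn; rewrite -cReN -cReD.
  exact: le_trans (cRe_le_rnorm _) (NP _ _ Nm Nn).
have [|b ub] := @real_cauchy_cvg R (fun n => complex.Im (u n)).
  move=> e /uC[N NP]; exists N => m n Nm Nn; rewrite -cImN -cImD.
  exact: le_trans (cIm_le_rnorm _) (NP _ _ Nm Nn).
exists (a +i* b)%C => e e0.
have [|N NP] := ua (e / 2); first lra.
have [|M MP] := ub (e / 2); first lra.
exists (maxn N M) => n; rewrite geq_max => /andP[Nn Mn].
apply: le_trans (rnorm_le_ReIm _) _; rewrite cReD cReN cImD cImN /=.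
have := NP _ Nn; have := MP _ Mn; lra.
Qed.

Lemma invS_lt (R : realType) (e : R) : 0 < e ->
  exists N, forall n, (N <= n)%N -> n.+1%:R^-1 <= e.
Proof.
move=> e0; exists (Num.Def.archi_bound e^-1) => n Nn.
have ei : 0 <= e^-1 by rewrite invr_ge0 ltW.
rewrite -[leRHS]invrK lef_pV2 ?posrE ?ltr0n ?invr_gt0//.
by apply: ltW; apply: lt_le_trans (archi_boundP ei) _; rewrite ler_nat leqW.
Qed.

Lemma invS_gt0 (R : realType) n : 0 < n.+1%:R^-1 :> R.
Proof. by rewrite invr_gt0 ltr0n. Qed.

Section HilbertCompletion.
Variables (R : realType) (V : lmodType R[i]) (dot : V -> V -> R[i]).
Hypothesis S : semi_inner dot.
Local Notation vn := (snorm dot).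

(* A vector of the completion is encoded by the functional [w |-> <xi, w>]. *)
Definition happrox (xi : V -> R[i]) (v : V) (e : R) :=
  forall w, rnorm (xi w - dot v w) <= e * vn w.
Definition hbounded (xi : V -> R[i]) (K : R) :=
  0 <= K /\ forall w, rnorm (xi w) <= K * vn w.
Definition hvector (xi : V -> R[i]) := forall e, 0 < e -> exists v, happrox xi v e.

Lemma happroxD xi et v w e d :
  happrox xi v e -> happrox et w d -> happrox (xi + et) (v + w) (e + d).
Proof.
move=> h k x; rewrite mulrDl (si_Dl S).
have -> : (xi + et) x - (dot v x + dot w x) = (xi x - dot v x) + (et x - dot w x).
  by have -> : (xi + et) x = xi x + et x by []; ring.
by apply: le_trans (rnormD _ _) _; rewrite lerD.
Qed.

Lemma happroxZ (c : R[i]) xi v e : happrox xi v e -> happrox (c *: xi) (c *: v) (rnorm c * e).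
Proof.
move=> h x; rewrite (si_Zl S) [(c *: xi) x]/(c * xi x) -mulrBr rnormMc -mulrA.
by rewrite ler_wpM2l ?rnorm_ge0.
Qed.

Lemma happrox_dot v : happrox (dot v) v 0.
Proof. by move=> w; rewrite subrr rnorm0 mul0r. Qed.

Lemma happrox_le xi v e d : e <= d -> happrox xi v e -> happrox xi v d.
Proof. by move=> ed h w; apply: le_trans (h w) _; rewrite ler_wpM2r ?snorm_ge0. Qed.

Lemma dot_hbounded v K : (forall w, rnorm (dot v w) <= K * vn w) -> 0 <= K -> vn v <= K.
Proof.
move=> h K0; have := h v; rewrite (si_self S) rnorm_real ger0_norm ?exprn_ge0 ?snorm_ge0//.
rewrite expr2; have [->|v0] := eqVneq (vn v) 0 => //.
by rewrite ler_pM2r// lt_def v0 snorm_ge0.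
Qed.

Lemma happrox_close xi v w e d : 0 <= e -> 0 <= d ->
  happrox xi v e -> happrox xi w d -> vn (v - w) <= e + d.
Proof.
move=> e0 d0 h k; apply: dot_hbounded => [x|]; last exact: addr_ge0.
have -> : dot (v - w) x = (xi x - dot w x) - (xi x - dot v x).
  by rewrite (si_Dl S) (si_Nl S); ring.
apply: le_trans (rnormD _ _) _; rewrite rnormN mulrDl addrC.
by rewrite lerD.
Qed.

Lemma happrox_bounded xi v e : 0 <= e -> happrox xi v e -> hbounded xi (vn v + e).
Proof.
move=> e0 h; split => [|w]; first by rewrite addr_ge0 ?snorm_ge0.
rewrite -[xi w](subrK (dot v w)); apply: le_trans (rnormD _ _) _.
by rewrite mulrDl addrC lerD// (cauchy_schwarz S).
Qed.

Lemma hvector_bounded xi : hvector xi -> exists K, hbounded xi K.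
Proof. by move=> /(_ 1 ltr01)[v /happrox_bounded h]; exists (vn v + 1); exact: h. Qed.

Lemma happrox_snorm xi v e K : 0 <= e -> hbounded xi K -> happrox xi v e -> vn v <= K + e.
Proof.
move=> e0 [K0 h] k; apply: dot_hbounded => [w|]; last exact: addr_ge0.
rewrite -[dot v w](subKr (xi w)); apply: le_trans (rnormD _ _) _.
by rewrite rnormN mulrDl lerD.
Qed.

Lemma hvector_subB xi v w : hvector xi -> xi (v - w) = xi v - xi w.
Proof.
move=> hx; apply: (rnorm_small_eq (vn (v - w) + vn v + vn w)) => [|e e0].
  by rewrite !addr_ge0 ?snorm_ge0.
have [u uP] := hx e e0.
have -> : xi (v - w) - (xi v - xi w) =
   (xi (v - w) - dot u (v - w)) - (xi v - dot u v) + (xi w - dot u w).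
  by rewrite (si_Dr S) (si_Nr S); ring.
apply: le_trans (rnormD _ _) _; apply: le_trans (lerD (rnormD _ _) (lexx _)) _.
by rewrite rnormN mulrC !mulrDr !lerD.
Qed.

(** The inner product is the limit of [xi w] as [w] approximates [et]. Demanding a linear rate
    reduces uniqueness and linearity to one estimate each. *)
Definition hdot_spec (xi et : V -> R[i]) (c : R[i]) := exists2 K : R, 0 <= K &
  forall e w, 0 < e -> happrox et w e -> rnorm (c - xi w) <= K * e.

Lemma hdot_spec_uniq xi et c d : hvector et -> hdot_spec xi et c -> hdot_spec xi et d -> c = d.
Proof.
move=> he [K K0 cP] [L L0 dP]; apply: (rnorm_small_eq (K + L)) => [|e e0].
  exact: addr_ge0.
have [w we] := he e e0.
rewrite -(subrKA (xi w)) mulrDl; apply: le_trans (rnormD _ _) _.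
by rewrite lerD ?cP// rnormB dP.
Qed.

Lemma hdot_spec_ex xi et : hvector xi -> hvector et -> exists c, hdot_spec xi et c.
Proof.
move=> hx he; have [K [K0 KP]] := hvector_bounded hx.
have [w wP] := choice (fun n => he n.+1%:R^-1 (invS_gt0 R n)).
have close n v e : 0 < e -> happrox et v e ->
    rnorm (xi v - xi (w n)) <= K * (e + n.+1%:R^-1).
  move=> e0 ve; rewrite -hvector_subB//; apply: le_trans (KP _) _.
  rewrite ler_wpM2l//; apply: happrox_close ve (wP n); first exact: ltW.
  exact/ltW/invS_gt0.
have small e : 0 < e -> exists2 d : R, 0 < d & K * d + K * d + d = e.
  move=> e0; have K1 : 0 < 2 * K + 1 by lra.
  by exists (e / (2 * K + 1)); rewrite ?divr_gt0//; field; rewrite gt_eqF.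
have [|c cP] := @complex_seq_complete R (fun n => xi (w n)).
  move=> e e0; have [d d0 dE] := small e e0; have [N NP] := invS_lt d0.
  exists N => m n Nm Nn; apply: le_trans (close _ _ _ (invS_gt0 R m) (wP m)) _.
  rewrite -dE mulrDr; have := ler_wpM2l K0 (NP _ Nm); have := ler_wpM2l K0 (NP _ Nn).
  by move: (m.+1%:R^-1) (n.+1%:R^-1) => a b; have := ltW d0; lra.
exists c; exists K => // e v e0 ve; apply/ler_addgt0Pr => d d0.
have [N1 NP1] := cP (d / 2) (divr_gt0 d0 (ltr0n R 2)).
have [d' d'0 dE] := small d d0; have [N2 NP2] := invS_lt d'0.
pose n := maxn N1 N2.
have := NP1 n (leq_maxl _ _); have := ler_wpM2l K0 (NP2 n (leq_maxr _ _)).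
have := close n v e e0 ve.
have := rnormD (c - xi (w n)) (xi (w n) - xi v); rewrite subrKA.
rewrite [rnorm (c - xi (w n))]rnormB [rnorm (xi (w n) - xi v)]rnormB mulrDr.
by move: (n.+1%:R^-1) => a; have := ltW d'0; lra.
Qed.

(** The default [0] is never taken on vectors of the completion, by [hdotfP]. *)
Definition hdotf (xi et : V -> R[i]) : R[i] := xget 0 [set c | hdot_spec xi et c].

Lemma hdotfP xi et : hvector xi -> hvector et -> hdot_spec xi et (hdotf xi et).
Proof.
move=> hx he; rewrite /hdotf; case: xgetP => [c -> //|h].
by have [c /h] := hdot_spec_ex hx he.
Qed.

Lemma hdotfE xi et c : hvector xi -> hvector et -> hdot_spec xi et c -> hdotf xi et = c.
Proof. by move=> hx he; apply: hdot_spec_uniq => //; exact: hdotfP. Qed.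

Lemma hvectorD xi et : hvector xi -> hvector et -> hvector (xi + et).
Proof.
move=> h k e e0; have [|v vP] := h (e / 2); first lra.
have [|w wP] := k (e / 2); first lra.
by exists (v + w); have := happroxD vP wP; rewrite -splitr.
Qed.

Lemma hvectorZ (c : R[i]) xi : hvector xi -> hvector (c *: xi).
Proof.
move=> h e e0; have c0 := rnorm_ge0 c.
have [|v vP] := h (e / (rnorm c + 1)); first by rewrite divr_gt0// ltr_wpDl.
exists (c *: v); apply: happrox_le (happroxZ c vP).
by rewrite mulrA ler_pdivrMr ?ltr_wpDl// mulrC ler_wpM2l ?lerDl// ltW.
Qed.

Lemma hvector_dot v : hvector (dot v).
Proof. by move=> e e0; exists v; apply: happrox_le (happrox_dot v); exact: ltW. Qed.

Lemma hvector0 : hvector 0.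
Proof.
have -> : 0 = dot 0 :> (V -> R[i]).
  by apply/funext => w; rewrite -(scale0r (0 : V)) (si_Zl S) mul0r.
exact: hvector_dot.
Qed.

Definition hpred : {pred V -> R[i]} := fun xi => `[< hvector xi >].

Lemma hpred_submod : GRing.submod_closed hpred.
Proof.
split; first by apply/asboolP; exact: hvector0.
move=> c x y /asboolP hx /asboolP hy; apply/asboolP; apply: hvectorD => //.
exact: hvectorZ.
Qed.
HB.instance Definition _ := GRing.isSubmodClosed.Build R[i] (V -> R[i]) hpred hpred_submod.

Definition hspace : Type := {xi : V -> R[i] | hpred xi}.
HB.instance Definition _ := SubChoice.on hspace.
HB.instance Definition _ := [SubChoice_isSubLmodule of hspace by <:].

Let hv (x : hspace) : hvector (val x).
Proof. exact/asboolP/(valP x). Qed.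

Definition hinner (x y : hspace) : R[i] := hdotf (val x) (val y).

Let hinner_approx x y : exists2 C : R, 0 <= C & forall e v w, 0 < e -> e <= 1 ->
  happrox (val x) v e -> happrox (val y) w e -> rnorm (hinner x y - dot v w) <= C * e.
Proof.
have [K K0 KP] := hdotfP (hv x) (hv y); have [L Lb] := hvector_bounded (hv y).
have L0 := Lb.1.
exists (K + (L + 1)) => [|e v w e0 e1 xv yw]; first by rewrite !addr_ge0.
rewrite -(subrKA (val x w)) mulrDl; apply: le_trans (rnormD _ _) _.
apply: lerD; first exact: KP.
apply: le_trans (xv w) _; rewrite mulrC ler_wpM2r//; first exact: ltW.
apply: le_trans (happrox_snorm _ Lb yw) _; first exact: ltW.
by rewrite lerD2l.
Qed.

Let hinner_C x y : hinner x y = (hinner y x)^*.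
Proof.
have [C C0 CP] := hinner_approx x y; have [D D0 DP] := hinner_approx y x.
apply: (rnorm_small_eq (C + D)) => [|e e0]; first exact: addr_ge0.
pose d := Num.min e 1; have d0 : 0 < d by rewrite lt_min e0 ltr01.
have d1 : d <= 1 by rewrite ge_min lexx orbT.
have de : d <= e by rewrite ge_min lexx.
have [v xv] := hv x d0; have [w yw] := hv y d0.
apply: (@le_trans _ _ ((C + D) * d)); last by rewrite ler_wpM2l// addr_ge0.
rewrite -(subrKA (dot v w)) mulrDl; apply: le_trans (rnormD _ _) _.
apply: lerD; first exact: CP.
by rewrite (si_C S) -rmorphB rnormJ rnormB; exact: DP.
Qed.

Let hinner_Dl x y z : hinner (x + y) z = hinner x z + hinner y z.
Proof.
apply: hdotfE; [exact: hv|exact: hv|].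
have [K K0 KP] := hdotfP (hv x) (hv z); have [L L0 LP] := hdotfP (hv y) (hv z).
exists (K + L) => [|e w e0 zw]; first exact: addr_ge0.
have -> : hinner x z + hinner y z - val (x + y) w =
  (hinner x z - val x w) + (hinner y z - val y w).
  have -> : val (x + y) w = val x w + val y w by [].
  by ring.
by rewrite mulrDl; apply: le_trans (rnormD _ _) _; rewrite lerD ?KP ?LP.
Qed.

Let hinner_Zl (c : R[i]) x y : hinner (c *: x) y = c * hinner x y.
Proof.
apply: hdotfE; [exact: hv|exact: hv|].
have [K K0 KP] := hdotfP (hv x) (hv y).
exists (rnorm c * K) => [|e w e0 yw]; first by rewrite mulr_ge0 ?rnorm_ge0.
have -> : c * hinner x y - val (c *: x) w = c * (hinner x y - val x w).
  have -> : val (c *: x) w = c * val x w by [].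
  by ring.
by rewrite rnormMc -mulrA ler_wpM2l ?rnorm_ge0 ?KP.
Qed.

Let hinner_ge0 x : 0 <= hinner x x.
Proof.
have [C C0 CP] := hinner_approx x x.
rewrite lecE; apply/andP; split.
  have := hinner_C x x; rewrite {1}/Num.conj /=; case: (hinner x x) => a b /=.
  by move=> [bb]; apply/eqP; lra.
rewrite -oppr_le0; apply/ler_addgt0Pr => e e0; rewrite add0r.
pose d := Num.min (e / (C + 1)) 1.
have d0 : 0 < d by rewrite lt_min ltr01 divr_gt0// ltr_wpDl.
have d1 : d <= 1 by rewrite ge_min lexx orbT.
have Cd : C * d <= e.
  apply: (@le_trans _ _ ((C + 1) * d)); first by rewrite ler_wpM2r ?lerDl ?ltW.
  by rewrite mulrC -ler_pdivlMr ?ltr_wpDl// ge_min lexx.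
have [v xv] := hv x d0.
have := le_trans (cRe_le_rnorm _) (CP _ _ _ d0 d1 xv xv).
rewrite cReD cReN ler_norml => /andP[h _].
have := si_Re_ge0 S v; lra.
Qed.

Lemma hinner_semi : semi_inner hinner.
Proof.
by split; [exact: hinner_Dl|exact: hinner_Zl|exact: hinner_C|exact: hinner_ge0].
Qed.

Definition hemb (v : V) : hspace := exist _ (dot v) (asboolT (hvector_dot v)).

Lemma hinner_emb x v : hinner x (hemb v) = val x v.
Proof.
apply: hdotfE; [exact: hv|exact: hvector_dot|].
have [K [K0 KP]] := hvector_bounded (hv x).
exists K => // e w e0 vw; rewrite -hvector_subB; last exact: hv.
apply: le_trans (KP _) _; rewrite ler_wpM2l// -[leRHS]add0r.
by apply: happrox_close (happrox_dot v) vw => //; exact: ltW.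
Qed.

Lemma hinner_emb2 v w : hinner (hemb v) (hemb w) = dot v w.
Proof. exact: hinner_emb. Qed.

Lemma snorm_emb v : snorm hinner (hemb v) = vn v.
Proof. by rewrite /snorm hinner_emb2. Qed.

Local Notation hn := (snorm hinner).

(** If [w] approximates [x] within [t], then [<x, x>] differs from [val x w] by at most [K t], and
    [val x w] is at most [e (e + t)]. With [hn_bound] this makes the Hilbert norm the norm of the
    functional, so estimates can be made pointwise. *)
Lemma hn_le x e : hbounded (val x) e -> hn x <= e.
Proof.
move=> xe; have e0 := xe.1.
rewrite -(@ler_pXn2r _ 2)// ?nnegrE ?snorm_ge0// (snorm_sq hinner_semi).
have [K K0 KP] := hdotfP (hv x) (hv x).
apply/ler_addgt0Pr => d d0.
pose t := d / (K + e + 1).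
have Ke : 0 < K + e + 1 by rewrite ltr_wpDl// addr_ge0.
have t0 : 0 < t by rewrite divr_gt0.
have [w xw] := hv x t0.
have := KP t w t0 xw; have := xe.2 w; have := happrox_snorm (ltW t0) xe xw.
have := cRe_le_rnorm (hinner x x); rewrite ler_norml => /andP[_].
have := rnormD (hinner x x - val x w) (val x w); rewrite subrK -/(hinner x x).
have : (K + e + 1) * t = d by rewrite mulrC divfK ?gt_eqF.
have := ler_wpM2l e0 (happrox_snorm (ltW t0) xe xw).
by move: t t0 {xw} => t t0; rewrite mulrDr expr2; nra.
Qed.

Lemma hn_bound x v : rnorm (val x v) <= hn x * vn v.
Proof.
by rewrite -hinner_emb -snorm_emb; exact: (cauchy_schwarz hinner_semi).
Qed.

Definition hnorm (x : hspace) : R[i] := (hn x)%:C%C.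

Let hnormD x y : hnorm (x + y) <= hnorm x + hnorm y.
Proof. by rewrite -rmorphD lecR (snormD hinner_semi). Qed.

Let hnormZ (c : R[i]) x : hnorm (c *: x) = `|c| * hnorm x.
Proof. by rewrite /hnorm (snormZ hinner_semi) rmorphM normrE_rnorm. Qed.

Let hnorm_eq0 x : hnorm x = 0 -> x = 0.
Proof.
move=> /complexI x0; apply/val_inj/funext => v.
by apply/rnorm_eq0/eqP; rewrite eq_le rnorm_ge0 andbT; have := hn_bound x v; rewrite x0 mul0r.
Qed.

HB.instance Definition _ := Lmodule_isNormed.Build R[i] hspace hnormD hnormZ hnorm_eq0.

(** A sequence [x n] chosen along the filter converges pointwise as functionals, with error at most
    [vn w / (n + 1)] at [w]. This uniform rate makes the limit a vector of the completion and the
    convergence one in norm. *)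
Let hspace_complete (F : set_system hspace) : ProperFilter F -> cauchy F -> cvg F.
Proof.
move=> FF /cauchyP Fc.
have Fn n : exists x, F [set y | hn (x - y) < n.+1%:R^-1].
  have [|x Fx] := Fc (n.+1%:R^-1)%:C%C; first by rewrite ltcR invS_gt0.
  exists x; apply: filterS Fx => y; rewrite -ball_normE /=.
  by rewrite -[`|x - y|]/((hn (x - y))%:C%C) ltcR.
have [x xP] := choice Fn.
have xx m n : hn (x m - x n) <= m.+1%:R^-1 + n.+1%:R^-1.
  have [y [/= ym yn]] := filter_ex (filterI (xP m) (xP n)).
  rewrite -(subrKA y); apply: le_trans (snormD hinner_semi _ _) _.
  by rewrite lerD ?ltW// (snormB hinner_semi).
have xw m n w : rnorm (val (x m) w - val (x n) w) <= (m.+1%:R^-1 + n.+1%:R^-1) * vn w.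
  have -> : val (x m) w - val (x n) w = val (x m - x n) w by [].
  by apply: le_trans (hn_bound _ _) _; rewrite ler_wpM2r ?snorm_ge0.
have small w e : 0 < e -> exists2 d : R, 0 < d & d * vn w <= e.
  move=> e0; have w0 := snorm_ge0 dot w; have w1 : 0 < vn w + 1 by lra.
  exists (e / (vn w + 1)); first by rewrite divr_gt0.
  by rewrite mulrAC ler_pdivrMr// ler_wpM2l ?lerDl//; exact: ltW.
have lim w : exists l, forall e : R, 0 < e -> exists N, forall n, (N <= n)%N ->
     rnorm (val (x n) w - l) <= e.
  apply: complex_seq_complete => e e0; have [d d0 dw] := small w _ e0.
  have [|N NP] := @invS_lt R (d / 2); first lra.
  exists N => m n Nm Nn; apply: le_trans (xw m n w) _; apply: le_trans dw.
  rewrite ler_wpM2r ?snorm_ge0//; move: (NP _ Nm) (NP _ Nn).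
  by move: (m.+1%:R^-1) (n.+1%:R^-1) => a b; lra.
have [xi xiP] := choice lim.
have xi_le n w : rnorm (xi w - val (x n) w) <= n.+1%:R^-1 * vn w.
  apply/ler_addgt0Pr => e e0.
  have [|N NP] := xiP w (e / 2); first lra.
  have [|d d0 dw] := small w (e / 2); first lra.
  have [M MP] := invS_lt d0; pose k := maxn N M.
  have := NP k (leq_maxl _ _); have := xw k n w.
  have := ler_wpM2r (snorm_ge0 dot w) (MP k (leq_maxr _ _)).
  have := rnormD (xi w - val (x k) w) (val (x k) w - val (x n) w); rewrite subrKA.
  rewrite [rnorm (xi w - val (x k) w)]rnormB mulrDl.
  by move: (k.+1%:R^-1) (n.+1%:R^-1) => a b; lra.
have hxi : hvector xi.
  move=> e e0; have [|N NP] := @invS_lt R (e / 2); first lra.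
  have [|v vP] := hv (x N) (_ : 0 < e / 2); first lra.
  exists v => w; rewrite -(subrKA (val (x N) w)); apply: le_trans (rnormD _ _) _.
  rewrite [e]splitr mulrDl lerD//; apply: le_trans (xi_le _ _) _.
  by rewrite ler_wpM2r ?snorm_ge0// NP.
pose l : hspace := exist _ xi (asboolT hxi).
apply/cvg_ex; exists l; apply/cvgrPdist_le => e /posC_ex[d d0 ->].
have [|N NP] := @invS_lt R (d / 2); first lra.
apply: filterS (xP N) => y /= xy.
rewrite -[`|l - y|]/((hn (l - y))%:C%C) lecR -(subrKA (x N)).
apply: le_trans (snormD hinner_semi _ _) _.
have h : hn (l - x N) <= N.+1%:R^-1.
  apply: hn_le; split; first exact/ltW/invS_gt0.
  exact: xi_le.
by move: h (NP N (leqnn N)) xy; move: (N.+1%:R^-1) => a; lra.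
Qed.

HB.instance Definition _ := Uniform_isComplete.Build hspace hspace_complete.

Let hinner_norm (x : hspace) : hinner x x = `|x| ^+ 2.
Proof. by rewrite (si_self hinner_semi) -[`|x|]/((hn x)%:C%C) rmorphXn. Qed.

Definition hcompletion : hilbert R :=
  @Hilbert R hspace hinner hinner_Dl hinner_Zl hinner_C hinner_norm.

(** [dot] may be degenerate: [e] also performs the quotient by the null vectors. *)
Theorem hilbert_completion : exists (H : hilbert R) (e : V -> H),
  [/\ forall v w, e (v + w) = e v + e w,
      forall (c : R[i]) v, e (c *: v) = c *: e v,
      forall v w, hdot (e v) (e w) = dot v w &
      forall (x : H) (d : R), 0 < d -> exists v, rnorm (x - e v) <= d].
Proof.
exists hcompletion, hemb; split => [v w|c v|v w|x d d0].
- by apply/val_inj/funext => z; rewrite /= (si_Dl S).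
- by apply/val_inj/funext => z; rewrite /= (si_Zl S).
- exact: hinner_emb2.
- have [v xv] := hv x d0; exists v.
  change (hn ((x : hspace) - hemb v) <= d); apply: hn_le; split; first exact: ltW.
  exact: xv.
Qed.

End HilbertCompletion.

(** * Extension of Lipschitz maps from dense subsets *)

Lemma bounded_extension (R : realType) (X : Type) (D : set X) (A W : normedModType R[i])
    (iota : X -> A) (f : X -> W) (C : R) :
  seq_complete W -> 0 <= C -> closure (iota @` D) = setT ->
  (forall u v, D u -> D v -> rnorm (f u - f v) <= C * rnorm (iota u - iota v)) ->
  exists F : A -> W, forall a u, D u -> rnorm (F a - f u) <= C * rnorm (a - iota u).
Proof.
move=> Wc C0 dD fC.
have : forall a, exists b : W, forall u, D u -> rnorm (b - f u) <= C * rnorm (a - iota u).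
  move=> a.
  have : forall n, exists u, D u /\ rnorm (a - iota u) <= n.+1%:R^-1.
    by move=> n; have [_ [u Du <-] au] := rnorm_dense a dD (invS_gt0 R n); exists u.
  move=> /choice[u uP].
  have small e : 0 < e -> exists2 d : R, 0 < d & C * d <= e.
    move=> e0; have C1 : 0 < C + 1 by lra.
    exists (e / (C + 1)); first by rewrite divr_gt0.
    by rewrite mulrA ler_pdivrMr// mulrC ler_wpM2l ?lerDl//; exact: ltW.
  have [|b bP] := Wc (f \o u).
    move=> e e0; have [|d d0 dC] := small (e / 2); first lra.
    have [N NP] := invS_lt d0; exists N => m n Nm Nn.
    apply: le_trans (fC _ _ (uP m).1 (uP n).1) _.
    have := rnormD (iota (u m) - a) (a - iota (u n)); rewrite subrKA [rnorm (_ - a)]rnormB.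
    move: (uP m).2 (uP n).2 (NP _ Nm) (NP _ Nn).
    move: (m.+1%:R^-1) (n.+1%:R^-1) => x y h1 h2 h3 h4 h5.
    have : C * rnorm (iota (u m) - iota (u n)) <= C * (d + d).
      by rewrite ler_wpM2l//; lra.
    by rewrite mulrDr; lra.
  exists b => v Dv; apply/ler_addgt0Pr => e e0.
  have [|N NP] := bP (e / 2); first lra.
  have [|d d0 dC] := small (e / 2); first lra.
  have [M MP] := invS_lt d0; pose k := maxn N M.
  have := NP k (leq_maxl _ _); have := fC _ _ (uP k).1 Dv.
  move: (uP k).2 (MP k (leq_maxr _ _)); move: (k.+1%:R^-1) => x h1 h2 h3 h4.
  have := rnormD (b - f (u k)) (f (u k) - f v); rewrite subrKA.
  rewrite [rnorm (b - _)]rnormB.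
  have := rnormD (iota (u k) - a) (a - iota v); rewrite subrKA [rnorm (_ - a)]rnormB.
  move=> h5 h6; have : C * rnorm (iota (u k) - iota v) <= C * (d + rnorm (a - iota v)).
    by rewrite ler_wpM2l//; lra.
  rewrite mulrDr => h7; move: h4; rewrite /= => h4; lra.
by move=> /choice[F FP]; exists F.
Qed.

(** The last hypothesis is what [bounded_extension] yields; it determines [F], so linearity on [D]
    is inherited by approximation. *)
Lemma extension_linear (R : realType) (X : lmodType R[i]) (D : set X) (A W : normedModType R[i])
    (iota : X -> A) (f : X -> W) (F : A -> W) (C : R) :
  0 <= C -> closure (iota @` D) = setT ->
  (forall (c : R[i]) u v, D u -> D v -> [/\ D (c *: u + v),
     iota (c *: u + v) = c *: iota u + iota v & f (c *: u + v) = c *: f u + f v]) ->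
  (forall a u, D u -> rnorm (F a - f u) <= C * rnorm (a - iota u)) -> linear F.
Proof.
move=> C0 dD lin FP c x y.
apply: (rnorm_small_eq (C * (rnorm c + 1 + rnorm c + 1))) => [|d d0].
  by rewrite mulr_ge0// !addr_ge0 ?rnorm_ge0.
have [_ [u Du <-] xu] := rnorm_dense x dD d0; have [_ [v Dv <-] yv] := rnorm_dense y dD d0.
have [Dw iw fw] := lin c _ _ Du Dv.
have := FP (c *: x + y) _ Dw; have := FP x u Du; have := FP y v Dv; rewrite iw fw.
have -> : F (c *: x + y) - (c *: F x + F y) =
  (F (c *: x + y) - (c *: f u + f v)) - c *: (F x - f u) - (F y - f v).
  by rewrite scalerBr; zmodule.
move=> h1 h2 h3.
apply: le_trans (rnormD _ _) _; rewrite rnormN.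
apply: le_trans (lerD (rnormD _ _) (lexx _)) _; rewrite rnormN rnormZ.
have h4 : rnorm (c *: x + y - (c *: iota u + iota v)) <= rnorm c * d + d.
  have -> : c *: x + y - (c *: iota u + iota v) = c *: (x - iota u) + (y - iota v).
    by rewrite scalerBr; zmodule.
  apply: le_trans (rnormD _ _) _; rewrite rnormZ lerD//.
  by rewrite ler_wpM2l ?rnorm_ge0.
have c0 := rnorm_ge0 c; have h5 := ler_wpM2l C0 h4; have h6 := ler_wpM2l C0 xu.
by have := ler_wpM2l C0 yv; have := ler_wpM2l c0 (le_trans h2 h6); lra.
Qed.

Section Lipschitz.
Variables (R : realType).

Definition rlipschitz (A W : normedModType R[i]) (f : A -> W) : Prop :=
  exists2 C : R, 0 <= C & forall x y, rnorm (f x - f y) <= C * rnorm (x - y).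

Lemma rlipschitz_dense_eq (X : Type) (A W : normedModType R[i]) (e : X -> A) (f g : A -> W) :
  (forall a (d : R), 0 < d -> exists v, rnorm (a - e v) <= d) ->
  rlipschitz f -> rlipschitz g -> (forall v, f (e v) = g (e v)) -> forall a, f a = g a.
Proof.
move=> eD [C C0 fC] [K K0 gK] fg a; apply: (rnorm_small_eq (C + K)) => [|d d0].
  exact: addr_ge0.
have [v av] := eD a d d0.
rewrite -(subrKA (f (e v))) mulrDl; apply: le_trans (rnormD _ _) _.
apply: lerD; first by apply: le_trans (fC _ _) _; rewrite ler_wpM2l.
by rewrite fg rnormB; apply: le_trans (gK _ _) _; rewrite ler_wpM2l.
Qed.

Lemma rlipschitz_comp (A B W : normedModType R[i]) (f : B -> W) (g : A -> B) :
  rlipschitz f -> rlipschitz g -> rlipschitz (f \o g).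
Proof.
move=> [C C0 fC] [K K0 gK]; exists (C * K) => [|x y]; first exact: mulr_ge0.
by apply: le_trans (fC _ _) _; rewrite -mulrA ler_wpM2l.
Qed.

Lemma rlipschitzD (A W : normedModType R[i]) (f g : A -> W) :
  rlipschitz f -> rlipschitz g -> rlipschitz (fun x => f x + g x).
Proof.
move=> [C C0 fC] [K K0 gK]; exists (C + K) => [|x y]; first exact: addr_ge0.
by rewrite opprD addrACA mulrDl; apply: le_trans (rnormD _ _) _; rewrite lerD.
Qed.

Lemma rlipschitzZ (W : normedModType R[i]) (c : R[i]) : rlipschitz (fun x : W => c *: x).
Proof. by exists (rnorm c) => [|x y]; rewrite ?rnorm_ge0// -scalerBr rnormZ. Qed.

End Lipschitz.

Section HilbertSemi.
Variables (R : realType) (H : hilbert R).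

Lemma hilbert_semi : semi_inner (@hdot R H).
Proof.
split; [exact: hdotDl|exact: hdotZl|exact: hdotC|move=> x].
by rewrite hdot_norm exprn_ge0.
Qed.

Lemma snorm_hdot (x : H) : snorm hdot x = rnorm x.
Proof.
by rewrite /snorm hdot_norm normrE_rnorm -rmorphXn /= sqrtr_sqr ger0_norm ?rnorm_ge0.
Qed.

Lemma hdot_cauchy_schwarz (x y : H) : rnorm (hdot x y) <= rnorm x * rnorm y.
Proof. by rewrite -!snorm_hdot; exact: (cauchy_schwarz hilbert_semi). Qed.

Lemma hdot_rnorm (x : H) : hdot x x = (rnorm x ^+ 2)%:C%C.
Proof. by rewrite hdot_norm normrE_rnorm -rmorphXn. Qed.

Lemma hdotBl (x y z : H) : hdot (x - y) z = hdot x z - hdot y z.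
Proof. by rewrite hdotDl (si_Nl hilbert_semi). Qed.

Lemma hdotBr (x y z : H) : hdot x (y - z) = hdot x y - hdot x z.
Proof. by rewrite (si_Dr hilbert_semi) (si_Nr hilbert_semi). Qed.

Lemma rlipschitz_hdotl (y : H) : rlipschitz (fun x : H => hdot x y).
Proof.
exists (rnorm y) => [|x x']; first exact: rnorm_ge0.
by rewrite -hdotBl mulrC; exact: hdot_cauchy_schwarz.
Qed.

Lemma rlipschitz_hdotr (x : H) : rlipschitz (hdot x).
Proof.
exists (rnorm x) => [|y y']; first exact: rnorm_ge0.
by rewrite -hdotBr; exact: hdot_cauchy_schwarz.
Qed.

End HilbertSemi.

(** * The GNS construction and the Gelfand-Naimark theorem *)

Section PositiveFunctional.
Variables (R : realType) (A : banachStarAlg R).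

Definition positive_functional (phi : A -> R[i]) : Prop :=
  [/\ forall a b, phi (a + b) = phi a + phi b,
      forall (c : R[i]) a, phi (c *: a) = c * phi a,
      forall a, phi (bstar a) = (phi a)^* &
      forall a, 0 <= phi (bmul (bstar a) a)].

Definition gns_dot (phi : A -> R[i]) (a b : A) : R[i] := phi (bmul (bstar b) a).

Lemma gns_semi phi : positive_functional phi -> semi_inner (gns_dot phi).
Proof.
case=> pD pZ pS p0; split => *; rewrite /gns_dot.
- by rewrite bmulDr pD.
- by rewrite bmulZr pZ.
- by rewrite -pS bstarM bstarK.
- exact: p0.
Qed.

(* Iterating Cauchy-Schwarz along [h, h^2, h^4, ..]. *)
Lemma positive_functional_le (phi : A -> R[i]) (M : A -> R) a b :
  positive_functional phi ->
  (forall x, 0 <= M x) -> (forall x y, M (bmul x y) <= M x * M y) ->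
  (forall x, complex.Re (phi x) <= M x) ->
  snorm (gns_dot phi) (bmul a b) ^+ 2 <=
  M (bmul (bstar a) a) * snorm (gns_dot phi) b ^+ 2.
Proof.
move=> pp M0 MM pM; have S := gns_semi pp.
pose h n := iter n (fun h => bmul h h) (bmul (bstar a) a).
have sh n : bstar (h n) = h n.
  by elim: n => [|n IH] /=; rewrite bstarM ?bstarK// -/(h n) IH.
pose s n := complex.Re (gns_dot phi (bmul (h n) b) b).
have s0 : s 0 = snorm (gns_dot phi) (bmul a b) ^+ 2.
  by rewrite (snorm_sq S) /s /gns_dot /= bstarM !bmulA.
have sS n : s n.+1 = snorm (gns_dot phi) (bmul (h n) b) ^+ 2.
  by rewrite (snorm_sq S) /s /gns_dot /= bstarM -/(h n) sh !bmulA.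
have s_ge0 n : 0 <= s n by case: n => [|n]; rewrite ?s0 ?sS exprn_ge0// snorm_ge0.
set t := snorm (gns_dot phi) b ^+ 2.
have t0 : 0 <= t by rewrite exprn_ge0// snorm_ge0.
have sq n : s n ^+ 2 <= s n.+1 * t.
  rewrite sS -exprMn lerXn2r ?nnegrE ?mulr_ge0 ?snorm_ge0//.
  apply: le_trans (cauchy_schwarz S _ _).
  exact: le_trans (ler_norm _) (cRe_le_rnorm _).
have [tz|tn] := eqVneq t 0.
  have := sq 0%N; rewrite tz !mulr0 -s0 => h0.
  have : s 0 ^+ 2 == 0 by rewrite eq_le h0 exprn_ge0.
  by rewrite sqrf_eq0 => /eqP->.
have tp : 0 < t by rewrite lt_def tn.
rewrite -s0 -ler_pdivrMr//.
have pw n : (s 0 / t) ^+ (2 ^ n) <= s n / t.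
  elim: n => [|n IH]; first by rewrite expn0 expr1.
  rewrite expnSr exprM; apply: (@le_trans _ _ ((s n / t) ^+ 2)).
    by rewrite lerXn2r ?nnegrE ?exprn_ge0 ?divr_ge0.
  have t2 : 0 < t ^+ 2 by exact: exprn_gt0.
  rewrite expr_div_n ler_pdivrMr//.
  by have -> : s n.+1 / t * t ^+ 2 = s n.+1 * t by field.
have Mh n : M (h n) <= M (h 0) ^+ (2 ^ n).
  elim: n => [|n IH]; first by rewrite expn0 expr1.
  rewrite expnSr exprM expr2; apply: le_trans (MM _ _) _.
  by apply: ler_pM; rewrite ?M0.
(* The crude bound of [s n] by [M (bstar b) * M (h n) * M b] suffices, since its constant factor
   does not survive the roots. *)
apply: (@le_of_exp_2n _ _ _ (M (bstar b) * M b / t)) => // [|n].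
  by rewrite divr_ge0.
apply: le_trans (pw n) _; rewrite mulrAC ler_wpM2r ?invr_ge0//.
apply: le_trans (pM _) _; apply: le_trans (MM _ _) _; rewrite -mulrA ler_wpM2l//.
by rewrite mulrC; apply: le_trans (MM _ _) _; rewrite ler_wpM2r.
Qed.

(** [A] need not have a unit, so no cyclic vector is provided, only the canonical map [e] from [A].
    Left multiplication is bounded by [positive_functional_le] with the norm of [A] as [M], and
    extends from the dense range of [e]. *)
Theorem gns (phi : A -> R[i]) : positive_functional phi ->
  (forall a, complex.Re (phi a) <= rnorm a) ->
  exists (H : hilbert R) (pi : bsa_data A -> {linear H -> H}) (e : A -> H),
  [/\ star_rep pi, forall a b, pi a (e b) = e (bmul a b),
      forall v w, e (v + w) = e v + e w &
      forall v w, hdot (e v) (e w) = phi (bmul (bstar w) v)].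
Proof.
move=> pp pb; have S := gns_semi pp.
have [H [e [eD eZ edot edense]]] := hilbert_completion S.
have enorm v : rnorm (e v) = snorm (gns_dot phi) v.
  by rewrite -snorm_hdot /snorm edot.
have eN v : e (- v) = - e v by rewrite -scaleN1r eZ scaleN1r.
have eB v w : e (v - w) = e v - e w by rewrite eD eN.
have ebd a b : rnorm (e (bmul a b)) <= rnorm a * rnorm (e b).
  rewrite !enorm -(@ler_pXn2r _ 2)// ?nnegrE ?mulr_ge0 ?rnorm_ge0 ?snorm_ge0// exprMn.
  apply: le_trans (positive_functional_le a b pp (fun x => rnorm_ge0 x) (@rnorm_bmul R A) pb) _.
  rewrite ler_wpM2r ?exprn_ge0 ?snorm_ge0//; apply: le_trans (rnorm_bmul _ _) _.
  by rewrite rnorm_bstar expr2.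
have dense : closure (e @` setT) = setT.
  apply: (@dense_closure R H (e @` setT)) => x d d0.
  by have [v xv] := edense x d d0; exists (e v) => //; exists v.
have Hc : seq_complete H by move=> u uC; have [l lP] := rnorm_cauchy_cvg uC; exists l.
have : forall a, exists T : {linear H -> H},
    (forall x, rnorm (T x) <= rnorm a * rnorm x) /\ forall b, T (e b) = e (bmul a b).
  move=> a; have [|T TP] := bounded_extension (f := fun b => e (bmul a b)) Hc (rnorm_ge0 a) dense.
    by move=> u v _ _; rewrite -!eB -bmulNr -bmulDr; exact: ebd.
  have Te b : T (e b) = e (bmul a b).
    apply/eqP; rewrite -subr_eq0; apply/eqP/rnorm_eq0/eqP.
    by rewrite eq_le rnorm_ge0 andbT; have := TP (e b) b I; rewrite subrr rnorm0 mulr0.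
  have Tlin : linear T.
    apply: (extension_linear (rnorm_ge0 a) dense _ TP) => c u v _ _; split => //.
      by rewrite eD eZ.
    by rewrite bmulDr bmulZr eD eZ.
  pose T' : {linear H -> H} := HB.pack T (GRing.isLinear.Build _ _ _ _ T Tlin).
  exists T'; split => // x; apply/ler_addgt0Pr => d d0.
  have a0 := rnorm_ge0 a.
  pose d' := d / (rnorm a + rnorm a + 1).
  have d'0 : 0 < d' by rewrite divr_gt0// ltr_wpDl// addr_ge0.
  have d'd : rnorm a * d' + rnorm a * d' <= d.
    have : (rnorm a + rnorm a + 1) * d' = d by rewrite mulrC divfK ?gt_eqF// ltr_wpDl// addr_ge0.
    by rewrite 2!mulrDl mul1r; lra.
  have [u xu] := edense x d' d'0.
  have := TP x u I; have := rnormD (T x - e (bmul a u)) (e (bmul a u)); rewrite subrK.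
  have := ebd a u; have := rnormD (e u - x) x; rewrite subrK [rnorm (e u - x)]rnormB.
  move=> h1 h2 h3 h4; have := ler_wpM2l a0 xu; have := ler_wpM2l a0 h1.
  by rewrite mulrDr -[rnorm (T' x)]/(rnorm (T x)); lra.
move=> /choice[pi piP].
exists H, pi, e; split => //; last by move=> a b; exact: (piP a).2.
have lip a : rlipschitz (pi a).
  by exists (rnorm a) => [|x y]; rewrite ?rnorm_ge0// -linearB (piP a).1.
split.
- by move=> a _; apply: rnorm_bound_continuous (piP a).1.
- move=> a b _ _.
  apply: (rlipschitz_dense_eq edense (lip _) (rlipschitzD (lip a) (lip b))) => v.
  by rewrite !(piP _).2 bmulDl eD.
- move=> c a _.
  apply: (rlipschitz_dense_eq (g := fun x => c *: pi a x) edense (lip _)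
    (rlipschitz_comp (rlipschitzZ H c) (lip a))) => v.
  by rewrite /= !(piP _).2 bmulZl eZ.
- move=> a b _ _.
  apply: (rlipschitz_dense_eq (g := pi a \o pi b) edense (lip _)
    (rlipschitz_comp (lip a) (lip b))) => v.
  by rewrite /= !(piP _).2 bmulA.
- move=> a _ x y; move: x.
  apply: (rlipschitz_dense_eq (f := (hdot^~ y) \o pi a) edense
    (rlipschitz_comp (rlipschitz_hdotl y) (lip a))
    (rlipschitz_hdotl _)) => v /=; move: y.
  apply: (rlipschitz_dense_eq (g := hdot _ \o pi _) edense (rlipschitz_hdotr _)
    (rlipschitz_comp (rlipschitz_hdotr _) (lip _))) => w /=.
  by rewrite !(piP _).2 !edot /gns_dot bstarM bstarK !bmulA.
Qed.

End PositiveFunctional.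

(** * Operator norms and the seminorm of a representation *)

Section OperatorNorm.
Variables (R : realType) (H : hilbert R).

Lemma opnorm_ge (T : {linear H -> H}) (x : H) (K L : R) :
  0 < L -> rnorm x <= L -> K * L <= rnorm (T x) -> (K%:E <= opnorm T)%E.
Proof.
move=> L0 xL KT; have li : 0 <= L^-1 by rewrite invr_ge0 ltW.
apply: (@le_trans _ _ (rnorm (T (L^-1%:C%C *: x)))%:E).
  by rewrite lee_fin linearZ /= rnormZr// mulrC ler_pdivlMr.
apply: ereal_sup_ubound; exists (L^-1%:C%C *: x) => //=.
by rewrite -(rmorph1 (@real_complex R)) rnorm_le rnormZr// mulrC ler_pdivrMr// mul1r.
Qed.

Lemma opnorm_ge0 (T : {linear H -> H}) : (0 <= opnorm T)%E.
Proof.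
apply: ereal_sup_ubound; exists 0 => /=; first by rewrite normr0 ler01.
by rewrite linear0 rnorm0.
Qed.

Lemma opnorm_le (T : {linear H -> H}) (K : R) : 0 <= K ->
  (forall x, rnorm (T x) <= K * rnorm x) -> (opnorm T <= K%:E)%E.
Proof.
move=> K0 TK; apply: ub_ereal_sup => _ [x /= x1 <-]; rewrite lee_fin.
apply: le_trans (TK x) _; apply: ler_piMr => //.
by move: x1; rewrite -(rmorph1 (@real_complex R)) rnorm_le.
Qed.

Lemma opnormE (T : {linear H -> H}) : continuous T -> opnorm T = (fine (opnorm T))%:E.
Proof.
move=> /continuous_rnorm_bound[C C0 TC]; rewrite fineK// ge0_fin_numE ?opnorm_ge0//.
by apply: le_lt_trans (opnorm_le C0 TC) _; rewrite ltry.
Qed.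

Lemma opnorm_bound (T : {linear H -> H}) x : continuous T ->
  rnorm (T x) <= fine (opnorm T) * rnorm x.
Proof.
move=> cT; have [x0|x0] := eqVneq (rnorm x) 0.
  by rewrite x0 mulr0 (rnorm_eq0 x0) linear0 rnorm0.
have xp : 0 < rnorm x by rewrite lt_def x0 rnorm_ge0.
rewrite -ler_pdivrMr// -lee_fin -opnormE//.
by apply: (opnorm_ge (x := x) xp) => //; rewrite divfK.
Qed.

Lemma fine_opnorm_ge0 (T : {linear H -> H}) : 0 <= fine (opnorm T).
Proof. exact/fine_ge0/opnorm_ge0. Qed.

Lemma fine_opnorm_le (T : {linear H -> H}) (K : R) : 0 <= K -> continuous T ->
  (forall x, rnorm (T x) <= K * rnorm x) -> fine (opnorm T) <= K.
Proof. by move=> K0 cT TK; rewrite -lee_fin -opnormE//; exact: opnorm_le. Qed.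

Lemma opnorm_adjoint_le (T S : {linear H -> H}) : continuous T -> continuous S ->
  (forall x y, hdot (T x) y = hdot x (S y)) -> fine (opnorm S) <= fine (opnorm T).
Proof.
move=> cT cS TS; apply: fine_opnorm_le => // [|y]; first exact: fine_opnorm_ge0.
have [y0|y0] := eqVneq (rnorm (S y)) 0.
  by rewrite y0 mulr_ge0 ?rnorm_ge0 ?fine_opnorm_ge0.
have yp : 0 < rnorm (S y) by rewrite lt_def y0 rnorm_ge0.
rewrite -(ler_pM2l yp) -expr2.
have : rnorm (hdot (T (S y)) y) = rnorm (S y) ^+ 2.
  by rewrite TS hdot_rnorm rnorm_real ger0_norm ?exprn_ge0 ?rnorm_ge0.
move=> <-; apply: le_trans (hdot_cauchy_schwarz _ _) _.
by rewrite mulrA [rnorm (S y) * _]mulrC ler_wpM2r ?rnorm_ge0 ?opnorm_bound.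
Qed.

(** The product is a separate operator [U] because a representation sends [a* a] to a linear map
    that agrees with the composite only pointwise. *)
Lemma opnorm_cstar (T S U : {linear H -> H}) :
  continuous T -> continuous S -> continuous U ->
  (forall x y, hdot (T x) y = hdot x (S y)) -> (forall x, U x = S (T x)) ->
  fine (opnorm U) = fine (opnorm T) ^+ 2.
Proof.
move=> cT cS cU TS UE; apply/eqP; rewrite eq_le; apply/andP; split.
  apply: fine_opnorm_le => // [|x]; first by rewrite exprn_ge0 ?fine_opnorm_ge0.
  rewrite UE; apply: le_trans (opnorm_bound _ cS) _.
  rewrite expr2 -mulrA; apply: ler_pM; rewrite ?rnorm_ge0 ?fine_opnorm_ge0 ?opnorm_bound//.
  exact: opnorm_adjoint_le.
rewrite -[leRHS]sqr_sqrtr ?fine_opnorm_ge0// lerXn2r ?nnegrE ?sqrtr_ge0 ?fine_opnorm_ge0//.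
apply: fine_opnorm_le => // x.
rewrite -(@ler_pXn2r _ 2)// ?nnegrE ?mulr_ge0 ?rnorm_ge0 ?sqrtr_ge0// exprMn.
rewrite sqr_sqrtr ?fine_opnorm_ge0//.
have : rnorm (hdot x (S (T x))) = rnorm (T x) ^+ 2.
  by rewrite -TS hdot_rnorm rnorm_real ger0_norm ?exprn_ge0 ?rnorm_ge0.
move=> <-; apply: le_trans (hdot_cauchy_schwarz _ _) _.
by rewrite -UE mulrC expr2 mulrA ler_wpM2r ?rnorm_ge0 ?opnorm_bound.
Qed.

End OperatorNorm.

Section RepresentationNorm.
Variables (R : realType) (A : banachStarAlg R).

Lemma star_rep_seminorm (H : hilbert R) (pi : bsa_data A -> {linear H -> H}) :
  star_rep pi -> cstar_seminorm (fun a : A => fine (opnorm (pi a))).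
Proof.
case=> pc pD pZ pM pS; have c a := pc a I.
split => [a b|z a|a b|a].
- apply: fine_opnorm_le => // [|x]; first by rewrite addr_ge0 ?fine_opnorm_ge0.
  rewrite pD//; apply: le_trans (rnormD _ _) _.
  by rewrite mulrDl lerD ?opnorm_bound.
- apply: (rnorm_homogeneous (p := fun b : A => fine (opnorm (pi b)))) => [b|w b].
    exact: fine_opnorm_ge0.
  apply: fine_opnorm_le => // [|x]; first by rewrite mulr_ge0 ?rnorm_ge0 ?fine_opnorm_ge0.
  by rewrite pZ// rnormZ -mulrA ler_wpM2l ?rnorm_ge0 ?opnorm_bound.
- apply: fine_opnorm_le => // [|x]; first by rewrite mulr_ge0 ?fine_opnorm_ge0.
  rewrite pM//; apply: le_trans (opnorm_bound _ (c a)) _.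
  by rewrite -mulrA ler_wpM2l ?fine_opnorm_ge0 ?opnorm_bound.
- by apply: opnorm_cstar => // [x y|x]; [exact: pS|exact: pM].
Qed.

Lemma star_rep_contractive (H : hilbert R) (pi : bsa_data A -> {linear H -> H}) a :
  star_rep pi -> (opnorm (pi a) <= (rnorm a)%:E)%E.
Proof.
move=> rp; rewrite opnormE; last by case: rp => /(_ a I).
by rewrite lee_fin; exact: cstar_seminorm_contractive (star_rep_seminorm rp) a.
Qed.

End RepresentationNorm.

Section GelfandNaimark.
Variables (R : realType) (A : banachStarAlg R) (N : A -> R).
Hypothesis NC : cstar_seminorm N.

Let ND : forall a b, N (a + b) <= N a + N b. Proof. by case: NC. Qed.

Let NZ : forall (c : R[i]) a, N (c *: a) = rnorm c * N a. Proof. by case: NC. Qed.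

Let NM : forall a b, N (bmul a b) <= N a * N b. Proof. by case: NC. Qed.

Let NS : forall a, N (bmul (bstar a) a) = N a ^+ 2. Proof. by case: NC. Qed.

Let N0 := cstar_seminorm_ge0 NC.
Let NZr (t : R) a : 0 <= t -> N (t%:C%C *: a) = t * N a.
Proof. by move=> t0; rewrite NZ rnorm_real ger0_norm. Qed.

Let re (a : A) : A := 2^-1%:C%C *: (a + bstar a).

(* A real-linear functional below [q] is positive, since [q (- b* b) <= 0], and
   monotonicity of [N] gives [q (c* c) = N (c* c)]. *)
Let sos (w : A) := exists r : seq A, w = \sum_(b <- r) bmul (bstar b) b.

Let sos0 : sos 0. Proof. by exists [::]; rewrite big_nil. Qed.

Let sosD v w : sos v -> sos w -> sos (v + w).
Proof. by move=> [r ->] [s ->]; exists (r ++ s); rewrite big_cat. Qed.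

Let sosZ (t : R) w : 0 <= t -> sos w -> sos (t%:C%C *: w).
Proof.
move=> t0 [r ->]; exists [seq (Num.sqrt t)%:C%C *: b | b <- r].
rewrite big_map scaler_sumr; apply: eq_bigr => b _.
by rewrite bstarZ conjC_real bmulZl bmulZr scalerA -rmorphM -expr2 sqr_sqrtr.
Qed.

Let sos_sq b : sos (bmul (bstar b) b).
Proof. by exists [:: b]; rewrite big_seq1. Qed.

(** The [N]-distance from the real part of [a] to the cone of negated sums of squares. *)
Let q (a : A) : R := inf [set N (re a + w) | w in sos].

Let q_lb a : has_lbound [set N (re a + w) | w in sos].
Proof. by exists 0 => _ [w _ <-]. Qed.

Let q_le a w : sos w -> q a <= N (re a + w).
Proof. by move=> sw; apply: ge_inf => //; exists w. Qed.

Let le_q a K : (forall w, sos w -> K <= N (re a + w)) -> K <= q a.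
Proof.
move=> h; apply: lb_le_inf; first by exists (N (re a + 0)); exists 0.
by move=> _ [w sw <-]; exact: h.
Qed.

Let q_approx a e : 0 < e -> exists2 w, sos w & N (re a + w) < q a + e.
Proof.
move=> e0; have [|_ [w sw <-] we] := @inf_adherent _ [set N (re a + w) | w in sos] e e0.
  by split; [exists (N (re a + 0)); exists 0|exact: q_lb].
by exists w.
Qed.

Let reD a b : re (a + b) = re a + re b.
Proof. by rewrite /re bstarD -scalerDr; congr (_ *: _); zmodule. Qed.

Let reZ (t : R) a : re (t%:C%C *: a) = t%:C%C *: re a.
Proof. by rewrite /re bstarZ conjC_real -scalerDr !scalerA mulrC. Qed.

Let re_sa a : bstar a = a -> re a = a.
Proof.
move=> sa; rewrite /re sa -[in a + a](scale1r a) -scalerDl scalerA.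
by rewrite -(rmorph1 (@real_complex R)) -rmorphD -rmorphM mulVf ?pnatr_eq0// rmorph1 scale1r.
Qed.

Let re_skew a : re (bstar a - a) = 0.
Proof. by rewrite /re bstarB bstarK [_ + _](_ : _ = 0) ?scaler0//; zmodule. Qed.

Let q_sublinear : sublinear q.
Proof.
split => [x y|t x t0].
  apply/ler_addgt0Pr => e e0.
  have [|v sv ve] := @q_approx x (e / 2); first lra.
  have [|w sw we] := @q_approx y (e / 2); first lra.
  have := q_le (x + y) (sosD sv sw); rewrite reD.
  have -> : re x + re y + (v + w) = (re x + v) + (re y + w) by zmodule.
  by have := ND (re x + v) (re y + w); lra.
rewrite -ler_pdivrMl//; apply: le_q => w sw; rewrite ler_pdivrMl//.
apply: le_trans (q_le _ (sosZ (ltW t0) sw)) _.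
by rewrite reZ -scalerDr NZr// ltW.
Qed.

Lemma norming_state c : exists phi : A -> R[i],
  [/\ positive_functional phi, forall a, complex.Re (phi a) <= N a &
      N c ^+ 2 <= complex.Re (phi (bmul (bstar c) c))].
Proof.
have [f [[fD fZ] fq fc]] := hahn_banach_sublinear (bmul (bstar c) c) q_sublinear.
have fN x : f (- x) = - f x by exact: (real_linearN x (conj fD fZ)).
(* [re] kills the skew elements [b* - b], so [q], and hence [f], is at most [0] on them, for [b = a]
   and for [b = a*]. *)
have fstar a : f (bstar a) = f a.
  have le b : f (bstar b - b) <= 0.
    apply: le_trans (fq _) _; apply: le_trans (q_le _ sos0) _.
    by rewrite re_skew addr0 (cstar_seminorm0 NC).
  have := le a; have := le (bstar a); rewrite bstarK !fD !fN; lra.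
(* The complex-linear functional with real part [f]. *)
pose phi a := (f a)%:C%C - 'i%C * (f ('i%C *: a))%:C%C.
have phiRe a : complex.Re (phi a) = f a.
  by rewrite /phi /=; ring.
have fi a : f ('i%C *: bstar a) = - f ('i%C *: a).
  by rewrite -[in RHS]fstar bstarZ conjCi scaleNr fN opprK.
have phiD a b : phi (a + b) = phi a + phi b.
  by rewrite /phi scalerDr !fD !rmorphD /=; ring.
exists phi; split => [|a|].
- split => [//|z a|a|a].
  + have rl (t : R) b : phi (t%:C%C *: b) = t%:C%C * phi b.
      have -> : phi (t%:C%C *: b) = (t * f b)%:C%C - 'i%C * (t * f ('i%C *: b))%:C%C.
        by rewrite /phi scalerA [_ * t%:C%C]mulrC -scalerA !fZ.
      by rewrite /phi !rmorphM /=; ring.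
    have im b : phi ('i%C *: b) = 'i%C * phi b.
      rewrite /phi scalerA mulCii scaleN1r fN mulrBr mulrA mulCii rmorphN /=; ring.
    rewrite [z]complexE [X in X *: _](_ : _ = (complex.Re z)%:C%C + (complex.Im z)%:C%C * 'i%C).
      by rewrite scalerDl phiD -scalerA !rl im; ring.
    by congr (_ + _); rewrite mulrC.
  + have cj (x y : R) : (x%:C%C - 'i%C * y%:C%C)^* = x%:C%C + 'i%C * y%:C%C.
      by rewrite rmorphB rmorphM /= !conjC_real conjCi; ring.
    by rewrite /phi fstar fi cj rmorphN /=; ring.
  + have sa : bstar (bmul (bstar a) a) = bmul (bstar a) a by rewrite bstarM bstarK.
    have h := fi (bmul (bstar a) a); rewrite sa in h.
    have -> : phi (bmul (bstar a) a) = (f (bmul (bstar a) a))%:C%C.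
      by rewrite /phi (_ : f ('i%C *: _) = 0) ?mulr0 ?subr0//; lra.
    rewrite lecR -oppr_le0 -fN; apply: le_trans (fq _) _.
    apply: le_trans (q_le _ (sos_sq a)) _.
    by rewrite re_sa ?bstarN ?sa// addNr (cstar_seminorm0 NC).
- rewrite phiRe; apply: le_trans (fq a) _; apply: le_trans (q_le _ sos0) _.
  rewrite addr0 NZr ?invr_ge0//; have := ND a (bstar a).
  by rewrite (cstar_seminorm_star NC); lra.
- rewrite phiRe fc; apply: le_q => _ [r ->].
  rewrite re_sa; last by rewrite bstarM bstarK.
  by rewrite -NS; exact: cstar_seminorm_monotone.
Qed.

(* For a state phi with phi(h^3) = N(a)^6, where h = a* a, the vector of h in the GNS
   representation satisfies |a h|^2 = phi(h^3) and |h|^2 = phi(h^2) <= N(a)^4. *)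
Theorem cstar_seminorm_le_universal a : ((N a)%:E <= universal_norm a)%E.
Proof.
pose h := bmul (bstar a) a; pose c := bmul a h.
have sh : bstar h = h by rewrite bstarM bstarK.
have [phi [pp pN pc]] := norming_state c.
have pb x : complex.Re (phi x) <= rnorm x.
  exact: le_trans (pN x) (cstar_seminorm_contractive NC x).
have [H [pi [e [prep pie eD edot]]]] := gns pp pb.
apply: (@le_trans _ _ (opnorm (pi a))); last by apply: ereal_sup_ubound; exists H, pi.
have [a0|an] := eqVneq (N a) 0; first by rewrite a0 opnorm_ge0.
have ap : 0 < N a by rewrite lt_def an N0.
have hE : N h = N a ^+ 2 by exact: NS.
have hh : N (bmul h h) = N h ^+ 2 by have := NS h; rewrite sh.
have en v : rnorm (e v) ^+ 2 = complex.Re (phi (bmul (bstar v) v)).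
  by rewrite -edot hdot_rnorm.
apply: (@opnorm_ge _ _ _ (e h) _ (N h)).
- by rewrite hE exprn_gt0.
- rewrite -(@ler_pXn2r _ 2)// ?nnegrE ?rnorm_ge0 ?N0// en sh -hh; exact: pN.
- rewrite -(@ler_pXn2r _ 2)// ?nnegrE ?rnorm_ge0 ?mulr_ge0 ?N0// pie en.
  apply: le_trans pc.
  have : N (bmul (bmul h h) (bmul h h)) = N h ^+ 2 ^+ 2.
    by have := NS (bmul h h); rewrite bstarM sh hh.
  have : N (bmul (bmul h h) (bmul h h)) <= N h * N (bmul (bstar c) c).
    have -> : bmul (bmul h h) (bmul h h) = bmul h (bmul (bstar c) c).
      by rewrite /c bstarM sh /h !bmulA.
    exact: NM.
  rewrite NS hE => h1 h2; rewrite h2 in h1.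
  move: h1; have -> : N a ^+ 2 ^+ 2 ^+ 2 = N a ^+ 2 * (N a * N a ^+ 2) ^+ 2 by ring.
  by rewrite ler_pM2l// exprn_gt0.
Qed.

End GelfandNaimark.

(** * Universal, full and reduced norms *)

Section UniversalNorm.
Variables (R : realType) (A : banachStarAlg R).

(** A finite supremum of C*-seminorms is one; [reduced] makes it definite. *)
Lemma universal_cstar_norm (N : A -> R) : reduced A ->
  (forall a, (N a)%:E = universal_norm a) -> cstar_norm N.
Proof.
move=> redA NU.
have ubN (H : hilbert R) (pi : bsa_data A -> {linear H -> H}) a :
    star_rep pi -> fine (opnorm (pi a)) <= N a.
  move=> rp; rewrite -lee_fin -opnormE; last by case: rp => /(_ a I).
  by rewrite NU; apply: ereal_sup_ubound; exists H, pi.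
have leN a K : (forall (H : hilbert R) (pi : bsa_data A -> {linear H -> H}),
    star_rep pi -> fine (opnorm (pi a)) <= K) -> N a <= K.
  move=> h; rewrite -lee_fin NU; apply: ub_ereal_sup => _ [H [pi [rp ->]]].
  by rewrite opnormE ?lee_fin; [exact: h|case: rp => /(_ a I)].
have N0 a : 0 <= N a.
  (* Without any representation the supremum would be [-oo], which is not the real number [N a]. *)
  have [[H [pi rp]]|no] := pselect (exists (H : hilbert R) (pi : bsa_data A -> {linear H -> H}), star_rep pi).
    exact: le_trans (fine_opnorm_ge0 (pi a)) (ubN _ _ a rp).
  have := NU a; rewrite /universal_norm [X in ereal_sup X](_ : _ = set0) ?ereal_sup0//.
  by rewrite -subset0 => t [H [pi [rp _]]]; apply: no; exists H, pi.
have NZ (z : R[i]) a : N (z *: a) <= rnorm z * N a.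
  apply: leN => H pi rp; have [_ -> _ _] := star_rep_seminorm rp.
  by rewrite ler_wpM2l ?rnorm_ge0 ?ubN.
split.
- move=> a b; apply: leN => H pi rp; have [h _ _ _] := star_rep_seminorm rp.
  by apply: le_trans (h a b) _; rewrite lerD ?ubN.
- exact: rnorm_homogeneous.
- move=> a Na0; apply: contrapT => a0; have [H [pi [rp [x px]]]] := redA a 0 a0; apply: px.
  have -> : pi (0 : A) x = 0.
    have [_ _ pZ _ _] := rp; have := pZ 0 (0 : A) I x; rewrite !scale0r.
    by move=> ->.
  apply/rnorm_eq0/eqP; rewrite eq_le rnorm_ge0 andbT.
  have pc : continuous (pi a) by case: rp => /(_ a I).
  apply: le_trans (opnorm_bound x pc) _.
  by have := ubN H pi a rp; rewrite Na0 => h; rewrite mulr_le0_ge0 ?rnorm_ge0.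
- move=> a b; apply: leN => H pi rp; have [_ _ h _] := star_rep_seminorm rp.
  by apply: le_trans (h a b) _; apply: ler_pM; rewrite ?fine_opnorm_ge0 ?ubN.
- move=> a; apply/eqP; rewrite eq_le; apply/andP; split.
    apply: leN => H pi rp; have [_ _ _ ->] := star_rep_seminorm rp.
    by rewrite lerXn2r ?nnegrE ?fine_opnorm_ge0 ?ubN.
  rewrite -[leRHS]sqr_sqrtr// lerXn2r ?nnegrE ?sqrtr_ge0//.
  apply: leN => H pi rp; have [_ _ _ h] := star_rep_seminorm rp.
  rewrite -(@ler_pXn2r _ 2)// ?nnegrE ?fine_opnorm_ge0 ?sqrtr_ge0//.
  by rewrite sqr_sqrtr// -h ubN.
Qed.

Lemma cstar_norm_seminorm (N : A -> R) : cstar_norm N -> cstar_seminorm N.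
Proof. by case. Qed.

Lemma dense_cstar_identity (D : set A) : closure D = setT ->
  (forall x : A, D x -> rnorm (bmul (bstar x) x) = rnorm x ^+ 2) ->
  forall x : A, rnorm (bmul (bstar x) x) = rnorm x ^+ 2.
Proof.
move=> dD DC x; apply/eqP; rewrite eq_le; apply/andP; split.
  by apply: le_trans (rnorm_bmul _ _) _; rewrite rnorm_bstar expr2.
apply/ler_addgt0Pr => e e0.
have x0 := rnorm_ge0 x.
have [d d0 [d1 de]] := small_affine x0 e0.
have [u Du xu] := rnorm_dense x dD d0; have u0 := rnorm_ge0 u.
have h1 := rnorm_bmulB (bstar u) u (bstar x) x.
rewrite -bstarB !rnorm_bstar [rnorm (u - x)]rnormB in h1.
have h2 := rnormD (x - u) u; rewrite subrK in h2.
have h3 := rnormD (u - x) x; rewrite subrK [rnorm (u - x)]rnormB in h3.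
have h4 := rnormD (bmul (bstar u) u - bmul (bstar x) x) (bmul (bstar x) x).
rewrite subrK (DC _ Du) in h4.
have h5 : rnorm x ^+ 2 <= rnorm u ^+ 2 + (d * rnorm u + d * rnorm u) + d * d.
  have : rnorm x ^+ 2 <= (rnorm u + d) ^+ 2 by rewrite lerXn2r ?nnegrE//; lra.
  by have -> : (rnorm u + d) ^+ 2 = rnorm u ^+ 2 + (d * rnorm u + d * rnorm u) + d * d by ring.
have h6 : rnorm (x - u) * rnorm u <= d * rnorm x + d.
  have -> : d * rnorm x + d = d * (rnorm x + 1) by ring.
  by apply: ler_pM; rewrite ?rnorm_ge0//; lra.
have h7 : rnorm x * rnorm (x - u) <= d * rnorm x by rewrite mulrC ler_wpM2r.
have h8 : d * rnorm u <= d * rnorm x + d.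
  have -> : d * rnorm x + d = d * (rnorm x + 1) by ring.
  by rewrite ler_wpM2l//; lra.
have h9 : d * d <= d by rewrite -[leRHS]mulr1 ler_wpM2l// ltW.
lra.
Qed.

End UniversalNorm.

(** [completion] only provides a Banach *-algebra; the C*-identity of its norm is recovered from the
    representations that define it on the dense image. *)
Lemma full_norm_cstar (R : realType) (G : topGroupoid) (s : G * G -> R[i])
    (B : banachStarAlg R) (iota : (G -> R[i]) -> B) :
  (forall f, Cc (R := R) f -> Cc (invol s f)) ->
  (forall f g, Cc f -> Cc g -> Cc (Defs.conv s f g)) ->
  completion (A := Cc_alg s) (full_norm s) iota ->
  forall x : B, rnorm (bmul (bstar x) x) = rnorm x ^+ 2.
Proof.
move=> CI CC [[iD iZ iM iS] iN id]; apply: (dense_cstar_identity id) => _ [f Cf <-].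
have ubN (H : hilbert R) (pi : Cc_alg s -> {linear H -> H}) g : Cc g ->
    star_rep pi -> I_bounded pi -> fine (opnorm (pi g)) <= rnorm (iota g).
  move=> Cg rp ib; rewrite -lee_fin -opnormE; last by case: rp => /(_ g Cg).
  by rewrite (iN g Cg); apply: ereal_sup_ubound; exists H, pi.
have leN g K : Cc g -> (forall (H : hilbert R) (pi : Cc_alg s -> {linear H -> H}),
    star_rep pi -> I_bounded pi -> fine (opnorm (pi g)) <= K) -> rnorm (iota g) <= K.
  move=> Cg h; rewrite -lee_fin (iN g Cg); apply: ub_ereal_sup => _ [H [pi [rp ib ->]]].
  by rewrite opnormE ?lee_fin; [exact: h|case: rp => /(_ g Cg)].
have Cf' := CI _ Cf; have Cff := CC _ _ Cf' Cf.
have iM' : iota (Defs.conv s (invol s f) f) = bmul (iota (invol s f)) (iota f) := iM _ _ Cf' Cf.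
have repC (H : hilbert R) (pi : Cc_alg s -> {linear H -> H}) : star_rep pi ->
    fine (opnorm (pi (Defs.conv s (invol s f) f))) = fine (opnorm (pi f)) ^+ 2.
  case=> pc pD pZ pM pS.
  apply: (@opnorm_cstar _ _ (pi f) (pi (invol s f))).
  - exact: pc.
  - exact: pc.
  - exact: pc.
  - by move=> x y; exact: pS.
  - by move=> x; exact: pM.
have -> : bstar (iota f) = iota (invol s f) by rewrite -iS.
rewrite -iM'.
apply/eqP; rewrite eq_le; apply/andP; split.
  apply: leN => // H pi rp ib; rewrite repC//.
  by rewrite lerXn2r ?nnegrE ?fine_opnorm_ge0 ?rnorm_ge0 ?ubN.
rewrite -[leRHS]sqr_sqrtr ?rnorm_ge0// lerXn2r ?nnegrE ?sqrtr_ge0 ?rnorm_ge0//.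
apply: leN => // H pi rp ib.
rewrite -(@ler_pXn2r _ 2)// ?nnegrE ?fine_opnorm_ge0 ?sqrtr_ge0//.
by rewrite sqr_sqrtr ?rnorm_ge0// -repC// ubN.
Qed.

(** Bijectivity of [q] is purely algebraic. Through the inverse [g], the norm of [Cfull] becomes a
    C*-seminorm on [Cred]; such seminorms are contractive, so [g] does not increase norms. *)
Lemma weak_containment_full_le (R : realType) (G : topGroupoid) (s : G * G -> R[i]) :
  (forall f, Cc (R := R) f -> Cc (invol s f)) ->
  (forall f g, Cc f -> Cc g -> Cc (Defs.conv s f g)) ->
  weak_containment s ->
  forall f, Cc f -> (full_norm s f <= reduced_norm s f)%E.
Proof.
move=> CI CC [Cfull [Cred [ifull [ired [q [cf cr [qD qZ qM qS] qi [g gq qg]]]]]]] f Cf.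
have CF := full_norm_cstar CI CC cf.
have gS : cstar_seminorm (fun c : Cred => rnorm (g c)).
  split => [a b|z a|a b|a].
  - apply: le_trans (rnormD _ _); rewrite -[g a + g b]gq qD// !qg; exact: lexx.
  - by rewrite -rnormZ -[z *: g a]gq qZ// qg.
  - apply: le_trans (rnorm_bmul _ _); rewrite -[bmul (g a) (g b)]gq qM// !qg; exact: lexx.
  - by rewrite -CF -[bmul _ (g a)]gq qM// qS// qg.
have [_ cfN _] := cf; have [_ crN _] := cr.
rewrite -cfN// -crN// lee_fin.
by have := cstar_seminorm_contractive gS (ired f); rewrite -qi// gq.
Qed.

(** * The convolution algebra of an étale groupoid *)

(** Meant for [gmul] and the cocycle, which are continuous on composable pairs only: the inner map
    has to stay among these near [x]. *)
Lemma within_continuous_comp (S T U : topologicalType) (A : set T) (p : T -> U) (h : S -> T) (x : S) :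
  {within A, continuous p} -> {for x, continuous h} -> A (h x) ->
  nbhs x (h @^-1` A) -> {for x, continuous (p \o h)}.
Proof.
move=> /subspace_continuousP pA hx Ahx Ah V nV.
have := pA (h x) Ahx V nV; rewrite /fmap /within /= => nA.
have := hx _ nA; rewrite /fmap /= => nh.
by apply: filterS (filterI Ah nh) => y [Ay]; apply.
Qed.

Lemma fsum_seq (V : zmodType) (T : choiceType) (D : set T) (r : seq T) (F : T -> V) :
  uniq r -> [set` r] `<=` D -> (forall m, D m -> F m != 0 -> m \in r) ->
  \sum_(m \in D) F m = \sum_(m <- r) F m.
Proof.
move=> ur rD Dr; rewrite [RHS]fsbig_seq//; apply: esym; apply: fsbig_widen => // m [Dm /= mr].
by apply/eqP; apply: contrapT => /negP Fm; apply: mr; exact: Dr.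
Qed.

Lemma infinite_compact_cluster (T : topologicalType) (K S : set T) :
  compact K -> S `<=` K -> infinite_set S ->
  exists2 p, K p & forall U, nbhs p U -> infinite_set (S `&` U).
Proof.
move=> cK SK Si; pose F := [set B : set T | finite_set (S `\` B)].
have FF : ProperFilter F.
  split; first by rewrite /F /= setD0.
  split; first by rewrite /F /= setDT; exact: finite_set0.
  - by move=> A B fA fB; rewrite /F /= setDIr finite_setU; split.
  - by move=> A B AB; apply: sub_finite_set => x [Sx nBx]; split => // /AB.
have FK : F K by rewrite /F /= (_ : _ `\` _ = set0)//; apply/seteqP; split => // x [/SK].
have [p [Kp pc]] := cK F FF FK; exists p => // U nU fU.
have FU : F (~` U) by rewrite /F /= setDE setCK.
by have [x [nUx Ux]] := pc _ _ FU nU.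
Qed.

Section EtaleSections.
Variables (G : topGroupoid) (etG : etale G).

Lemma units_rng (x : G) : units G x -> rng x = x.
Proof. by move=> [g _ <-]; rewrite rng_rng. Qed.

Lemma units_src (x : G) : units G x -> src x = x.
Proof. by move=> [g _ <-]; rewrite src_rng. Qed.

Lemma src_units (g : G) : units G (src g).
Proof. by exists (src g) => //; rewrite rng_src. Qed.

Lemma rng_units (g : G) : units G (rng g).
Proof. by exists g. Qed.

Lemma units_inv (x : G) : units G x -> ginv x = x.
Proof.
move=> ux; rewrite -[LHS]gmul_src src_inv (units_rng ux).
by rewrite -{3}(units_src ux) -(gmulVl x).
Qed.

Lemma gmul_inv_src (g m : G) : src m = src g -> src g = rng (ginv m).
Proof. by move=> mg; rewrite rng_inv mg. Qed.

Lemma gmulKV (g m : G) : src m = src g -> gmul (gmul g (ginv m)) m = g.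
Proof.
move=> mg; rewrite gmulA; [|exact: gmul_inv_src|by rewrite src_inv].
by rewrite gmulVl mg gmul_src.
Qed.

Lemma gmulK (a b : G) : src a = rng b -> gmul (gmul a b) (ginv b) = a.
Proof.
by move=> ab; rewrite gmulA ?rng_inv// gmulV -ab gmul_src.
Qed.

Lemma gmulVK (a b : G) : src a = rng b -> gmul (ginv a) (gmul a b) = b.
Proof.
by move=> ab; rewrite -gmulA ?src_inv// gmulVl ab rng_gmul.
Qed.

(** Near a unit, [h] and [rng h] both lie in a set on which [rng] is injective, and they have the
    same range. *)
Lemma open_units : open (units G).
Proof.
rewrite openE => x ux; have [_ /(_ x) [U [W [k [[oU Ux] _ _ kU _]]]]] := etG.
have nU : nbhs x U by exact: open_nbhs_nbhs.
have nrU : nbhs x (rng @^-1` U) by apply: rng_continuous; rewrite (units_rng ux).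
apply: filterS (filterI nU nrU) => h [Uh Urh] /=.
exists h => //; have kh := kU h (mem_set Uh).
by have := kU (rng h) (mem_set Urh); rewrite rng_rng kh.
Qed.

(** [etale] speaks of [rng], so it is used at [ginv m] and carried over by inversion. As the units
    are open, the section [k] is continuous for the topology of [G] itself. *)
Lemma src_section (m : G) : exists (U V : set G) (k : G -> G),
  [/\ open U, U m, open V /\ V `<=` units G, forall u, U u -> V (src u) &
   [/\ forall u, U u -> k (src u) = u,
       forall x, V x -> U (k x) /\ src (k x) = x &
       forall x, V x -> {for x, continuous k}]].
Proof.
have [_ /(_ (ginv m)) [U [W [k [[oU Um] oW UW kU kc]]]]] := etG.
pose V := W `&` units G.
have VE x : V x -> exists2 u, U u & rng u = x by rewrite /V -UW => -[u Uu <-]; exists u.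
exists (ginv @^-1` U), V, (ginv \o k); split => //.
- by apply: open_comp => // x _; exact: ginv_continuous.
- by split; [apply: openI => //; exact: open_units|move=> x []].
- by move=> u Uu; rewrite /V -UW; exists (ginv u) => //; rewrite rng_inv.
split.
- by move=> u Uu /=; rewrite -rng_inv kU ?ginvK// inE.
- move=> x /VE[u Uu <-] /=; rewrite kU ?inE//; rewrite ginvK src_inv.
  by split => //=; rewrite ginvK.
- move=> x Vx.
  have kx : {for x, continuous k}.
    have oV : open V by apply: openI => //; exact: open_units.
    have rV : rng @` U = V by rewrite UW.
    have := kc; rewrite rV continuous_open_subspace//.
    by apply; rewrite inE.
  by apply: continuous_comp => //; exact: ginv_continuous.
Qed.

(** Around a cluster point, a set on which [src] is injective would contain infinitely many points
    of a single fibre. *)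
Lemma compact_fibre_finite (K : set G) (x : G) : hausdorff_space G -> compact K ->
  finite_set (K `&` src_fibre x).
Proof.
move=> hG cK; apply: contrapT => Si.
have [p Kp pc] := infinite_compact_cluster cK (@subIsetl _ _ _) Si.
have [U [V [k [oU Up _ _ [kU _ _]]]]] := src_section p.
apply: (pc U); first exact: open_nbhs_nbhs.
apply: (@sub_finite_set _ _ [set k x]); last exact: finite_set1.
by move=> m [[_ mx] Um] /=; rewrite -[LHS]kU// mx.
Qed.

End EtaleSections.

Lemma near_all_seq (T : choiceType) (S : topologicalType) (x : S) (r : seq T) (P : T -> set S) :
  (forall m, m \in r -> nbhs x (P m)) -> nbhs x [set y | forall m, m \in r -> P m y].
Proof.
elim: r => [|m r IH] h; first by apply: filterS filterT => y _ m.
have h1 : nbhs x (P m) by apply: h; rewrite mem_head.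
have h2 : nbhs x [set y | forall m, m \in r -> P m y].
  by apply: IH => n nr; apply: h; rewrite inE nr orbT.
by apply: filterS (filterI h1 h2) => y [Py h3] n; rewrite inE => /orP[/eqP->//|/h3].
Qed.

Lemma near_neq (S T : topologicalType) (f g : S -> T) (x : S) : hausdorff_space T ->
  {for x, continuous f} -> {for x, continuous g} -> f x <> g x ->
  nbhs x [set y | f y != g y].
Proof.
move=> hT fx gx /eqP fg; move: hT; rewrite open_hausdorff => /(_ _ _ fg)[[A B] /= [Af Bg] [oA oB AB]].
have nA : nbhs x (f @^-1` A).
  by apply: fx; apply: open_nbhs_nbhs; split => //; move: Af; rewrite inE.
have nB : nbhs x (g @^-1` B).
  by apply: gx; apply: open_nbhs_nbhs; split => //; move: Bg; rewrite inE.
apply: filterS (filterI nA nB) => y [/= Ay By]; apply/eqP => fgy.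
by have : (A `&` B) (f y) by [split => //; rewrite fgy]; rewrite (eqP AB).
Qed.

Section LocalSections.
Variables (G : topGroupoid) (etG : etale G) (hG : hausdorff_space G).

(** A section goes through each of the finitely many points of [K] over [x0]. What the sets [U m]
    leave of [K] is compact, so its sources form a closed set, which misses [x0]. Near [x0], sums
    over fibres thus become sums over the fixed list [ms]; the sections may leave [K], where the
    summands vanish. *)
Lemma local_sections (K : set G) (x0 : G) : compact K -> units G x0 ->
  exists (ms : seq G) (k : G -> G -> G),
  (forall m, m \in ms -> {for x0, continuous (k m)}) /\
  nbhs x0 [set x | [/\ forall m, m \in ms -> src (k m x) = x,
     uniq [seq k m x | m <- ms] &
     forall g, K g -> src g = x -> g \in [seq k m x | m <- ms]]].
Proof.
move=> cK ux0.
have /finite_seqP[ms0 msE] := compact_fibre_finite etG x0 hG cK.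
pose ms := undup ms0.
have msP m : m \in ms <-> K m /\ src m = x0.
  rewrite mem_undup -[_ /\ _]/((K `&` src_fibre x0) m) msE /=; split=> //.
have [U /choice[V /choice[k kP]]] := choice (src_section etG).
exists ms, k.
have mV m : m \in ms -> V m x0.
  by move=> /msP[Km mx]; have [_ Um _ UV _] := kP m; rewrite -mx; exact: UV.
have nV m : m \in ms -> nbhs x0 (V m).
  move=> mm; apply: open_nbhs_nbhs; split; last exact: mV.
  by have [_ _ [oV _] _ _] := kP m.
have km m : m \in ms -> k m x0 = m.
  by move=> /msP[Km mx]; have [_ Um _ _ [kU _ _]] := kP m; rewrite -mx kU.
have kc m : m \in ms -> {for x0, continuous (k m)}.
  by move=> mm; have [_ _ _ _ [_ _]] := kP m; apply; exact: mV.
split => //.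
pose L := K `&` ~` \bigcup_(m in [set` ms]) U m.
have cL : compact L.
  apply: (@subclosed_compact _ _ K) => //; last by move=> g [].
  apply: closedI; first exact: compact_closed.
  apply: open_closedC; apply: bigcup_open => m _.
  by have [oU _ _ _ _] := kP m.
have csL : closed (src @` L).
  apply: compact_closed => //; apply: continuous_compact => //.
  by apply: continuous_subspaceT; exact: src_continuous.
have nL : nbhs x0 (~` (src @` L)).
  apply: open_nbhs_nbhs; split; first exact: closed_openC.
  move=> [g [Kg nU] gx]; apply: nU; exists g; first by apply/msP.
  by have [_ Um _ _ _] := kP g.
have nd : nbhs x0 [set x | forall m, m \in ms -> forall m', m' \in ms ->
    m != m' -> k m x != k m' x].
  apply: near_all_seq => m mm; apply: near_all_seq => m' mm'.
  have [->|mn] := eqVneq m m'; first by apply: filterS filterT => x _ /=; rewrite eqxx.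
  apply: filterS (_ : nbhs x0 [set y | k m y != k m' y]) => //.
  by apply: near_neq => //; [exact: kc|exact: kc|rewrite !km//; exact/eqP].
have nVs := near_all_seq nV.
apply: filterS (filterI nL (filterI nd nVs)) => x [xL [xd xV]].
have srck m : m \in ms -> src (k m x) = x.
  by move=> mm; have [_ _ _ _ [_ h _]] := kP m; exact: (h x (xV m mm)).2.
split => //.
- rewrite map_inj_in_uniq ?undup_uniq// => m m' mm mm' kk; apply/eqP/negP => /negP mn.
  by have := xd m mm m' mm' mn; rewrite kk eqxx.
- move=> g Kg gx.
  have [m mm Umg] : (\bigcup_(m in [set` ms]) U m) g.
    by apply: contrapT => nU; apply: xL; exists g.
  apply/mapP; exists m => //; have [_ _ _ _ [kU _ _]] := kP m.
  by rewrite -gx kU.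
Qed.

End LocalSections.

Lemma near_eq_continuous (S T : topologicalType) (f g : S -> T) (x : S) :
  nbhs x [set y | f y = g y] -> {for x, continuous g} -> {for x, continuous f}.
Proof.
move=> fg gx V; rewrite (nbhs_singleton fg) => /gx ng.
by apply: filterS (filterI fg ng) => y [/= fgy] Vgy; rewrite /= fgy.
Qed.

Lemma continuous_sum_seq (R : realType) (S : topologicalType) (T : eqType) (x : S) (r : seq T)
    (F : T -> S -> R[i]) :
  (forall m, m \in r -> {for x, continuous (F m)}) ->
  {for x, continuous (fun y => \sum_(m <- r) F m y)}.
Proof.
elim: r => [|m r IH] h.
  apply: (@near_eq_continuous _ _ _ (fun=> 0)); last exact: cvg_cst.
  by apply: filterS filterT => y _; rewrite /= big_nil.
apply: (@near_eq_continuous _ _ _ (fun y => F m y + \sum_(m <- r) F m y)).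
  by apply: filterS filterT => y _; rewrite /= big_cons.
apply: cvgD; first by apply: h; rewrite mem_head.
by apply: IH => n nr; apply: h; rewrite inE nr orbT.
Qed.

Lemma continuous_conjC (R : realType) (S : topologicalType) (x : S) (f : S -> R[i]) :
  {for x, continuous f} -> {for x, continuous (fun y => (f y)^*)}.
Proof.
move=> fx; apply/cvgrPdist_le => e e0.
move/cvgrPdist_le: fx => /(_ e e0); apply: filterS => y /=.
by rewrite -rmorphB norm_conjC.
Qed.

Lemma closed_eq_set (S T : topologicalType) (f g : S -> T) : hausdorff_space T ->
  continuous f -> continuous g -> closed [set x | f x = g x].
Proof.
move=> hT fc gc x cx; apply: contrapT => fg.
have [y [yfg /=]] := cx _ (near_neq hT (fc x) (gc x) fg).
by rewrite yfg eqxx.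
Qed.

Lemma pair_continuous (S T U : topologicalType) (f : S -> T) (g : S -> U) (x : S) :
  {for x, continuous f} -> {for x, continuous g} ->
  {for x, continuous (fun y => (f y, g y))}.
Proof. by move=> fx gx; apply: cvg_pair. Qed.

Section CompactSupport.
Variables (R : realType) (G : topGroupoid) (hG : hausdorff_space G).
Implicit Types f g : G -> R[i].

Lemma Cc_intro f (K : set G) : continuous f -> compact K ->
  (forall x, f x <> 0 -> K x) -> Cc f.
Proof.
move=> cf cK fK; split => //; apply: (@subclosed_compact _ _ K) => //.
  exact: closed_closure.
rewrite closureE => x; apply; split; first exact: compact_closed.
by move=> y /= /eqP; exact: fK.
Qed.

Lemma Cc_support f : Cc f -> exists K : set G, [/\ compact K, closed K & forall x, f x <> 0 -> K x].
Proof.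
move=> [cf cK]; exists (closure [set g | f g != 0]); split => //; first exact: closed_closure.
by move=> x /eqP fx; exact: subset_closure.
Qed.

Lemma CcD f g : Cc f -> Cc g -> Cc (f + g).
Proof.
move=> Cf Cg; have [K [cK _ fK]] := Cc_support Cf; have [L [cL _ gL]] := Cc_support Cg.
apply: (@Cc_intro _ (K `|` L)); first by move=> x; apply: cvgD; [exact: Cf.1|exact: Cg.1].
  exact: compactU.
move=> x fgx; have [fx|fx] := pselect (f x = 0); last by left; exact: fK.
right; apply: gL => gx; apply: fgx.
by have -> : (f + g) x = f x + g x by []; rewrite fx gx addr0.
Qed.

Lemma CcZ (c : R[i]) f : Cc f -> Cc (c *: f).
Proof.
move=> Cf; have [K [cK _ fK]] := Cc_support Cf.
apply: (@Cc_intro _ K) => //.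
  by move=> x; apply: (@cvgM _ _ _ _ (fun=> c) f); [exact: cvg_cst|exact: Cf.1].
move=> x cfx; apply: fK => fx; apply: cfx.
by have -> : (c *: f) x = c * f x by []; rewrite fx mulr0.
Qed.

Lemma CcB f g : Cc f -> Cc g -> Cc (f - g).
Proof. by move=> Cf Cg; rewrite -scaleN1r; apply: CcD => //; exact: CcZ. Qed.

End CompactSupport.

Section Convolution.
Variables (R : realType) (G : topGroupoid) (hG : hausdorff_space G) (etG : etale G).
Variables (s : G * G -> R[i]) (cs : Z2 R G s).
Implicit Types f g : G -> R[i].

Let s_cont : {within composable G, continuous s}. Proof. by case: cs. Qed.

Lemma conv_neq0 f g (x : G) : Defs.conv s f g x <> 0 ->
  exists m, [/\ src m = src x, f (gmul x (ginv m)) <> 0 & g m <> 0].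
Proof.
move=> h; apply: contrapT => no; apply: h; rewrite /Defs.conv.
apply: fsbig1 => m mx.
have [fx|fx] := pselect (f (gmul x (ginv m)) = 0); first by rewrite fx !mul0r.
have [gm|gm] := pselect (g m = 0); first by rewrite gm mulr0 mul0r.
by exfalso; apply: no; exists m.
Qed.

Lemma conv_continuous f g : continuous f -> Cc g -> continuous (Defs.conv s f g).
Proof.
move=> cf Cg x0; have [K [cK _ gK]] := Cc_support Cg.
have [ms [k [kc nk]]] := local_sections etG hG cK (src_units x0).
have srcc := @src_continuous G.
have nk' : nbhs x0 (src @^-1` _) := srcc x0 _ nk.
pose F m x := f (gmul x (ginv (k m (src x)))) * g (k m (src x)) *
  s (gmul x (ginv (k m (src x))), k m (src x)).
apply: (@near_eq_continuous _ _ _ (fun x => \sum_(m <- ms) F m x)).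
  apply: filterS nk' => x [ks ku kK] /=.
  rewrite /Defs.conv (@fsum_seq _ _ _ [seq k m (src x) | m <- ms])//.
  - by rewrite big_map.
  - by move=> _ /mapP[m mm ->]; exact: ks.
  - move=> m mx Fm; apply: kK => //; apply: gK => gm.
    by move: Fm; rewrite gm mulr0 mul0r eqxx.
apply: continuous_sum_seq => m mm.
have kcx : {for x0, continuous (fun x => k m (src x))}.
  by apply: (@continuous_comp _ _ _ src (k m)); [exact: srcc|exact: kc].
have icx : {for x0, continuous (fun x => ginv (k m (src x)))}.
  by apply: (@continuous_comp _ _ _ _ ginv) => //; exact: ginv_continuous.
have ksrc : nbhs x0 [set x | src (k m (src x)) = src x].
  by apply: filterS nk' => x [ks _ _] /=; rewrite ks.
have mcx : {for x0, continuous (fun x => gmul x (ginv (k m (src x))))}.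
  apply: (@within_continuous_comp _ _ _ _ (fun p => gmul p.1 p.2)
    (fun x => (x, ginv (k m (src x)))) x0 (@gmul_continuous G)).
  - by apply: pair_continuous => //; exact: cvg_id.
  - by rewrite /= rng_inv (nbhs_singleton ksrc).
  - by apply: filterS ksrc => x /= h; rewrite rng_inv h.
apply: cvgM; first apply: cvgM.
- have h := continuous_comp mcx (cf _); exact: h.
- have h := continuous_comp kcx (Cg.1 _); exact: h.
apply: (within_continuous_comp s_cont); first exact: pair_continuous.
- by rewrite /composable /= src_mul ?src_inv// rng_inv (nbhs_singleton ksrc).
- by apply: filterS ksrc => x /= h; rewrite /composable /= src_mul ?src_inv// rng_inv h.
Qed.

Lemma compact_mul (K L : set G) : compact K -> compact L ->
  compact [set gmul p.1 p.2 | p in (K `*` L) `&` composable G].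
Proof.
move=> cK cL; have clK := compact_closed hG cK; have clL := compact_closed hG cL.
have cP : closed (composable G).
  apply: (@closed_eq_set _ _ (fun p : G * G => src p.1) (fun p => rng p.2)) => // p.
    by apply: (@continuous_comp _ _ _ fst src); [exact: cvg_fst|exact: src_continuous].
  by apply: (@continuous_comp _ _ _ snd rng); [exact: cvg_snd|exact: rng_continuous].
apply: continuous_compact.
  exact: continuous_subspaceW (@subIsetr _ _ _) (@gmul_continuous G).
apply: (@subclosed_compact _ _ (K `*` L)); last by move=> ? [].
  apply: closedI => //; rewrite [K `*` L](_ : _ = (fst @^-1` K) `&` (snd @^-1` L))//.
  by apply: closedI; apply: closed_comp => // p _; [exact: cvg_fst|exact: cvg_snd].
exact: compact_setX.
Qed.

Lemma conv_support f g (K L : set G) : (forall x, f x <> 0 -> K x) -> (forall x, g x <> 0 -> L x) ->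
  forall x, Defs.conv s f g x <> 0 ->
  [set gmul p.1 p.2 | p in (K `*` L) `&` composable G] x.
Proof.
move=> fK gL x /conv_neq0[m [mx fx gm]]; exists (gmul x (ginv m), m); last exact: gmulKV.
split; first by split; [exact: fK|exact: gL].
by rewrite /composable /= src_mul ?src_inv// rng_inv mx.
Qed.

Lemma Cc_conv f g : Cc f -> Cc g -> Cc (Defs.conv s f g).
Proof.
move=> Cf Cg; have [K [cK _ fK]] := Cc_support Cf; have [L [cL _ gL]] := Cc_support Cg.
apply: (@Cc_intro _ _ hG _ [set gmul p.1 p.2 | p in (K `*` L) `&` composable G]).
- by apply: conv_continuous => //; exact: Cf.1.
- exact: compact_mul.
- exact: conv_support.
Qed.

Lemma Cc_invol f : Cc f -> Cc (invol s f).
Proof.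
move=> Cf; have [K [cK _ fK]] := Cc_support Cf.
apply: (@Cc_intro _ _ hG _ [set ginv x | x in K]).
- move=> x.
  have h1 : {for x, continuous (fun y => s (ginv y, y))}.
    apply: (@within_continuous_comp _ _ _ (composable G) s (fun y => (ginv y, y)) x s_cont).
    + by apply: pair_continuous; [exact: ginv_continuous|exact: cvg_id].
    + by rewrite /composable /= src_inv.
    + by apply: filterS filterT => y _; rewrite /composable /= src_inv.
  have h2 := continuous_comp (@ginv_continuous G x) (Cf.1 _).
  exact: cvgM (continuous_conjC h1) (continuous_conjC h2).
- by apply: continuous_compact => //; apply: continuous_subspaceT; exact: ginv_continuous.
- move=> x h; exists (ginv x); last exact: ginvK.
  by apply: fK => fx; apply: h; rewrite /invol fx conjC0 mulr0.
Qed.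

Let s_norm p : composable G p -> `|s p| = 1. Proof. by case: cs => h _ _ _; exact: h. Qed.

Let s_unit (g : G) : s (rng g, g) = 1 /\ s (g, src g) = 1. Proof. by case: cs. Qed.

(** The cocycle identity at [m], [ginv m], [m]. *)
Lemma cocycle_inv (m : G) : s (m, ginv m) = s (ginv m, m).
Proof.
case: cs => _ _ su sc.
have := sc m (ginv m) m; rewrite /composable /= rng_inv src_inv gmulV gmulVl.
by move=> /(_ erefl erefl); rewrite (su m).1 (su m).2 !mulr1.
Qed.

Lemma cocycle_invK (m : G) : (s (m, ginv m))^* * s (ginv m, m) = 1.
Proof.
rewrite cocycle_inv mulrC -normCK s_norm ?expr1n//.
by rewrite /composable /= src_inv.
Qed.

(** At a unit the cocycle factors of product and involution cancel, leaving the l2 inner product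
    over the fibre. This ties evaluation at [x] to the regular representation at [x]. *)
Lemma conv_invol_unit f g (x : G) : units G x ->
  Defs.conv s (invol s f) g x = \sum_(m \in src_fibre x) (f m)^* * g m.
Proof.
move=> ux; rewrite /Defs.conv (units_src ux); apply: eq_fsbigr => m; rewrite inE /src_fibre /= => mx.
have -> : gmul x (ginv m) = ginv m by rewrite -mx -(rng_inv m) rng_gmul.
rewrite /invol ginvK mulrAC [_^* * _ * _]mulrAC cocycle_invK mul1r.
by rewrite mulrC.
Qed.

Lemma conv_unit_l h f (x : G) : (forall m, h m <> 0 -> units G m) ->
  Defs.conv s h f x = h (rng x) * f x.
Proof.
move=> hu; rewrite /Defs.conv (@fsum_seq _ _ _ [:: x])//.
- by rewrite big_seq1 gmulV (s_unit x).1 mulr1.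
- by move=> m /=; rewrite inE => /eqP->.
- move=> m mx Fm; have hm : h (gmul x (ginv m)) <> 0.
    by move=> hm; move: Fm; rewrite hm !mul0r eqxx.
  rewrite inE; apply/eqP; have := units_src (hu _ hm).
  rewrite src_mul ?src_inv; last by rewrite rng_inv mx.
  by move=> e; rewrite -(@gmulKV _ x m)// -e rng_gmul.
Qed.

Lemma conv_unit_r f h (x : G) : (forall m, h m <> 0 -> units G m) ->
  Defs.conv s f h x = f x * h (src x).
Proof.
move=> hu; rewrite /Defs.conv (@fsum_seq _ _ _ [:: src x])//.
- rewrite big_seq1 (units_inv (src_units x)) gmul_src (s_unit x).2 mulr1//.
- by move=> m /=; rewrite inE => /eqP->; rewrite /src_fibre /= src_src.
- move=> m mx Fm; have hm : h m <> 0.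
    by move=> hm; move: Fm; rewrite hm mulr0 mul0r eqxx.
  by rewrite inE -mx; apply/eqP; rewrite (units_src (hu _ hm)).
Qed.

Lemma invol_unit f (x : G) : units G x -> invol s f x = (f x)^*.
Proof.
move=> ux; rewrite /invol (units_inv ux).
by have := (s_unit x).1; rewrite (units_rng ux) => ->; rewrite conjC1 mul1r.
Qed.

End Convolution.

Lemma esum_seq_ge (R : realType) (T : choiceType) (D : set T) (a : T -> R) (r : seq T) :
  uniq r -> (forall m, m \in r -> D m) ->
  ((\sum_(m <- r) a m)%:E <= \esum_(m in D) (a m)%:E)%E.
Proof.
move=> ur rD; apply: esum_ge; exists [set` r].
  by split; [apply/finite_seqP; exists r|move=> m /rD].
by rewrite -fsbig_seq// sumEFin.
Qed.

Lemma esum_le_seq (R : realType) (T : choiceType) (D : set T) (a : T -> R) (K : \bar R) :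
  (forall r : seq T, uniq r -> (forall m, m \in r -> D m) -> ((\sum_(m <- r) a m)%:E <= K)%E) ->
  (\esum_(m in D) (a m)%:E <= K)%E.
Proof.
move=> h; apply: ub_ereal_sup => _ [X [/finite_seqP[r ->] rD] <-].
have -> : [set` r] = [set` undup r] by apply/seteqP; split => m; rewrite /= mem_undup.
rewrite -fsbig_seq ?undup_uniq// sumEFin; apply: h; rewrite ?undup_uniq// => m.
by rewrite mem_undup => /rD.
Qed.

(** * Evaluation states of the l1-algebra *)

Section INorm.
Variables (R : realType) (G : topGroupoid).
Implicit Types f g : G -> R[i].

Lemma I_norm_ge_src f (x : G) (r : seq G) : uniq r ->
  (forall m, m \in r -> src m = src x) -> ((\sum_(m <- r) rnorm (f m))%:E <= I_norm f)%E.
Proof.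
move=> ur rx; apply: (@le_trans _ _ (\esum_(g in src_fibre (src x)) (rnorm (f g))%:E)%E).
  exact: esum_seq_ge.
apply: le_trans (_ : (_ <= maxe _ _)%E) _; last first.
  by apply: ereal_sup_ubound; right; exists (src x) => //; exact: src_units.
by rewrite Order.TotalTheory.le_max lexx.
Qed.

Lemma I_norm_ge_rng f (x : G) (r : seq G) : uniq r ->
  (forall m, m \in r -> rng m = rng x) -> ((\sum_(m <- r) rnorm (f m))%:E <= I_norm f)%E.
Proof.
move=> ur rx; apply: (@le_trans _ _ (\esum_(g in rng_fibre (rng x)) (rnorm (f g))%:E)%E).
  exact: esum_seq_ge.
apply: le_trans (_ : (_ <= maxe _ _)%E) _; last first.
  by apply: ereal_sup_ubound; right; exists (rng x) => //; exact: rng_units.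
by rewrite Order.TotalTheory.le_max lexx orbT.
Qed.

Lemma I_norm_le f (K : \bar R) : (0 <= K)%E ->
  (forall (r : seq G) x, uniq r -> (forall m, m \in r -> src m = src x) ->
     ((\sum_(m <- r) rnorm (f m))%:E <= K)%E) ->
  (forall (r : seq G) x, uniq r -> (forall m, m \in r -> rng m = rng x) ->
     ((\sum_(m <- r) rnorm (f m))%:E <= K)%E) ->
  (I_norm f <= K)%E.
Proof.
move=> K0 hs hr; apply: ub_ereal_sup => _ [->//|[x ux <-]].
rewrite Order.TotalTheory.ge_max; apply/andP; split; apply: esum_le_seq => r ur rx.
  by apply: (hs r x) => // m /rx; rewrite /src_fibre /= (units_src ux).
by apply: (hr r x) => // m /rx; rewrite /rng_fibre /= (units_rng ux).
Qed.

Lemma I_norm_ge f (x : G) : ((rnorm (f x))%:E <= I_norm f)%E.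
Proof.
have := @I_norm_ge_src f x [:: x] isT; rewrite big_seq1; apply => m.
by rewrite inE => /eqP->.
Qed.

End INorm.

Section Evaluation.
Variables (R : realType) (G : topGroupoid) (hG : hausdorff_space G) (etG : etale G).
Variables (s : G * G -> R[i]) (cs : Z2 R G s).
Variables (A : banachStarAlg R) (iota : (G -> R[i]) -> A) (hA : is_ell1 s iota).
Implicit Types f g : G -> R[i].

Lemma ell1D f g : Cc f -> Cc g -> iota (f + g) = iota f + iota g.
Proof. by move=> Cf Cg; case: hA => -[h _ _ _] _ _; exact: h. Qed.

Lemma ell1Z (c : R[i]) f : Cc f -> iota (c *: f) = c *: iota f.
Proof. by move=> Cf; case: hA => -[_ h _ _] _ _; exact: h. Qed.

Lemma ell1M f g : Cc f -> Cc g -> iota (Defs.conv s f g) = bmul (iota f) (iota g).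
Proof. by move=> Cf Cg; case: hA => -[_ _ h _] _ _; exact: h. Qed.

Lemma ell1S f : Cc f -> iota (invol s f) = bstar (iota f).
Proof. by move=> Cf; case: hA => -[_ _ _ h] _ _; exact: h. Qed.

Lemma ell1_norm f : Cc f -> (rnorm (iota f))%:E = I_norm f.
Proof. by move=> Cf; case: hA => _ h _; exact: h. Qed.

Lemma ell1B f g : Cc f -> Cc g -> iota (f - g) = iota f - iota g.
Proof.
move=> Cf Cg; rewrite -scaleN1r ell1D//; last exact: (CcZ hG).
by rewrite ell1Z// scaleN1r.
Qed.

Lemma ell1_dense (a : A) (e : R) : 0 < e -> exists2 f, Cc f & rnorm (a - iota f) <= e.
Proof.
move=> e0; case: hA => _ _ d; have [_ [f Cf <-] af] := rnorm_dense a d e0.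
by exists f.
Qed.

(** A value at an arrow is bounded by the I-norm, so evaluation extends to the completion and its
    elements acquire values at all arrows. *)
Lemma ell1_eval_ex (x : G) : exists ev : A -> R[i], forall a f, Cc f ->
  rnorm (ev a - f x) <= rnorm (a - iota f).
Proof.
case: hA => _ _ d.
have [|ev evP] := bounded_extension (f := fun f : G -> R[i] => f x) (@complex_seq_complete R) ler01 d.
  move=> f g Cf Cg; rewrite mul1r -lee_fin -ell1B// ell1_norm; last exact: (CcB hG).
  by have := I_norm_ge (f - g) x.
by exists ev => a f Cf; have := evP a f Cf; rewrite mul1r.
Qed.

Definition ell1_eval (x : G) : A -> R[i] := projT1 (cid (ell1_eval_ex x)).

Lemma ell1_evalP x a f : Cc f -> rnorm (ell1_eval x a - f x) <= rnorm (a - iota f).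
Proof. by move=> Cf; rewrite /ell1_eval; case: cid => ev evP /=; exact: evP. Qed.

Lemma ell1_eval_iota x f : Cc f -> ell1_eval x (iota f) = f x.
Proof.
move=> Cf; apply: (rnorm_small_eq 0) => // e _.
by rewrite mul0r; have := ell1_evalP x (iota f) Cf; rewrite subrr rnorm0.
Qed.

Lemma ell1_eval_linear x : linear (ell1_eval x).
Proof.
have [_ _ d] := hA; apply: (extension_linear ler01 d) => [c f g Cf Cg|a f Cf]; last first.
  by rewrite mul1r; exact: ell1_evalP.
by rewrite ell1D ?ell1Z//; [split => //; apply: (CcD hG) => //|]; exact: (CcZ hG).
Qed.

Lemma ell1_eval_le x a : rnorm (ell1_eval x a) <= rnorm a.
Proof.
have C0 : Cc (0 : G -> R[i]).
  have [f Cf _] := ell1_dense 0 ltr01.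
  by rewrite -(scale0r f); exact: (CcZ hG).
have := ell1_evalP x a C0; have -> : iota 0 = 0.
  by rewrite -(scale0r 0) ell1Z// scale0r.
by rewrite !subr0.
Qed.

Lemma sum_sq_seq f (x : G) : Cc f -> exists r : seq G,
  [/\ uniq r, forall m, m \in r -> src m = x, forall m, src m = x -> f m <> 0 -> m \in r &
    \sum_(m \in src_fibre x) (f m)^* * f m = (\sum_(m <- r) rnorm (f m) ^+ 2)%:C%C].
Proof.
move=> Cf; have [K [cK _ fK]] := Cc_support Cf.
have /finite_seqP[r0 rE] := compact_fibre_finite etG x hG cK.
have rP m : m \in undup r0 <-> K m /\ src m = x.
  by rewrite mem_undup -[_ /\ _]/((K `&` src_fibre x) m) rE /=; split.
have rf m : src m = x -> f m <> 0 -> m \in undup r0.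
  by move=> mx /fK Km; apply/rP.
exists (undup r0); split => //; [exact: undup_uniq|by move=> m /rP[]|].
rewrite (@fsum_seq _ _ _ (undup r0)) ?undup_uniq//; first 1 last.
- by move=> m /rP[].
- by move=> m mx fm; apply: rf => // f0; move: fm; rewrite f0 mulr0 eqxx.
rewrite rmorph_sum; apply: eq_bigr => m _.
by rewrite mulrC -normCK normrE_rnorm -rmorphXn.
Qed.

Lemma ell1_eval_star x a : units G x -> ell1_eval x (bstar a) = (ell1_eval x a)^*.
Proof.
move=> ux; apply: (rnorm_small_eq 2) => // e e0.
have [f Cf af] := ell1_dense a e0; have Cf' := Cc_invol hG cs Cf.
have := ell1_evalP x (bstar a) Cf'; have := ell1_evalP x a Cf.
rewrite ell1S// -bstarB rnorm_bstar (invol_unit cs)// => h1 h2.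
rewrite -(subrKA (f x)^*); apply: le_trans (rnormD _ _) _.
have h3 : rnorm ((f x)^* - (ell1_eval x a)^*) = rnorm (ell1_eval x a - f x).
  by rewrite -rmorphB rnormJ rnormB.
rewrite h3; lra.
Qed.

(** For [a] from [Cc] the right side is the sum of [rnorm (a n) ^+ 2] over the fibre of [src m], and
    the left side is one of its terms; the general case is by approximation. *)
Lemma ell1_eval_sq (m : G) a :
  rnorm (ell1_eval m a) ^+ 2 <= complex.Re (ell1_eval (src m) (bmul (bstar a) a)).
Proof.
apply/ler_addgt0Pr => e e0; have a0 := rnorm_ge0 a.
have [d d0 [d1 de]] := small_affine a0 e0.
have [f Cf af] := ell1_dense a d0; have Cf' := Cc_invol hG cs Cf.
have Cff := Cc_conv hG etG cs Cf' Cf.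
have h1 := ell1_evalP (src m) (bmul (bstar a) a) Cff.
rewrite ell1M// ell1S// (conv_invol_unit cs) in h1; last exact: src_units.
have h2 := rnorm_bmulB (bstar a) a (bstar (iota f)) (iota f).
rewrite -bstarB !rnorm_bstar in h2.
have [r [ur rm rf rE]] := sum_sq_seq (src m) Cf; rewrite rE in h1.
have h3 : rnorm (f m) ^+ 2 <= \sum_(m <- r) rnorm (f m) ^+ 2.
  have [fm0|fm0] := pselect (f m = 0).
    by rewrite fm0 rnorm0 expr0n; apply: sumr_ge0 => n _; rewrite exprn_ge0 ?rnorm_ge0.
  rewrite (bigD1_seq m) ?rf//= lerDl; apply: sumr_ge0 => n _.
  by rewrite exprn_ge0 ?rnorm_ge0.
have h4 : rnorm (ell1_eval m a) <= rnorm (f m) + d.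
  have := ell1_evalP m a Cf; have := rnormD (ell1_eval m a - f m) (f m); rewrite subrK; lra.
have h5 : rnorm (f m) <= rnorm a + d.
  have := ell1_evalP m a Cf; have := rnormD (f m - ell1_eval m a) (ell1_eval m a).
  rewrite subrK [rnorm (f m - _)]rnormB; have := ell1_eval_le m a; lra.
have h6 : rnorm (iota f) <= rnorm a + d.
  have := rnormD (iota f - a) a; rewrite subrK [rnorm (iota f - a)]rnormB; lra.
have f0 := rnorm_ge0 (f m).
have h7 : rnorm (ell1_eval m a) ^+ 2 <= rnorm (f m) ^+ 2 + (d * rnorm (f m) + d * rnorm (f m)) + d * d.
  have : rnorm (ell1_eval m a) ^+ 2 <= (rnorm (f m) + d) ^+ 2 by rewrite lerXn2r ?nnegrE ?rnorm_ge0//; lra.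
  by have -> : (rnorm (f m) + d) ^+ 2 = rnorm (f m) ^+ 2 + (d * rnorm (f m) + d * rnorm (f m)) + d * d by ring.
have E : d * rnorm a + d = d * (rnorm a + 1) by ring.
have h8 : d * rnorm (f m) <= d * rnorm a + d by rewrite E ler_wpM2l//; lra.
have h9 : d * d <= d by rewrite -[leRHS]mulr1 ler_wpM2l// ltW.
have h10 : rnorm (a - iota f) * rnorm a <= d * rnorm a by rewrite ler_wpM2r.
have h11 : rnorm (iota f) * rnorm (a - iota f) <= d * rnorm a + d.
  by rewrite E mulrC; apply: ler_pM; rewrite ?rnorm_ge0//; lra.
have := le_trans (cRe_le_rnorm _) h1; rewrite cReD cReN /= ler_norml => /andP[].
move: (\sum_(m <- r) rnorm (f m) ^+ 2) h3 {h1 rE} => S h3; lra.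
Qed.

Lemma ell1_eval_positive x : units G x -> positive_functional (ell1_eval x).
Proof.
move=> ux; split => [a b|c a|a|a].
- by have [_ ->] := GRing.semilinear_linear (ell1_eval_linear x).
- by have [-> _] := GRing.semilinear_linear (ell1_eval_linear x).
- exact: ell1_eval_star.
- set z := ell1_eval x _.
  have zc : z = z^* by rewrite /z -ell1_eval_star// bstarM bstarK.
  rewrite lecE; apply/andP; split.
    by move: zc; rewrite /Num.conj /=; case: z => u v /= [vv]; apply/eqP; lra.
  have := ell1_eval_sq x a; rewrite (units_src ux); apply: le_trans.
  by rewrite exprn_ge0 ?rnorm_ge0.
Qed.

Lemma ell1_eval_Re_le x a : complex.Re (ell1_eval x a) <= rnorm a.
Proof.
by apply: le_trans (ler_norm _) _; apply: le_trans (cRe_le_rnorm _) _; exact: ell1_eval_le.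
Qed.

(** The I-norm of an approximant [f] is a supremum of sums over finite lists [r]. For each [r] a
    second approximant [g], with accuracy [d] adapted to the length of [r], has sum at most [e] over
    [r], while [f - g] has I-norm at most [e + d <= 2 e]. So [iota f] has norm at most [3 e] and [a]
    at most [4 e]. *)
Lemma ell1_eval_faithful a : (forall x, ell1_eval x a = 0) -> a = 0.
Proof.
move=> ev0; apply: (rnorm_small_eq 4) => // e e0; rewrite subr0.
have [f Cf af] := ell1_dense a e0.
have bound (r : seq G) : (forall g, Cc g -> (\sum_(m <- r) rnorm ((f - g)%R m))%:E <= I_norm (f - g)%R)%E ->
    ((\sum_(m <- r) rnorm (f m))%:E <= (3 * e)%:E)%E.
  move=> hr; pose k : R := (size r)%:R; have k0 : 0 <= k by rewrite ler0n.
  have [d [d0 d1 dk]] : exists d : R, [/\ 0 < d, d <= e & k * d <= e].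
    have k1 : 0 < k + 1 by lra.
    exists (e / (k + 1)); split; first by rewrite divr_gt0.
      by rewrite ler_pdivrMr// ler_peMr ?lerDr// ltW.
    by rewrite mulrA ler_pdivrMr// mulrC ler_wpM2l ?lerDl//; exact: ltW.
  have [g Cg ag] := ell1_dense a d0.
  have := hr g Cg; rewrite -ell1_norm; last exact: (CcB hG).
  rewrite ell1B// !lee_fin => h1.
  have h2 : \sum_(m <- r) rnorm (g m) <= k * d.
    apply: (@le_trans _ _ (\sum_(m <- r) d)).
      apply: ler_sum => m _; have := ell1_evalP m a Cg; rewrite ev0 sub0r rnormN; lra.
    by rewrite big_const_seq count_predT iter_addr_0 -mulr_natl.
  have h3 : \sum_(m <- r) rnorm (f m) <= \sum_(m <- r) (rnorm ((f - g) m) + rnorm (g m)).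
    apply: ler_sum => m _; have -> : (f - g) m = f m - g m by [].
    by have := rnormD (f m - g m) (g m); rewrite subrK.
  rewrite big_split /= in h3.
  have := rnormD (iota f - a) (a - iota g); rewrite subrKA [rnorm (iota f - a)]rnormB.
  lra.
have : rnorm (iota f) <= 3 * e.
  rewrite -lee_fin ell1_norm//; apply: I_norm_le.
  - by rewrite lee_fin; lra.
  - by move=> r x ur rx; apply: bound => g Cg; exact: (I_norm_ge_src _ ur rx).
  - by move=> r x ur rx; apply: bound => g Cg; exact: (I_norm_ge_rng _ ur rx).
have := rnormD (a - iota f) (iota f); rewrite subrK; lra.
Qed.

(** With no cyclic vector at hand, [pi c] is tested at [e d] for [d = c* c]. Paired with [e c], the
    result is the value of [d* d] at [src x], nonzero by two uses of [ell1_eval_sq]. *)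
Theorem ell1_reduced : reduced A.
Proof.
move=> a b ab; pose c := a - b.
have [x evx] : exists x, ell1_eval x c <> 0.
  apply: contrapT => no; apply: ab; apply/eqP; rewrite -subr_eq0; apply/eqP.
  by apply: ell1_eval_faithful => x; apply: contrapT => h; apply: no; exists x.
have rpos (z : R[i]) : z <> 0 -> 0 < rnorm z ^+ 2.
  move=> z0; rewrite exprn_gt0// lt_def rnorm_ge0 andbT; apply/eqP.
  by move=> /rnorm_eq0.
pose d := bmul (bstar c) c; have ux := src_units x.
have evd : ell1_eval (src x) d <> 0.
  move=> h; have := lt_le_trans (rpos _ evx) (ell1_eval_sq x c).
  by rewrite -/d h ltxx.
have [H [pi [e [rp pie eD edot]]]] := gns (ell1_eval_positive ux) (ell1_eval_Re_le (src x)).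
exists H, pi; split => //; exists (pi (bstar c) (e c)) => pab.
have [pc pD pZ pM pS] := rp.
have pcy : pi c (pi (bstar c) (e c)) = 0.
  move: (pi (bstar c) (e c)) pab => y pab.
  have -> : c = a + (-1) *: b by rewrite scaleN1r.
  by rewrite pD// pZ// pab scaleN1r subrr.
have := pS c I (pi (bstar c) (e c)) (e c); rewrite pcy pie edot -/d.
rewrite (_ : hdot 0 _ = 0); last by rewrite -(scale0r (0 : H)) hdotZl mul0r.
move=> /esym h; have := lt_le_trans (rpos _ evd) (ell1_eval_sq (src x) d).
by rewrite src_src h ltxx.
Qed.

End Evaluation.

(** * Density of the units with isotropy in the interior *)

Section LocallyCompact.
Variables (R : realType) (T : topologicalType).
Hypotheses (lcT : locally_compact [set: T]) (hT : hausdorff_space T).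

Lemma urysohn_bump (x : T) (U : set T) : open U -> U x ->
  exists (f : T -> R) (K : set T), [/\ continuous f, f x = 1, forall y, 0 <= f y <= 1,
    compact K /\ K `<=` U & forall y, f y <> 0 -> K y].
Proof.
move=> oU Ux.
have [C] := @lcT x I; rewrite withinET => nCx [cC clC].
pose B := ~` (C° `&` U).
have clB : closed B by apply: open_closedC; apply: openI => //; exact: open_interior.
have nBx : ~ B x by apply; split.
have [f [cf f01 f0 f1]] := (@uniform_separatorP T R [set x] B).1
  (@locally_compact_completely_regular T R lcT hT x B clB nBx).
have fx : f x = 0 by have : [set 0] (f x) by [apply: f0; exists x].
have f_ge0 y : 0 <= f y by have [] : (0 <= f y /\ f y <= 1) by [have := f01 (f y) (ex_intro2 _ _ y I erefl); rewrite /= in_itv /= => /andP[]].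
(* Where [g] is nonzero, [f <= 2^-1]. This closed condition excludes the points of [B], where [f] is
   [1], so the support stays inside [C] and [U]. *)
pose g y := Num.max 0 (1 - 2 * f y).
pose K := C `&` (f @^-1` [set t | t <= 2^-1]).
exists g, K; split.
- move=> y; apply: (@continuous_comp _ _ _ f (fun t => Num.max 0 (1 - 2 * t))); first exact: cf.
  apply: continuous_max; first exact: cvg_cst.
  by apply: cvgB; [exact: cvg_cst|apply: cvgM; [exact: cvg_cst|exact: cvg_id]].
- by rewrite /g fx mulr0 subr0; apply/max_idPr.
- move=> y; rewrite /g le_max lexx /= ge_max ler01 /=.
  by have := f_ge0 y; lra.
- split.
    apply: (@subclosed_compact _ _ C) => //; last by move=> y [].
    by apply: closedI => //; apply: closed_comp; [move=> y _; exact: cf|exact: closed_le].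
  move=> y [Cy /= fy]; apply: contrapT => nU.
  have : [set 1] (f y) by apply: f1; exists y => // -[].
  by move=> /= e; move: fy; rewrite e; lra.
- move=> y gy; have fy : f y <= 2^-1.
    rewrite leNgt; apply/negP => h; apply: gy; rewrite /g; apply/max_idPl; lra.
  split => //; apply: contrapT => nC'.
  have : [set 1] (f y) by apply: f1; exists y => // -[/interior_subset].
  by move=> /= e; move: fy; rewrite e; lra.
Qed.

Lemma compact_nbhd_in (x : T) (U : set T) : open U -> U x ->
  exists V K : set T, [/\ open V, V x, compact K, V `<=` K & K `<=` U].
Proof.
move=> oU Ux; have [f [K [cf fx f01 [cK KU] fK]]] := urysohn_bump oU Ux.
exists (f @^-1` [set t | t != 0]), K; split => //.
- by apply: open_comp; [move=> y _; exact: cf|exact: open_neq].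
- by rewrite /= fx oner_eq0.
- by move=> y /= /eqP; exact: fK.
Qed.

(** Baire's theorem, with nowhere density spelled out in the hypothesis. Compact sets [K n] avoiding
    [F n] are nested with nonempty open sets in between, and a cluster point of the filter they
    generate lies in all of them. *)
Lemma locally_compact_baire (F : nat -> set T) :
  (forall n (O : set T), open O -> O !=set0 ->
     exists Q : set T, [/\ open Q, Q !=set0, Q `<=` O & Q `&` F n = set0]) ->
  forall O : set T, open O -> O !=set0 -> exists2 x, O x & forall n, ~ F n x.
Proof.
move=> nF O oO O0.
have step (p : nat * set T) : exists q : set T * set T, open p.2 -> p.2 !=set0 ->
    [/\ open q.1, q.1 !=set0, compact q.2, q.1 `<=` q.2 &
        q.2 `<=` p.2 /\ q.2 `&` F p.1 = set0].
  case: p => n V /=; have [[oV V0]|no] := pselect (open V /\ V !=set0); last first.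
    by exists (set0, set0) => oV V0; exfalso; apply: no.
  have [Q [oQ [x Qx] QV QF]] := nF n V oV V0.
  have [W [K [oW Wx cK WK KQ]]] := compact_nbhd_in oQ Qx.
  exists (W, K) => _ _ /=; split => //; first by exists x.
  split; first exact: subset_trans KQ QV.
  by apply/seteqP; split => // y [/KQ Qy Fy]; rewrite -QF.
have [q qP] := choice step.
pose V := fix V n := if n is n'.+1 then (q (n', V n')).1 else O.
pose K n := (q (n, V n)).2.
have VP n : open (V n) /\ V n !=set0.
  elim: n => [|n [oV V0]] //=.
  by have [] := qP (n, V n) oV V0.
have KP n : [/\ compact (K n), V n.+1 `<=` K n, K n `<=` V n & K n `&` F n = set0].
  by have [oV V0] := VP n; have [? ? ? ? []] := qP (n, V n) oV V0.
have Kdec n m : (n <= m)%N -> K m `<=` K n.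
  elim: m => [|m IH]; first by rewrite leqn0 => /eqP->.
  rewrite leq_eqVlt => /predU1P[->//|nm]; have [_ VK _ _] := KP m; have [_ _ KV _] := KP m.+1.
  exact: subset_trans KV (subset_trans VK (IH nm)).
have K0 n : K n !=set0.
  have [_ [x Vx]] := VP n.+1; exists x; have [_ VK _ _] := KP n; exact: VK.
pose FF := [set B : set T | exists n, K n `<=` B].
have FFP : ProperFilter FF.
  split; first by move=> [n h]; have [x Kx] := K0 n; exact: (h x Kx).
  split; first by exists 0.
  - move=> A B [n nA] [m mB]; exists (maxn n m) => x Kx; split.
      by apply: nA; exact: (Kdec _ _ (leq_maxl n m)).
    by apply: mB; exact: (Kdec _ _ (leq_maxr n m)).
  - by move=> A B AB [n nA]; exists n; exact: subset_trans nA AB.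
have [cK0 _ _ _] := KP 0.
have FK0 : FF (K 0) by exists 0.
have [p [K0p pc]] := cK0 FF FFP FK0.
have Kp n : K n p.
  have [cK _ _ _] := KP n.
  have : closed (K n) by exact: compact_closed.
  apply => U nU; apply: pc => //; by exists n.
exists p; first by have [_ _ KV _] := KP 0; exact: KV.
by move=> n Fp; have [_ _ _ KF] := KP n; have : (K n `&` F n) p by []; rewrite KF.
Qed.

End LocallyCompact.

Section EffectiveUnits.
Variables (G : topGroupoid) (hG : hausdorff_space G) (etG : etale G).
Hypotheses (secG : @second_countable G) (lcG : locally_compact [set: G]).

Lemma open_src (W : set G) : open W -> open (src @` W).
Proof.
move=> oW; rewrite openE => _ [m Wm <-].
have [U [V [k [oU Um [oV _] UV [kU kV kc]]]]] := src_section etG m.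
have Vm := UV _ Um; have nV : nbhs (src m) V by exact: open_nbhs_nbhs.
have nW : nbhs (src m) (k @^-1` W).
  by apply: kc => //; rewrite kU//; exact: open_nbhs_nbhs.
by apply: filterS (filterI nV nW) => x [Vx Wx]; exists (k x) => //; have [_] := kV x Vx.
Qed.

Definition good_unit (x : G) : Prop := units G x /\
  forall m, rng m = x -> src m = x -> iso_set G m.

(* A unit that is not good lies in the set [F n] of a basic bisection [b], and these
   sets are nowhere dense: the sources of the non-isotropic arrows of [b] form an
   open set disjoint from [F n]. *)
Lemma good_units_dense (R : realType) (O : set G) (x : G) : open O -> O x -> units G x ->
  exists2 y, O y & good_unit y.
Proof.
move=> oO Ox ux.
have [B cB [Bo Bb]] := secG.
(* A numbering of the countable basis, which arranges the bad sets in a sequence. *)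
have [g ginj] : exists g : set G -> nat, {in B &, injective g}.
  by have /pcard_injP[g] := cB; exists g.
pose bad (b : set G) : set G := [set y | {in b &, injective (@src G)} /\
  exists m, [/\ b m, rng m = y, src m = y & ~ iso_set G m]].
pose F n := [set y | exists2 b, B b /\ g b = n & bad b y].
have nF n (O1 : set G) : open O1 -> O1 !=set0 ->
   exists Q : set G, [/\ open Q, Q !=set0, Q `<=` O1 & Q `&` F n = set0].
  move=> oO1 O10.
  have [no|] := pselect (O1 `&` F n = set0); first by exists O1; split.
  move=> /eqP/set0P[y0 [y0O1 [b [Bb0 gb] [binj [m0 [bm0 rm0 sm0 nm0]]]]]].
  have ob := Bo _ Bb0.
  pose W := b `&` src @^-1` O1.
  have oW : open W.
    by apply: openI => //; apply: open_comp => // z _; exact: src_continuous.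
  have Wm0 : W m0 by split => //=; rewrite sm0.
  have [m1 Wm1 rs1] : exists2 m, W m & rng m <> src m.
    apply: contrapT => no; apply: nm0; apply: filterS (open_nbhs_nbhs (conj oW Wm0)) => m Wm.
    by apply: contrapT => rs; apply: no; exists m.
  have := near_neq hG (@rng_continuous G m1) (@src_continuous G m1) rs1.
  move=> /(filterI (open_nbhs_nbhs (conj oW Wm1))); rewrite nbhsE => -[W1 [oW1 W1m1] W1W].
  exists (src @` W1); split.
  - exact: open_src.
  - by exists (src m1), m1.
  - by move=> _ [m W1m <-]; have [[_ Wm] _] := W1W _ W1m.
  - apply/seteqP; split => // _ [[m2 W1m2 <-] [b' [Bb' gb'] [_ [m3 [bm3 rm3 sm3 _]]]]].
    have bb : b' = b by apply: ginj; rewrite ?inE// gb gb'.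
    have [[bm2 _] /= rs2] := W1W _ W1m2.
    have m23 : m3 = m2 by apply: binj; rewrite ?inE// -bb.
    by move: rs2; rewrite -m23 rm3 -m23 eqxx.
have oOu : open (O `&` units G) by apply: openI => //; exact: open_units.
have Ou0 : O `&` units G !=set0 by exists x.
have [y [yO uy] yF] := locally_compact_baire R lcG hG nF oOu Ou0.
exists y => //; split => // m rm sm; apply: contrapT => nm.
have [U [V [k [oU Um _ UV [kU _ _]]]]] := src_section etG m.
have nU : nbhs m U by exact: open_nbhs_nbhs.
have [b [Bb1 bm] bU] := Bb m U nU.
apply: (yF (g b)); exists b => //; split.
  move=> u v; rewrite !inE => bu bv uv.
  by rewrite -(kU u (bU _ bu)) -(kU v (bU _ bv)) uv.
by exists m.
Qed.

End EffectiveUnits.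

(** * Extension by zero from the interior of the isotropy *)

Section ExtensionByZero.
Variables (R : realType) (G : topGroupoid) (hG : hausdorff_space G) (etG : etale G).
Variables (s : G * G -> R[i]) (cs : Z2 R G s).
Local Notation I := (iso_interior etG).
Local Notation sI := (iso_cocycle (etG := etG) s).
Implicit Types f g : I -> R[i].

Definition to_iso (x : G) : option I := insub x.

Definition ext0 f : G -> R[i] := fun x => oapp f 0 (to_iso x).

Lemma iso_val (a : I) : iso_set G (val a).
Proof. exact: set_valP. Qed.

Lemma ext0_val f (a : I) : ext0 f (val a) = f a.
Proof. by rewrite /ext0 /to_iso valK. Qed.

Lemma iso_ex (x : G) : iso_set G x -> exists a : I, val a = x.
Proof. by move=> h; exists (exist _ x (mem_set h)). Qed.

Lemma ext0_out f (x : G) : ~ iso_set G x -> ext0 f x = 0.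
Proof. by move=> h; rewrite /ext0 /to_iso insubN//; apply/negP => /set_mem. Qed.

Lemma ext0_neq0 f (x : G) : ext0 f x <> 0 -> iso_set G x.
Proof. by move=> h; apply: contrapT => /(ext0_out f). Qed.

Lemma ext0P f (F : G -> R[i]) : (forall a : I, F (val a) = f a) ->
  (forall x, ~ iso_set G x -> F x = 0) -> ext0 f = F.
Proof.
move=> Fv F0; apply/funext => x; have [/iso_ex[a <-]|h] := pselect (iso_set G x).
  by rewrite ext0_val Fv.
by rewrite ext0_out// F0.
Qed.

Lemma ext0D f g : ext0 (f + g) = ext0 f + ext0 g.
Proof.
apply: ext0P => [a|x h]; rewrite -[(ext0 f + ext0 g) _]/(ext0 f _ + ext0 g _).
  by rewrite !ext0_val.
by rewrite !ext0_out// addr0.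
Qed.

Lemma ext0Z (c : R[i]) f : ext0 (c *: f) = c *: ext0 f.
Proof.
apply: ext0P => [a|x h]; rewrite -[(c *: ext0 f) _]/(c * ext0 f _).
  by rewrite !ext0_val.
by rewrite !ext0_out// mulr0.
Qed.

Lemma open_iso : open (iso_set G). Proof. exact: open_interior. Qed.

Lemma val_cont : continuous (val : I -> G).
Proof. exact: val_continuous. Qed.

Lemma hausdorff_iso : hausdorff_space I.
Proof.
move=> a b ab; apply/val_inj/hG => A B nA nB.
have [c [Ac Bc]] := ab _ _ (@val_cont a _ nA) (@val_cont b _ nB).
by exists (val c).
Qed.

Lemma nbhs_iso (a : I) (A : set I) : nbhs a A ->
  exists B : set G, [/\ nbhs (val a) B & forall b : I, B (val b) -> A b].
Proof.
move=> [_ [[B oB <-] Ba] BA]; exists B; split; first exact: open_nbhs_nbhs.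
by move=> b Bb; exact: BA.
Qed.

Lemma compact_iso (K : set G) : compact K -> K `<=` iso_set G ->
  compact [set a : I | K (val a)].
Proof.
move=> cK KI F FF FK.
have FK' : ((val : I -> G) @ F) K by [].
have [p [Kp pc]] := cK _ (fmap_proper_filter (val : I -> G) FF) FK'.
have [a ap] := iso_ex (KI _ Kp); exists a; split; first by rewrite /= ap.
move=> A B FA /nbhs_iso[C [nC CB]].
rewrite ap in nC.
have FvA : F (val @^-1` ((val : I -> G) @` A)) by apply: filterS FA => c Ac; exists c.
have [_ [[b Ab <-] Cb]] := pc _ _ FvA nC.
by exists b; split => //; exact: CB.
Qed.

(** Continuity on [iso_set] holds because it is open; elsewhere the function vanishes near the
    point, since the image of the support is compact, hence closed, and inside [iso_set]. *)
Lemma Cc_ext0 f : Cc f -> Cc (ext0 f).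
Proof.
move=> Cf; have [K [cK _ fK]] := Cc_support Cf.
pose L : set G := val @` K.
have cL : compact L by apply: continuous_compact => //; apply: continuous_subspaceT; exact: val_cont.
have fL x : ext0 f x <> 0 -> L x.
  by move=> h; have [a ax] := iso_ex (ext0_neq0 h); move: h; rewrite -ax ext0_val => /fK Ka; exists a.
apply: (Cc_intro hG _ cL fL) => x V; have [/iso_ex[a <-]|h] := pselect (iso_set G x).
  rewrite ext0_val => /(Cf.1 a)/nbhs_iso[B [nB BV]].
  have nI : nbhs (val a) (iso_set G) by apply: open_nbhs_nbhs; split; [exact: open_iso|exact: iso_val].
  apply: filterS (filterI nB nI) => y [By /iso_ex[b yb]] /=.
  by rewrite -yb ext0_val; apply: BV; rewrite yb.
have nL : ~ L x by move=> [a _ ax]; apply: h; rewrite -ax; exact: iso_val.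
rewrite ext0_out// => nV.
have nL' : nbhs x (~` L).
  by apply: open_nbhs_nbhs; split => //; apply: closed_openC; exact: compact_closed.
apply: filterS nL' => y Ly /=; have -> : ext0 f y = 0 by apply: contrapT => /fL.
exact: nbhs_singleton nV.
Qed.

Lemma Cc_restrict (F : G -> R[i]) (K : set G) : continuous F -> compact K -> K `<=` iso_set G ->
  (forall x, F x <> 0 -> K x) -> Cc (F \o val : I -> R[i]) /\ ext0 (F \o val) = F.
Proof.
move=> cF cK KI FK; split.
  apply: (Cc_intro hausdorff_iso _ (compact_iso cK KI)) => [a|a /FK//].
  by apply: continuous_comp; [exact: val_cont|exact: cF].
by apply: ext0P => // x h; apply: contrapT => /FK/KI.
Qed.

Lemma ext0_conv f g : ext0 (Defs.conv sI f g) = Defs.conv s (ext0 f) (ext0 g).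
Proof.
apply: ext0P => [a|x h]; last first.
  apply: contrapT => /conv_neq0[m [mx fx gm]]; apply: h.
  rewrite -(gmulKV mx); apply: iso_interior_mul => //; [exact: ext0_neq0 fx|exact: ext0_neq0 gm|].
  by rewrite src_mul ?src_inv// rng_inv mx.
rewrite /Defs.conv.
pose F (m : G) := ext0 f (gmul (val a) (ginv m)) * ext0 g m * s (gmul (val a) (ginv m), m).
transitivity (\sum_(m \in val @` (src_fibre (src a) : set I)) F m).
  apply: esym; apply: fsbig_widen.
    move=> _ [b bx <-]; have h : src b = src a := bx.
    exact: (congr1 (val : I -> G) h).
  move=> m [mx nm] /=; rewrite /F [ext0 g m](_ : _ = 0) ?mulr0 ?mul0r//.
  apply: ext0_out => /iso_ex[b bm]; apply: nm; exists b => //.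
  by rewrite /src_fibre /=; apply: val_inj; rewrite /= bm mx.
rewrite fsbig_image; last by move=> b c _ _; exact: val_inj.
apply: eq_fsbigr => b; rewrite inE /src_fibre /= => bx.
have bx' : src (val b) = src (val a) by move: bx => /(congr1 val).
have E : gmul (val a) (ginv (val b)) = val (gmul a (ginv b)).
  by rewrite /= val_iso_mul//= rng_inv bx'.
by rewrite /F E !ext0_val.
Qed.

Lemma ext0_invol f : ext0 (invol sI f) = invol s (ext0 f).
Proof.
apply: ext0P => [a|x h].
  by rewrite /invol -[ginv (val a)]/(val (ginv a)) ext0_val.
rewrite /invol ext0_out ?conjC0 ?mulr0// => h'; apply: h.
by rewrite -(ginvK x); exact: iso_interior_inv.
Qed.

(** Deduced from the product in [G] through extension by zero, which spares proving that
    [iso_interior] is étale. *)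
Lemma Cc_conv_iso f g : Cc f -> Cc g -> Cc (Defs.conv sI f g).
Proof.
move=> Cf Cg.
have [K [cK _ fK]] := Cc_support Cf; have [L [cL _ gL]] := Cc_support Cg.
pose K' : set G := val @` K; pose L' : set G := val @` L.
have cK' : compact K' by apply: continuous_compact => //; apply: continuous_subspaceT; exact: val_cont.
have cL' : compact L' by apply: continuous_compact => //; apply: continuous_subspaceT; exact: val_cont.
have fK' x : ext0 f x <> 0 -> K' x.
  by move=> h; have [a ax] := iso_ex (ext0_neq0 h); move: h; rewrite -ax ext0_val => /fK Ka; exists a.
have gL' x : ext0 g x <> 0 -> L' x.
  by move=> h; have [a ax] := iso_ex (ext0_neq0 h); move: h; rewrite -ax ext0_val => /gL La; exists a.
have [|h _] := Cc_restrict (conv_continuous hG etG cs (Cc_ext0 Cf).1 (Cc_ext0 Cg))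
  (compact_mul hG cK' cL') _ (conv_support fK' gL').
  move=> _ [[x y] /= [[[a _ ax] [b _ bx]] xy] <-].
  by apply: iso_interior_mul => //; [rewrite -ax|rewrite -bx]; exact: iso_val.
have -> // : Defs.conv sI f g = Defs.conv s (ext0 f) (ext0 g) \o val.
by apply/funext => a /=; rewrite -ext0_conv ext0_val.
Qed.

Lemma Cc_invol_iso f : Cc f -> Cc (invol sI f).
Proof.
move=> Cf; have [K [cK _ fK]] := Cc_support Cf.
pose K' : set G := ginv @` (val @` K).
have cK' : compact K'.
  apply: continuous_compact; first by apply: continuous_subspaceT; exact: ginv_continuous.
  by apply: continuous_compact => //; apply: continuous_subspaceT; exact: val_cont.
have [||h _] := @Cc_restrict (invol s (ext0 f)) K' (Cc_invol hG cs (Cc_ext0 Cf)).1 cK'.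
- by move=> _ [_ [a _ <-] <-]; apply: iso_interior_inv => //; exact: iso_val.
- move=> x h; have h' : ext0 f (ginv x) <> 0.
    by move=> e; apply: h; rewrite /invol e conjC0 mulr0.
  have [a ax] := iso_ex (ext0_neq0 h'); move: h'; rewrite -ax ext0_val => /fK Ka.
  by exists (ginv x); [exists a|exact: ginvK].
have -> // : invol sI f = invol s (ext0 f) \o val.
by apply/funext => a /=; rewrite -ext0_invol ext0_val.
Qed.

Lemma I_norm_ge0 (H : topGroupoid) (h : H -> R[i]) : (0 <= I_norm h)%E.
Proof. by apply: ereal_sup_ubound; left. Qed.

Lemma I_norm_ext0 f : I_norm (ext0 f) = I_norm f.
Proof.
have sum_pmap (r : seq G) :
    \sum_(m <- r) rnorm (ext0 f m) = \sum_(a <- pmap to_iso r) rnorm (f a).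
  elim: r => [|m r IH]; first by rewrite !big_nil.
  rewrite big_cons IH /=; case E : (to_iso m) => [a|] /=.
    by rewrite big_cons /ext0 E.
  by rewrite /ext0 E /= rnorm0 add0r.
have pmapP (r : seq G) a : a \in pmap to_iso r -> val a \in r.
  rewrite mem_pmap => /mapP[m mr]; rewrite /to_iso; case: insubP => // b _ bm [->].
  by rewrite bm.
have upmap (r : seq G) : uniq r -> uniq (pmap to_iso r).
  by move=> ur; apply: pmap_sub_uniq.
apply/eqP; rewrite eq_le; apply/andP; split.
  apply: I_norm_le => [|r x ur rx|r x ur rx]; first exact: I_norm_ge0.
    (* An empty list offers no arrow of [I] to name the fibre, hence the case distinction. *)
    rewrite sum_pmap; case E : (pmap to_iso r) => [|a r'].
      by rewrite big_nil; exact: I_norm_ge0.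
    rewrite -E; apply: (@I_norm_ge_src _ _ f a); first exact: upmap.
    move=> b /pmapP/rx bx; apply: val_inj => /=; rewrite bx -(rx (val a))//.
    by apply: pmapP; rewrite E mem_head.
  rewrite sum_pmap; case E : (pmap to_iso r) => [|a r'].
    by rewrite big_nil; exact: I_norm_ge0.
  rewrite -E; apply: (@I_norm_ge_rng _ _ f a); first exact: upmap.
  move=> b /pmapP/rx bx; apply: val_inj => /=; rewrite bx -(rx (val a))//.
  by apply: pmapP; rewrite E mem_head.
have sumv (r : seq I) : \sum_(m <- r) rnorm (f m) = \sum_(m <- map val r) rnorm (ext0 f m).
  by rewrite big_map; apply: eq_bigr => a _; rewrite ext0_val.
apply: I_norm_le => [|r x ur rx|r x ur rx]; first exact: I_norm_ge0.
  rewrite sumv; apply: (@I_norm_ge_src _ _ _ (val x)).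
    by rewrite map_inj_uniq//; exact: val_inj.
  by move=> _ /mapP[a /rx /(congr1 val) ax ->].
rewrite sumv; apply: (@I_norm_ge_rng _ _ _ (val x)).
  by rewrite map_inj_uniq//; exact: val_inj.
by move=> _ /mapP[a /rx /(congr1 val) ax ->].
Qed.

Variables (A : banachStarAlg R) (iG : (G -> R[i]) -> A) (hA : is_ell1 s iG).
Variables (B : banachStarAlg R) (iI : (I -> R[i]) -> B) (hB : is_ell1 sI iI).

(** Both algebras are abstract completions, so the inclusion is built by extending [ext0]. Being
    isometric it is injective, which makes the restriction of a C*-norm definite again. *)
Theorem iso_embedding : exists emb : B -> A,
  [/\ star_hom (A := bsa_data B) emb, forall b, rnorm (emb b) = rnorm b &
      forall f, Cc f -> emb (iI f) = iG (ext0 f)].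
Proof.
have iso f : Cc f -> rnorm (iG (ext0 f)) = rnorm (iI f).
  move=> Cf; have Cf' := Cc_ext0 Cf; have := ell1_norm hA Cf'.
  by rewrite I_norm_ext0 -(ell1_norm hB Cf) => -[].
have ext0B f g : ext0 (f - g) = ext0 f - ext0 g.
  by rewrite -scaleN1r ext0D ext0Z scaleN1r.
have isoB f g : Cc f -> Cc g -> rnorm (iG (ext0 f) - iG (ext0 g)) = rnorm (iI f - iI g).
  move=> Cf Cg; rewrite -(ell1B hausdorff_iso hB)// -iso; last exact: (CcB hausdorff_iso).
  by rewrite ext0B (ell1B hG hA)//; exact: Cc_ext0.
have [_ _ dB] := hB.
have Ac : seq_complete A by move=> u uC; have [l lP] := rnorm_cauchy_cvg uC; exists l.
have [|emb embP] := bounded_extension (f := fun f => iG (ext0 f)) Ac ler01 dB.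
  by move=> f g Cf Cg; rewrite mul1r isoB.
have eP a f : Cc f -> rnorm (emb a - iG (ext0 f)) <= rnorm (a - iI f).
  by move=> Cf; have := embP a f Cf; rewrite mul1r.
have embI f : Cc f -> emb (iI f) = iG (ext0 f).
  move=> Cf; apply: (rnorm_small_eq 0) => // e _.
  by rewrite mul0r; have := eP (iI f) f Cf; rewrite subrr rnorm0.
have near2 a b (e : R) : 0 < e -> exists f g, [/\ Cc f, Cc g, rnorm (a - iI f) <= e & rnorm (b - iI g) <= e].
  by move=> e0; have [f Cf af] := ell1_dense hB a e0; have [g Cg bg] := ell1_dense hB b e0; exists f, g.
have embN b : rnorm (emb b) = rnorm b.
  apply/eqP; rewrite eq_le; apply/andP; split; apply/ler_addgt0Pr => e e0.
    have [|f Cf bf] := ell1_dense hB b (_ : 0 < e / 2); first lra.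
    have := rnormD (emb b - iG (ext0 f)) (iG (ext0 f)); rewrite subrK iso//.
    have := rnormD (iI f - b) b; rewrite subrK [rnorm (iI f - b)]rnormB.
    by have := eP b f Cf; lra.
  have [|f Cf bf] := ell1_dense hB b (_ : 0 < e / 2); first lra.
  have := rnormD (iG (ext0 f) - emb b) (emb b); rewrite subrK iso// [rnorm (_ - emb b)]rnormB.
  have := rnormD (b - iI f) (iI f); rewrite subrK.
  by have := eP b f Cf; lra.
have [embZ embD] : semilinear emb.
  apply/GRing.semilinear_linear/(extension_linear ler01 dB _ embP) => c f g Cf Cg.
  have Ccf := CcZ hausdorff_iso c Cf; rewrite ext0D ext0Z.
  rewrite (ell1D hA) ?(ell1Z hA) ?(ell1D hB) ?(ell1Z hB)//; try exact: Cc_ext0.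
    by split => //; exact: (CcD hausdorff_iso).
  by apply: (CcZ hG); exact: Cc_ext0.
exists emb; split => //; split => [a b _ _|c a _|a b _ _|a _].
- exact: embD.
- exact: embZ.
- have a0 := rnorm_ge0 a; have b0 := rnorm_ge0 b.
  apply: (rnorm_small_eq1 ((rnorm b + (rnorm a + 1)) + ((rnorm b + 1) + rnorm a))) => [|e e0 e1].
    by rewrite !addr_ge0.
  have [f [g [Cf Cg af bg]]] := near2 a b e e0.
  have Cfg := Cc_conv_iso Cf Cg.
  have h1 := eP (bmul a b) _ Cfg; rewrite ext0_conv (ell1M hA) ?(ell1M hB)// in h1; try exact: Cc_ext0.
  have h2 := rnorm_bmulB a b (iI f) (iI g).
  have h3 := rnorm_bmulB (iG (ext0 f)) (iG (ext0 g)) (emb a) (emb b).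
  rewrite !iso// embN in h3.
  have h4 := eP a f Cf; have h5 := eP b g Cg.
  rewrite [rnorm (iG _ - emb a)]rnormB [rnorm (iG _ - emb b)]rnormB in h3.
  have h6 := rnormD (iI f - a) a; rewrite subrK [rnorm (iI f - a)]rnormB in h6.
  have h7 := rnormD (iI g - b) b; rewrite subrK [rnorm (iI g - b)]rnormB in h7.
  rewrite -(subrKA (bmul (iG (ext0 f)) (iG (ext0 g)))).
  apply: le_trans (rnormD _ _) _; rewrite mulrDl; apply: lerD.
    apply: le_trans h1 _; apply: le_trans h2 _; rewrite mulrDl; apply: lerD.
      by rewrite mulrC ler_wpM2l.
    by apply: ler_pM; rewrite ?rnorm_ge0//; lra.
  apply: le_trans h3 _; rewrite mulrDl; apply: lerD.
    by rewrite mulrC; apply: ler_pM; rewrite ?rnorm_ge0//; lra.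
  by apply: ler_wpM2l => //; lra.
- apply: (rnorm_small_eq 2) => // e e0.
  have [f Cf af] := ell1_dense hB a e0; have Cf' := Cc_invol_iso Cf.
  have := eP (bstar a) _ Cf'; rewrite ext0_invol (ell1S hA) ?(ell1S hB)//; last exact: Cc_ext0.
  have := eP a f Cf; rewrite -bstarB rnorm_bstar => h1 h2.
  rewrite -(subrKA (bstar (iG (ext0 f)))); apply: le_trans (rnormD _ _) _.
  by rewrite -[X in _ + rnorm X]bstarB rnorm_bstar [rnorm (iG _ - _)]rnormB; lra.
Qed.

End ExtensionByZero.

(** * Bounding the regular representations *)

Section StateBound.
Variables (R : realType) (G : topGroupoid) (hG : hausdorff_space G) (etG : etale G).
Variables (lcG : locally_compact [set: G]).
Variables (s : G * G -> R[i]) (cs : Z2 R G s).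
Variables (A : banachStarAlg R) (iG : (G -> R[i]) -> A) (hA : is_ell1 s iG).
Local Notation I := (iso_interior etG).
Variables (B : banachStarAlg R) (iI : (I -> R[i]) -> B).
Hypothesis hB : is_ell1 (iso_cocycle (etG := etG) s) iI.
Variables (N : A -> R) (NC : cstar_norm N).
Hypothesis uI : cstar_unique B.
Implicit Types f g : G -> R[i].

Let NS : cstar_seminorm N := cstar_norm_seminorm NC.

Lemma Cc_bump (x : G) (U : set G) : open U -> U x ->
  exists (h : G -> R[i]) (K : set G), [/\ Cc h, h x = 1, forall y, rnorm (h y) <= 1,
    compact K /\ K `<=` U & forall y, h y <> 0 -> K y].
Proof.
move=> oU Ux; have [f [K [cf fx f01 [cK KU] fK]]] := urysohn_bump R lcG hG oU Ux.
pose h y : R[i] := (f y)%:C%C.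
have hK y : h y <> 0 -> K y.
  by move=> hy; apply: fK => fy; apply: hy; rewrite /h fy.
exists h, K; split => //; last 2 first.
- by rewrite /h fx.
- by move=> y; have /andP[f0 f1] := f01 y; rewrite /h rnorm_real ger0_norm.
apply: (Cc_intro hG _ cK hK) => y; apply/cvgrPdist_le => e /posC_ex[d d0 ->].
move/cvgrPdist_le: (cf y) => /(_ d d0); apply: filterS => z fyz.
by rewrite rnorm_le /h -rmorphB rnorm_real.
Qed.

Lemma sum_single_le f (r : seq G) (z : G) : uniq r -> (forall y, rnorm (f y) <= 1) ->
  (forall m, m \in r -> f m <> 0 -> m = z) -> \sum_(m <- r) rnorm (f m) <= 1.
Proof.
move=> ur f1 fz; have [zr|zr] := boolP (z \in r).
  rewrite (bigD1_seq z)//= big1_seq ?addr0// => m /andP[mz mr].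
  have -> : f m = 0 by apply: contrapT => /(fz m mr)/eqP; rewrite (negbTE mz).
  by rewrite rnorm0.
rewrite big1_seq ?ler01// => m /andP[_ mr].
have -> : f m = 0 by apply: contrapT => /(fz m mr) mz; move: zr; rewrite -mz mr.
by rewrite rnorm0.
Qed.

(** Each fibre contains just one unit, so every sum has at most one nonzero term. *)
Lemma I_norm_unit_le f : (forall y, rnorm (f y) <= 1) -> (forall m, f m <> 0 -> units G m) ->
  (I_norm f <= 1)%E.
Proof.
move=> f1 fu; apply: I_norm_le => // r x ur rx; rewrite lee_fin.
  apply: (@sum_single_le _ _ (src x)) => // m mr /fu um.
  by rewrite -(rx m mr) (units_src um).
apply: (@sum_single_le _ _ (rng x)) => // m mr /fu um.
by rewrite -(rx m mr) (units_rng um).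
Qed.

(** Otherwise arrows of [K] outside [iso_set], with range and source tending to [x], cluster at an
    arrow with range and source [x] that is still outside the open set [iso_set]. *)
Lemma good_unit_nbhd (x : G) (K : set G) : good_unit x -> compact K ->
  exists V : set G, [/\ open V, V x & forall m, K m -> V (rng m) -> V (src m) -> iso_set G m].
Proof.
move=> [ux gx] cK; apply: contrapT => no.
pose L := K `&` ~` iso_set G.
have cL : compact L.
  apply: (@subclosed_compact _ _ K) => //; last by move=> ? [].
  apply: closedI; first exact: compact_closed.
  by apply: open_closedC; exact: open_interior.
pose F := [set P : set G | exists2 V, nbhs x V & L `&` (rng @^-1` V `&` src @^-1` V) `<=` P].
have FF : ProperFilter F.
  split.
    move=> [V]; rewrite nbhsE => -[W [oW Wx] WV] h; apply: no; exists W; split => // m Km Wr Ws.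
    by apply: contrapT => nm; apply: (h m); split => //; split; exact: WV.
  split; first by exists setT => //; exact: filterT.
  - move=> P Q [V nV VP] [W nW WQ]; exists (V `&` W); first exact: filterI.
    by move=> m [Lm [[Vr Wr] [Vs Ws]]]; split; [exact: VP|exact: WQ].
  - by move=> P Q PQ [V nV VP]; exists V => //; exact: subset_trans VP PQ.
have FL : F L by exists setT; [exact: filterT|move=> m []].
have [p [[Kp np] pc]] := cL F FF FL; apply: np.
have rp : x = rng p.
  apply: hG => V W nV nW.
  have [m [[_ [/= Vr _]] Wr]] := pc _ (rng @^-1` W) (ex_intro2 _ _ V nV (fun m h => h)) (@rng_continuous G p _ nW).
  by exists (rng m).
have sp : x = src p.
  apply: hG => V W nV nW.
  have [m [[_ [/= _ Vs]] Ws]] := pc _ (src @^-1` W) (ex_intro2 _ _ V nV (fun m h => h)) (@src_continuous G p _ nW).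
  by exists (src m).
exact: gx.
Qed.

Lemma units_iso : units G `<=` iso_set G.
Proof. by move=> _ [m _ <-]; exact: iso_interior_rng. Qed.

(** A universal norm is bounded below by exhibiting one representation: the GNS representation of
    evaluation at [x] on the isotropy algebra. The image of [h] is a unit vector in it, and the
    diagonal coefficient of [h f h] there is [f x]. *)
Lemma eval_bound_Cc (x : G) f : good_unit x -> Cc f -> rnorm (f x) <= N (iG f).
Proof.
move=> gx Cf; have [ux _] := gx.
have [K [cK clK fK]] := Cc_support Cf.
have [V [oV Vx VK]] := good_unit_nbhd gx cK.
have oVu : open (V `&` units G) by apply: openI => //; exact: open_units.
have [h [Kh [Ch hx h1 [cKh KhV] hK]]] := Cc_bump oVu (conj Vx ux).
have hu m : h m <> 0 -> units G m by move=> /hK/KhV[].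
have clKh : closed Kh by exact: compact_closed.
(* As [h] lives on the units, [b] is [f] multiplied pointwise by [h (rng y)] and [h (src y)],
   without a cocycle factor. *)
pose fh := Defs.conv s f h; pose b := Defs.conv s h fh.
have Cfh : Cc fh := Cc_conv hG etG cs Cf Ch.
have Cb : Cc b := Cc_conv hG etG cs Ch Cfh.
have bE y : b y = h (rng y) * (f y * h (src y)).
  by rewrite /b (conv_unit_l cs)// /fh (conv_unit_r cs).
pose K' := K `&` (rng @^-1` Kh `&` src @^-1` Kh).
have cK' : compact K'.
  apply: (@subclosed_compact _ _ K) => //; last by move=> ? [].
  apply: closedI => //; apply: closedI; apply: closed_comp => // y _.
    exact: rng_continuous.
  exact: src_continuous.
have K'I : K' `<=` iso_set G.
  by move=> m [Km [/KhV[Vr _] /KhV[Vs _]]]; exact: VK.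
have bK' y : b y <> 0 -> K' y.
  rewrite bE => by0; split; first by apply: fK => fy; apply: by0; rewrite fy mul0r mulr0.
  split; first by apply: hK => hy; apply: by0; rewrite hy mul0r.
  by apply: hK => hy; apply: by0; rewrite hy !mulr0.
have [Cc0 ec] := Cc_restrict hG etG Cb.1 cK' K'I bK'.
have [Ch0 eh] := Cc_restrict hG etG Ch.1 cKh (subset_trans KhV (subset_trans (@subIsetr _ _ _) units_iso)) hK.
set c0 := b \o val in Cc0 ec; set h0 := h \o val in Ch0 eh.
have [emb [[eD eZ eM eS] eN eI]] := iso_embedding hG cs hA hB.
have [_ uN] := uI.
have NeC : cstar_norm (fun a : B => N (emb a)).
  have [ND NZ N0 NM NSt] := NC; split => [a a'|z a|a|a a'|a].
  - by rewrite eD.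
  - by rewrite eZ.
  - move=> /N0 ea; apply/rnorm_eq0; by rewrite -eN ea rnorm0.
  - by rewrite eM.
  - by rewrite eM// eS.
have Nh : N (iG h) <= 1.
  apply: le_trans (cstar_seminorm_contractive NS _) _.
  by rewrite -lee_fin (ell1_norm hA Ch); exact: I_norm_unit_le.
have [ND NZ N0 NM NSt] := NC.
have Nge0 a : 0 <= N a := cstar_seminorm_ge0 NS a.
have Nb : N (iG b) <= N (iG f).
  rewrite /b (ell1M hA Ch Cfh) /fh (ell1M hA Cf Ch).
  apply: le_trans (NM _ _) _; apply: le_trans (ler_wpM2l (Nge0 _) (NM _ _)) _.
  have := Nge0 (iG h); have := Nge0 (iG f).
  move: (N (iG h)) (N (iG f)) Nh => u v u1 v0 u0.
  have : u * (v * u) <= 1 * (v * 1) by apply: ler_pM; rewrite ?mulr_ge0// ler_wpM2l.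
  by rewrite mul1r mulr1.
apply: le_trans Nb.
have -> : iG b = emb (iI c0) by rewrite eI// ec.
rewrite -lee_fin [X in (_ <= X)%E](_ : _ = universal_norm (iI c0)); last exact: (uN (fun a => N (emb a))).1 NeC (iI c0).
pose psi (a : B) := ell1_eval hG hA x (emb a).
have evpos := ell1_eval_positive hG etG cs hA ux.
have psipos : positive_functional psi.
  have [pD pZ pS p0] := evpos; rewrite /psi; split => [a a'|z a|a|a].
  - by rewrite eD// pD.
  - by rewrite eZ// pZ.
  - by rewrite eS// pS.
  - by rewrite eM// eS.
have psib a : complex.Re (psi a) <= rnorm a.
  by rewrite -eN; exact: ell1_eval_Re_le.
have [H [pi [e [rp pie _ edot]]]] := gns psipos psib.
have Chs := Cc_invol hG cs Ch.
have hsu m : invol s h m <> 0 -> units G m.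
  rewrite /invol => hm; have /hu : h (ginv m) <> 0 by move=> hi; apply: hm; rewrite hi conjC0 mulr0.
  by move=> um; rewrite -(ginvK m) (units_inv um).
have [E1 E2] : psi (bmul (bstar (iI h0)) (bmul (iI c0) (iI h0))) = b x /\
   psi (bmul (bstar (iI h0)) (iI h0)) = 1.
  rewrite /psi !eM// eS// !eI// ec eh -(ell1S hA)//.
  rewrite -(ell1M hA Cb Ch) -(ell1M hA Chs Ch) -(ell1M hA Chs (Cc_conv hG etG cs Cb Ch)).
  rewrite !ell1_eval_iota//; [|exact: Cc_conv|by apply: Cc_conv => //; exact: Cc_conv].
  rewrite !(conv_unit_l cs _ _ hsu) (conv_unit_r cs _ _ hu).
  by rewrite ?(units_rng ux) ?(units_src ux) (invol_unit cs)// hx conjC1 !mul1r mulr1.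
have v1 : rnorm (e (iI h0)) = 1.
  have : rnorm (e (iI h0)) ^+ 2 = 1.
    by apply: complexI; rewrite -hdot_rnorm edot E2.
  by move=> /eqP; rewrite sqrf_eq1 => /orP[/eqP//|/eqP h']; have := rnorm_ge0 (e (iI h0)); rewrite h'; lra.
have bx : b x = f x.
  by rewrite bE (units_rng ux) (units_src ux) hx mul1r mulr1.
have inner : hdot (pi (iI c0) (e (iI h0))) (e (iI h0)) = f x.
  by rewrite pie edot E1.
have := hdot_cauchy_schwarz (pi (iI c0) (e (iI h0))) (e (iI h0)).
rewrite inner v1 mulr1 => fle.
apply: (@le_trans _ _ (opnorm (pi (iI c0)))); last first.
  by apply: ereal_sup_ubound; exists H, pi.
by apply: (@opnorm_ge _ _ _ (e (iI h0)) _ 1); rewrite ?v1 ?mulr1.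
Qed.

Lemma eval_bound (x : G) a : good_unit x -> rnorm (ell1_eval hG hA x a) <= N a.
Proof.
move=> gx; apply/ler_addgt0Pr => e e0.
have [|f Cf af] := ell1_dense hA a (_ : 0 < e / 2); first lra.
have := eval_bound_Cc gx Cf; have := ell1_evalP hG hA x a Cf.
have := rnormD (ell1_eval hG hA x a - f x) (f x); rewrite subrK.
have [ND _ _ _ _] := NC.
have := ND (iG f - a) a; rewrite subrK.
have := cstar_seminorm_contractive NS (iG f - a); rewrite [rnorm (iG f - a)]rnormB; lra.
Qed.

(** At a unit [x], for [g] in [Cc], this is the squared l2 norm of [g] on the fibre of [x]; as a
    value of a convolution it is continuous in [x]. *)
Definition sq_sum g (x : G) : R := complex.Re (Defs.conv s (invol s g) g x).

Lemma sq_sum_eval g x : Cc g -> units G x ->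
  snorm (gns_dot (ell1_eval hG hA x)) (iG g) ^+ 2 = sq_sum g x.
Proof.
move=> Cg ux; rewrite (snorm_sq (gns_semi (ell1_eval_positive hG etG cs hA ux))) /gns_dot.
have Cgs := Cc_invol hG cs Cg.
by rewrite -(ell1S hA)// -(ell1M hA)// ell1_eval_iota//; exact: Cc_conv.
Qed.

Lemma sq_sum_continuous g : Cc g -> continuous (sq_sum g).
Proof.
move=> Cg x; have Cgs := Cc_invol hG cs Cg.
have := conv_continuous hG etG cs Cgs.1 Cg (x := x) => /cvgrPdist_le h.
apply/cvgrPdist_le => e e0; have := h e%:C%C; rewrite ltcR => /(_ e0).
apply: filterS => y; rewrite rnorm_le => xy.
by rewrite /sq_sum -cReN -cReD; exact: le_trans (cRe_le_rnorm _) xy.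
Qed.

Hypothesis secG : @second_countable G.

Theorem sq_sum_conv_le f g x : Cc f -> Cc g -> units G x ->
  sq_sum (Defs.conv s f g) x <= N (iG f) ^+ 2 * sq_sum g x.
Proof.
move=> Cf Cg ux; have Cfg := Cc_conv hG etG cs Cf Cg.
have [_ _ _ NM NSt] := NC.
have good y : good_unit y -> sq_sum (Defs.conv s f g) y <= N (iG f) ^+ 2 * sq_sum g y.
  move=> gy; have [uy _] := gy.
  rewrite -!sq_sum_eval// (ell1M hA)// -NSt.
  apply: positive_functional_le => //.
  - exact: (ell1_eval_positive hG etG cs hA).
  - exact: (cstar_seminorm_ge0 NS).
  - move=> a; apply: le_trans (ler_norm _) _; apply: le_trans (cRe_le_rnorm _) _.
    exact: eval_bound.
(* A violation at [x] would persist on an open set, which contains a good unit. *)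
rewrite leNgt; apply/negP => lt.
pose D y := sq_sum (Defs.conv s f g) y - N (iG f) ^+ 2 * sq_sum g y.
have cD : continuous D.
  move=> y; apply: cvgB; first exact: sq_sum_continuous.
  by apply: cvgM; [exact: cvg_cst|exact: sq_sum_continuous].
have oD : open (D @^-1` [set t | 0 < t]).
  by apply: open_comp; [move=> y _; exact: cD|exact: open_gt].
have Dx : (D @^-1` [set t | 0 < t]) x by rewrite /= subr_gt0.
have [y Dy gy] := good_units_dense hG etG secG lcG R oD Dx ux.
by move: Dy; rewrite /= subr_gt0 ltNge good.
Qed.

End StateBound.

Lemma ler_sum_uniq (R : realType) (T : eqType) (F : T -> R) (r q : seq T) : uniq r -> uniq q ->
  (forall m, 0 <= F m) -> (forall m, m \in r -> F m != 0 -> m \in q) ->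
  \sum_(m <- r) F m <= \sum_(m <- q) F m.
Proof.
move=> ur uq F0 rq.
rewrite (bigID (mem q))/= [X in _ + X]big1_seq ?addr0; last first.
  by move=> m /andP[mq mr]; apply/eqP; apply: contraNT mq; exact: rq.
rewrite -big_filter [leRHS](bigID (mem r))/= -[\sum_(_ <- q | _ \in r) _]big_filter.
rewrite (perm_big [seq i <- q | i \in r]) ?lerDl ?sumr_ge0//.
by apply: uniq_perm; rewrite ?filter_uniq// => m; rewrite !mem_filter andbC.
Qed.

Section RegularBound.
Variables (R : realType) (G : topGroupoid) (hG : hausdorff_space G) (etG : etale G).
Variables (lcG : locally_compact [set: G]).
Variables (s : G * G -> R[i]) (cs : Z2 R G s).
Implicit Types f g : G -> R[i].

(** Each bump is supported where [src] is injective, so it meets the fibre in one point only. *)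
Lemma Cc_interpolate (x : G) (xi : G -> R[i]) (q : seq G) : uniq q ->
  (forall m, m \in q -> src m = x) -> exists2 eta : G -> R[i], Cc eta &
  forall m, src m = x -> eta m = if m \in q then xi m else 0.
Proof.
elim: q => [_ _|m0 q IH /= /andP[m0q uq] qx].
  exists (fun=> 0) => [|m _]; last by rewrite in_nil.
  by apply: (Cc_intro hG _ (@compact0 G)) => //; exact: cst_continuous.
have [|eta Ceta etaE] := IH uq; first by move=> m mq; apply: qx; rewrite inE mq orbT.
have m0x : src m0 = x by apply: qx; rewrite inE eqxx.
have [U [V [k [oU Um0 _ _ [kU _ _]]]]] := src_section etG m0.
have [h [K [Ch hm0 _ [_ KU] hK]]] := Cc_bump R hG lcG oU Um0.
exists (xi m0 *: h + eta); first by apply: CcD => //; exact: CcZ.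
move=> m mx; have -> : (xi m0 *: h + eta) m = xi m0 * h m + eta m by [].
rewrite etaE// inE; have [->|mm0] := eqVneq m m0.
  by rewrite hm0 mulr1 (negbTE m0q) addr0.
suff -> : h m = 0 by rewrite mulr0 add0r.
apply: contrapT => /hK/KU Um; move/eqP: mm0; apply.
by rewrite -(kU m Um) mx -m0x kU.
Qed.

(** Only the term [m = gmul h (ginv g)] of the defining sum reaches the coordinate [h]. *)
Lemma regular_deltaE f (g h : G) : Cc f -> src g = src h ->
  regular_delta s f g h = s (gmul h (ginv g), g) * f (gmul h (ginv g)).
Proof.
move=> Cf gh; have [K [cK _ fK]] := Cc_support Cf.
have /finite_seqP[r0 rE] := compact_fibre_finite etG (rng g) hG cK.
have rP m : m \in undup r0 <-> K m /\ src m = rng g.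
  by rewrite mem_undup -[_ /\ _]/((K `&` src_fibre (rng g)) m) rE /=; split.
rewrite /regular_delta (@fsum_seq _ _ _ (undup r0)) ?undup_uniq//; first last.
- move=> m mg Fm; apply/rP; split=> //; apply: fK => fm.
  by move: Fm; rewrite fm mulr0 scale0r eqxx.
- by move=> m /= /rP[].
rewrite fct_sumE; set m0 := gmul h (ginv g).
have dE m : m \in undup r0 -> delta R (gmul m g) h = (m == m0)%:R.
  move=> /rP[_ mg]; rewrite /delta; congr (_%:R); congr nat_of_bool.
  apply/eqP/eqP => [hE|->]; last by rewrite /m0 gmulKV.
  by rewrite /m0 hE gmulK.
have sm0 : src m0 = rng g by rewrite /m0 src_mul ?src_inv// rng_inv gh.
have [m0r|m0r] := boolP (m0 \in undup r0).
  rewrite (bigD1_seq m0) ?undup_uniq//= big1_seq.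
    by rewrite addr0 -[LHS]/((s (m0, g) * f m0) * delta R (gmul m0 g) h) dE// eqxx mulr1.
  move=> m /andP[mm0 mr]; rewrite -[LHS]/((s (m, g) * f m) * delta R (gmul m g) h).
  by rewrite dE// (negbTE mm0) mulr0.
have -> : f m0 = 0.
  by apply: contrapT => /fK Km0; move/negP: m0r; apply; apply/rP.
rewrite mulr0 big1_seq// => m /andP[_ mr].
rewrite -[LHS]/((s (m, g) * f m) * delta R (gmul m g) h) dE//.
by case: eqP => [mm0|]; rewrite ?mulr0//; move: m0r; rewrite -mm0 mr.
Qed.

Lemma sq_sum_seq_ge f (x : G) (r : seq G) : units G x -> Cc f -> uniq r ->
  (forall m, m \in r -> src m = x) -> \sum_(m <- r) rnorm (f m) ^+ 2 <= sq_sum s f x.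
Proof.
move=> ux Cf ur rx; have [q [uq qx fq e]] := sum_sq_seq hG etG x Cf.
rewrite /sq_sum (conv_invol_unit cs)// e /=.
apply: ler_sum_uniq => // [m|m mr]; first exact: sqr_ge0.
by rewrite sqrf_eq0 => fm; apply: fq; [exact: rx|move=> f0; rewrite f0 rnorm0 eqxx in fm].
Qed.

Lemma sq_sum_seq_le f (x : G) (q : seq G) : units G x -> Cc f -> uniq q ->
  (forall m, src m = x -> m \notin q -> f m = 0) -> sq_sum s f x <= \sum_(m <- q) rnorm (f m) ^+ 2.
Proof.
move=> ux Cf uq fq; have [r [ur rx fr e]] := sum_sq_seq hG etG x Cf.
rewrite /sq_sum (conv_invol_unit cs)// e /=.
apply: ler_sum_uniq => // [m|m mr]; first exact: sqr_ge0.
by apply: contraNT => /fq->; rewrite ?rnorm0 ?expr0n//; exact: rx.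
Qed.

(** [xi] is an arbitrary square-summable vector, while the hypothesis concerns [Cc]. Finitely many
    coordinates [r] of the image depend only on the coordinates of [xi] in a finite set [q], where
    the inverse of the support of [f] carries [r]; a function [eta] in [Cc] agreeing with [xi] on
    [q] does the same. *)
Lemma regular_norm_le f (x : G) (K : R) : Cc f -> units G x -> 0 <= K ->
  (forall g, Cc g -> sq_sum s (Defs.conv s f g) x <= K ^+ 2 * sq_sum s g x) ->
  (regular_norm s x f <= K%:E)%E.
Proof.
move=> Cf ux K0 le; apply: ub_ereal_sup => _ [xi /= xi1 <-].
have -> : K%:E = sqrte (K ^+ 2)%:E by rewrite /= sqrtr_sqr ger0_norm.
rewrite /ell2_norm lee_sqrt ?lee_fin ?sqr_ge0//.
have xi2 : (\esum_(g in src_fibre x) (rnorm (xi g) ^+ 2)%:E <= 1)%E.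
  by rewrite -lee_sqrt ?lee01// [sqrte 1%E]/= sqrtr1.
apply: esum_le_seq => r ur rx; rewrite lee_fin.
have [L [cL _ fL]] := Cc_support Cf.
pose Q := [set gmul p.1 p.2 | p in (ginv @` L `*` [set` r]) `&` composable G].
have cQ : compact Q.
  apply: (compact_mul hG); last by apply: finite_compact; apply/finite_seqP; exists r.
  by apply: continuous_compact => //; apply: continuous_subspaceT; exact: ginv_continuous.
have /finite_seqP[q0 qE] := compact_fibre_finite etG x hG cQ.
pose q := undup q0.
have qP m : m \in q <-> Q m /\ src m = x.
  by rewrite mem_undup -[_ /\ _]/((Q `&` src_fibre x) m) qE /=; split.
have uq : uniq q := undup_uniq _.
have [|eta Ceta etaE] := @Cc_interpolate x xi q uq; first by move=> m /qP[].
have rE h : h \in r -> regular s x f xi h = Defs.conv s f eta h.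
  move=> hr; rewrite /regular /Defs.conv (rx _ hr); apply: eq_fsbigr => m.
  rewrite inE /src_fibre /= => mx; rewrite regular_deltaE ?mx ?rx// etaE//.
  case: ifPn => [_|mq]; first by ring.
  suff -> : f (gmul h (ginv m)) = 0 by rewrite !(mulr0, mul0r).
  apply: contrapT => /fL fm; move/negP: mq; apply; apply/qP; split => //.
  have hm : src h = rng (ginv m) by rewrite rng_inv mx rx.
  exists (ginv (gmul h (ginv m)), h) => /=; first split => //=.
  - by split => //; exists (gmul h (ginv m)).
  - by rewrite /composable /= src_inv rng_mul.
  rewrite -[RHS](gmulVK (a := gmul h (ginv m)) (b := m)).
    by rewrite gmulKV// mx rx.
  by rewrite src_mul// src_inv.
have -> : \sum_(m <- r) rnorm (regular s x f xi m) ^+ 2 = \sum_(m <- r) rnorm (Defs.conv s f eta m) ^+ 2.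
  by apply: eq_big_seq => m mr; rewrite rE.
apply: le_trans (sq_sum_seq_ge ux (Cc_conv hG etG cs Cf Ceta) ur rx) _.
apply: le_trans (le _ Ceta) _; rewrite -[leRHS]mulr1 ler_wpM2l ?sqr_ge0//.
apply: (@le_trans _ _ (\sum_(m <- q) rnorm (xi m) ^+ 2)).
  have -> : \sum_(m <- q) rnorm (xi m) ^+ 2 = \sum_(m <- q) rnorm (eta m) ^+ 2.
    by apply: eq_big_seq => m mq; have /qP[_ mx] := mq; rewrite etaE// mq.
  by apply: sq_sum_seq_le => // m mx mq; rewrite etaE// (negbTE mq).
rewrite -lee_fin; apply: le_trans xi2.
by apply: esum_seq_ge => // m /qP[].
Qed.

End RegularBound.

(** * Comparison of the norms and conclusion *)

Lemma star_rep_iota_le (R : realType) (G : topGroupoid) (s : G * G -> R[i])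
  (A : banachStarAlg R) (iG : (G -> R[i]) -> A) (hA : is_ell1 s iG)
  (H : hilbert R) (pi : bsa_data A -> {linear H -> H}) (f : G -> R[i]) :
  star_rep pi -> Cc f -> (opnorm (pi (iG f)) <= full_norm s f)%E.
Proof.
move=> rp Cf; apply: ereal_sup_ubound; exists H, (fun g : Cc_alg s => pi (iG g)); split => //.
- have [pc pD pZ pM pS] := rp; split => [g _|g h Cg Ch x|c g Cg x|g h Cg Ch x|g Cg x y].
  + exact: pc.
  + by rewrite (ell1D hA Cg Ch) pD.
  + by rewrite (ell1Z hA c Cg) pZ.
  + by rewrite [iG _](ell1M hA Cg Ch) pM.
  + by rewrite pS//; congr (hdot x (pi _ y)); rewrite -[LHS](ell1S hA Cg).
- exists 1 => g Cg; rewrite mul1e -(ell1_norm hA Cg).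
  exact: star_rep_contractive.
Qed.

Theorem proposition3p2 (R : realType) (G : topGroupoid)
  (secG : @second_countable G)
  (lcG : locally_compact [set: G])
  (hausG : hausdorff_space G)
  (etG : etale G)
  (s : G * G -> R[i])
  (cocs : Z2 R G s)
  (wcs : weak_containment s)
  (ell1G : banachStarAlg R) (iG : (G -> R[i]) -> ell1G)
  (ell1I : banachStarAlg R) (iI : (iso_interior etG -> R[i]) -> ell1I)
  (hG : is_ell1 s iG)
  (hI : is_ell1 (iso_cocycle (etG := etG) s) iI) :
  cstar_unique ell1I -> cstar_unique ell1G.
Proof.
move=> uI; have redG := ell1_reduced hausG etG cocs hG.
split => // N; split=> [NC|]; last exact: universal_cstar_norm.
have NS := cstar_norm_seminorm NC; have N0 a := cstar_seminorm_ge0 NS a.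
have redN f : Cc f -> (reduced_norm s f <= (N (iG f))%:E)%E.
  move=> Cf; apply: ub_ereal_sup => _ [->|[x ux <-]]; first by rewrite lee_fin.
  apply: (regular_norm_le hausG etG lcG cocs Cf ux (N0 _)) => g Cg.
  exact: (sq_sum_conv_le hausG lcG cocs hG hI NC uI secG Cf Cg ux).
move=> a; apply/eqP; rewrite eq_le cstar_seminorm_le_universal//=.
apply: ub_ereal_sup => _ [H [pi [rp ->]]].
have pE b : opnorm (pi b) = (fine (opnorm (pi b)))%:E.
  by apply: opnormE; case: rp => + _ _ _ _; apply.
have [piD _ _ _] := star_rep_seminorm rp; have [ND _ _ _] := NS.
have piN f : Cc f -> fine (opnorm (pi (iG f))) <= N (iG f).
  move=> Cf; rewrite -lee_fin -pE; apply: le_trans (star_rep_iota_le hG rp Cf) _.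
  apply: le_trans (redN f Cf); apply: weak_containment_full_le => //.
    by move=> g; exact: Cc_invol.
  by move=> g h; exact: Cc_conv.
(* [N] and the seminorm of [pi] are both bounded by the norm of [ell1G], so the inequality extends
   from the dense image of [Cc]. *)
rewrite pE lee_fin; apply/ler_addgt0Pr => e e0.
have [|f Cf af] := ell1_dense hG a (_ : 0 < e / 2); first lra.
have := piN f Cf; have := piD (a - iG f) (iG f); have := ND (iG f - a) a; rewrite !subrK.
have := cstar_seminorm_contractive NS (iG f - a).
have := cstar_seminorm_contractive (star_rep_seminorm rp) (a - iG f).
by rewrite [rnorm (iG f - a)]rnormB; lra.
Qed.
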